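(* Let $f_0:\Lambda\to\mathbb{R}^d$ and $f:\mathbb{R}^d\times\Lambda\to\mathbb{R}^d$ be locally Lipschitz, with $\int_\Lambda f_0\,d\mu=0$, and assume that the compact invariant set $\Lambda$ of the fast equation $\dot y=g(y)$, with ergodic invariant probability measure $\mu$, is mildly chaotic, i.e. satisfies the weak invariance principle (WIP) for $f_0$ with covariance matrix $\Sigma$. Define $F(x)=\int_\Lambda f(x,y)\,d\mu(y)$ and let $\xi\in\mathbb{R}^d$. For $\epsilon>0$ let $x^{(\epsilon)},y^{(\epsilon)}$ denote the solutions to the fast-slow system \[ \dot x^{(\epsilon)}=\epsilon^{-1}f_0(y^{(\epsilon)})+f(x^{(\epsilon)},y^{(\epsilon)}),\quad x^{(\epsilon)}(0)=\xi,\qquad \dot y^{(\epsilon)}=\epsilon^{-2}g(y^{(\epsilon)}),\quad y^{(\epsilon)}(0)=\eta . \] Assume that solutions $X$ to the SDE \[ dX=\sqrt\Sigma\,dW+F(X)\,dt,\qquad X(0)=\xi, \] where $W$ is unit $d$-dimensional Brownian motion, exist on $[0,\infty)$ with probability one. Then $x^{(\epsilon)}\to_w X$ in $C([0,\infty),\mathbb{R}^d)$ as $\epsilon\to0$.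
   Context: Fast dynamics: $g:\mathbb{R}^\ell\to\mathbb{R}^\ell$ is a locally Lipschitz vector field, and $\Lambda\subset\mathbb{R}^\ell$ is a compact set invariant under the flow of $\dot y=g(y)$, with ergodic invariant probability measure $\mu$ supported on $\Lambda$. The initial condition $\eta\in\Lambda$ is the only source of randomness and is distributed according to $\mu$; $\xi$ is fixed. Mildly chaotic / WIP (continuous time): let $y(t)$ be the solution of $\dot y=g(y)$, $y(0)=\eta$, and $W_n(t)=n^{-1/2}\int_0^{nt}f_0(y(s))\,ds$. The assumption is that $W_n\to_w\sqrt\Sigma\,W$ in $C([0,\infty),\mathbb{R}^d)$, where $W$ is unit $d$-dimensional Brownian motion and $\Sigma$ is a $d\times d$ covariance matrix. Convention for weak convergence when $x^{(\epsilon)}$ may blow up: let $[0,\tau_\epsilon]$ be the maximal interval of existence of the solution $x^{(\epsilon)}$ (depending on $\eta$), and define $x^{(\epsilon)}_*(t)=x^{(\epsilon)}(t)$ for $0\le t\le\tau_\epsilon/2$ and $x^{(\epsilon)}_*(t)=x^{(\epsilon)}(\tau_\epsilon/2)$ for $t\ge\tau_\epsilon/2$ (if $x^{(\epsilon)}$ exists on $[0,\infty)$, set $x^{(\epsilon)}_*\equiv x^{(\epsilon)}$ and $\tau_\epsilon=\infty$). Then ''$x^{(\epsilon)}\to_w X$ in $C([0,\infty),\mathbb{R}^d)$'' means that $\tau_\epsilon\to\infty$ in probability and $x^{(\epsilon)}_*$ converges weakly (in the sense of probability measures) to $X$ in $C([0,\infty),\mathbb{R}^d)$, with the topology of uniform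 convergence on compact sets. *)

(* Defs.v *)
From HB Require Import structures.
From mathcomp Require Import all_boot all_order all_algebra.
From mathcomp Require Import all_classical all_reals all_analysis.
From mathcomp Require Import measurable_realfun.

Set Implicit Arguments.
Unset Strict Implicit.
Unset Printing Implicit Defensive.

Import Order.TTheory GRing.Theory Num.Theory.
Import numFieldNormedType.Exports.

Local Open Scope classical_set_scope.
Local Open Scope ring_scope.

Definition halfline (R : realType) : set R := [set t : R | 0 <= t].
Arguments halfline : clear implicits.

(* C([0,oo), R^d), with the topology of uniform convergence on compact sets. *)
Definition path_space (R : realType) (d : nat) : Type :=
  continuousType (halfline R) 'rV[R]_d.

HB.instance Definition _ (R : realType) (d : nat) :=
  Choice.on (path_space R d).

Definition path_fun (R : realType) (d : nat) (p : path_space R d) :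
    {family compact, halfline R -> 'rV[R]_d} :=
  (p : continuousType (halfline R) 'rV[R]_d) : halfline R -> 'rV[R]_d.

HB.instance Definition _ (R : realType) (d : nat) :=
  Topological.copy (path_space R d) (initial_topology (@path_fun R d)).

Definition path0 (R : realType) (d : nat) : path_space R d :=
  mkcts (@cst_continuous (halfline R) 'rV[R]_d 0).

HB.instance Definition _ (R : realType) (d : nat) :=
  isPointed.Build (path_space R d) (@path0 R d).

(* The path [0,oo) -> R^d underlying a function of a real time; the zero path
   is a junk value, taken only when h is not continuous on [0,oo). *)
Definition path_of (R : realType) (d : nat) (h : R -> 'rV[R]_d) :
    path_space R d :=
  match pselect (continuous (h \o set_val : halfline R -> 'rV[R]_d)) with
  | left hc => mkcts hc
  | right _ => @path0 R d
  end.

Notation borel T := (g_sigma_algebraType (@open T)).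

(* X is a random element of C([0,oo), R^d), defined for outcomes in D. *)
Definition random_path (R : realType) (d : nat) (disp : measure_display)
    (T : measurableType disp) (D : set T) (X : T -> R -> 'rV[R]_d) : Prop :=
  (forall w, D w -> continuous (X w \o set_val : halfline R -> 'rV[R]_d)) /\
  measurable_fun D (fun w => path_of (X w) : borel (path_space R d)).

(* Weak convergence in C([0,oo), R^d), along the filter F, of the laws of X i
   under mu (carried by D) to the law of Y under P. *)
Definition weak_cvg (R : realType) (d : nat) (I : Type) (F : set_system I)
    (d1 : measure_display) (T : measurableType d1) (mu : probability T R)
    (D : set T) (X : I -> T -> R -> 'rV[R]_d)
    (d2 : measure_display) (U : measurableType d2) (P : probability U R)
    (Y : U -> R -> 'rV[R]_d) : Prop :=
  [/\ \forall i \near F, random_path D (X i),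
      random_path setT Y &
      forall Phi : path_space R d -> R, continuous Phi ->
        (exists M, forall p, `|Phi p| <= M) ->
        (\int[mu]_(w in D) Phi (path_of (X i w))) @[i --> F] -->
        \int[P]_w Phi (path_of (Y w))].

Definition row_integral (R : realType) (d : nat) (disp : measure_display)
    (T : measurableType disp) (mu : {measure set T -> \bar R}) (D : set T)
    (h : T -> 'rV[R]_d) : 'rV[R]_d :=
  \row_j \int[mu]_(x in D) h x 0 j.

Definition time_integral (R : realType) (d : nat) (t : R)
    (h : R -> 'rV[R]_d) : 'rV[R]_d :=
  row_integral lebesgue_measure `[0, t] h.

Definition locally_lipschitz (R : realType) (V W : normedModType R)
    (A : set V) (h : V -> W) : Prop :=
  forall x, A x ->
    exists2 U, nbhs x U & [lipschitz h z | z in A `&` U].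

Section fast_dynamics.
Context (R : realType) (l : nat).
Local Notation V := 'rV[R]_l.

(* Lambda is invariant under the flow phi of the ODE y' = g(y). *)
Definition invariant_flow (g : V -> V) (Lambda : set V) (phi : R -> V -> V) :
    Prop :=
  [/\ forall eta, Lambda eta -> phi 0 eta = eta,
      forall (eta : V) (t : R), Lambda eta ->
        is_derive t 1 (fun s => phi s eta) (g (phi t eta)) &
      forall t, phi t @` Lambda = Lambda].

Definition ergodic_measure (Lambda : set V) (phi : R -> V -> V)
    (mu : probability (borel V) R) : Prop :=
  [/\ mu Lambda = 1%E,
      forall (t : R) (A : set (borel V)), measurable A ->
        mu (Lambda `&` phi t @^-1` A) = mu A &
      forall A : set (borel V), measurable A -> A `<=` Lambda ->
        (forall t, Lambda `&` phi t @^-1` A = A) -> mu A = 0%E \/ mu A = 1%E].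

End fast_dynamics.

Definition pos_semidef (R : realType) (d : nat) (S : 'M[R]_d) : Prop :=
  S^T = S /\ forall u : 'rV[R]_d, 0 <= (u *m S *m u^T) 0 0.

(* S is the square root of the covariance matrix Sigma. *)
Definition covariance_sqrt (R : realType) (d : nat) (Sigma S : 'M[R]_d) :
    Prop :=
  [/\ pos_semidef Sigma, pos_semidef S & S *m S = Sigma].

(* The last clause says that the increments over successive intervals are
   independent and that W(t) - W(s) is N(0, (t - s) I_d). *)
Definition brownian_motion (R : realType) (d : nat) (disp : measure_display)
    (Omega : measurableType disp) (P : probability Omega R)
    (W : Omega -> R -> 'rV[R]_d) : Prop :=
  [/\ random_path setT W,
      {ae P, forall w, W w 0 = 0} &
      forall (n : nat) (t : nat -> R), 0 <= t 0%N ->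
        (forall i, t i < t i.+1) ->
        forall B : 'I_n -> 'I_d -> set R, (forall i j, measurable (B i j)) ->
        P [set w | forall i j, B i j ((W w (t i.+1) - W w (t i)) 0 j)] =
        (\prod_(i < n) \prod_(j < d)
           normal_prob 0 (Num.sqrt (t i.+1 - t i)) (B i j))%E].

(* Vectors are rows; S is symmetric, so this is S W. *)
Definition scaled_path (R : realType) (d : nat) (Omega : Type) (S : 'M[R]_d)
    (W : Omega -> R -> 'rV[R]_d) (w : Omega) (t : R) : 'rV[R]_d :=
  W w t *m S.

Definition W_ (R : realType) (d l : nat) (f0 : 'rV[R]_l -> 'rV[R]_d)
    (phi : R -> 'rV[R]_l -> 'rV[R]_l) (n : nat) (eta : 'rV[R]_l) (t : R) :
    'rV[R]_d :=
  (Num.sqrt n%:R)^-1 *: time_integral (n%:R * t) (fun s => f0 (phi s eta)).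

Definition mildly_chaotic (R : realType) (d l : nat)
    (f0 : 'rV[R]_l -> 'rV[R]_d) (Lambda : set 'rV[R]_l)
    (phi : R -> 'rV[R]_l -> 'rV[R]_l) (mu : probability (borel 'rV[R]_l) R)
    (S : 'M[R]_d)
    (disp : measure_display) (Omega : measurableType disp)
    (P : probability Omega R) (W : Omega -> R -> 'rV[R]_d) : Prop :=
  weak_cvg \oo mu Lambda (W_ f0 phi) P (scaled_path S W).

(* As the noise is additive, the SDE dX = S dW + F(X) dt is a pathwise
   integral equation. *)
Definition sde_solution (R : realType) (d : nat) (xi : 'rV[R]_d)
    (S : 'M[R]_d) (F : 'rV[R]_d -> 'rV[R]_d)
    (disp : measure_display) (Omega : measurableType disp)
    (P : probability Omega R) (W X : Omega -> R -> 'rV[R]_d) : Prop :=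
  random_path setT X /\
  {ae P, forall w, forall t, 0 <= t ->
    X w t = xi + scaled_path S W w t + time_integral t (fun s => F (X w s))}.

Section fast_slow.
Context (R : realType) (d l : nat).
Context (f0 : 'rV[R]_l -> 'rV[R]_d) (f : 'rV[R]_d * 'rV[R]_l -> 'rV[R]_d).
Context (g : 'rV[R]_l -> 'rV[R]_l) (Lambda : set 'rV[R]_l).
Context (xi : 'rV[R]_d).

(* (x, y) solves the fast-slow system on [0,tau).  The slow vector field is
   defined only on R^d x Lambda. *)
Definition fast_slow_solution (eps : R) (eta : 'rV[R]_l) (tau : \bar R)
    (x : R -> 'rV[R]_d) (y : R -> 'rV[R]_l) : Prop :=
  let J := [set t : R | 0 <= t /\ (t%:E < tau)%E] in
  [/\ (0 < tau)%E,
      x 0 = xi /\ y 0 = eta,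
      {within J, continuous x} /\ {within J, continuous y},
      forall t, J t -> Lambda (y t) &
      forall t : R, J t -> 0 < t ->
        is_derive t 1 x (eps^-1 *: f0 (y t) + f (x t, y t)) /\
        is_derive t 1 y ((eps ^+ 2)^-1 *: g (y t))].

Definition maximal_solution (eps : R) (eta : 'rV[R]_l) (tau : \bar R)
    (x : R -> 'rV[R]_d) (y : R -> 'rV[R]_l) : Prop :=
  fast_slow_solution eps eta tau x y /\
  forall tau' x' y', fast_slow_solution eps eta tau' x' y' -> (tau' <= tau)%E.

End fast_slow.

(* The path x stopped at time tau / 2. *)
Definition stopped_path (R : realType) (d : nat) (tau : \bar R)
    (x : R -> 'rV[R]_d) (t : R) : 'rV[R]_d :=
  if tau is r%:E then x (Num.min t (r / 2)) else x t.

(* Weak convergence, as eps -> 0+, of paths x eps that may blow up at the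
   time tau eps. *)
Definition weak_cvg_blowup (R : realType) (d : nat)
    (d1 : measure_display) (T : measurableType d1) (mu : probability T R)
    (D : set T) (tau : R -> T -> \bar R) (x : R -> T -> R -> 'rV[R]_d)
    (d2 : measure_display) (U : measurableType d2) (P : probability U R)
    (X : U -> R -> 'rV[R]_d) : Prop :=
  [/\ \forall eps \near 0^'+, measurable_fun D (tau eps),
      forall M : R,
        mu (D `&` [set w | (tau eps w <= M%:E)%E]) @[eps --> 0^'+] --> 0%E &
      weak_cvg 0^'+ mu D (fun eps w => stopped_path (tau eps w) (x eps w))
        P X].

(* Main.v *)
(* Cut the slow vector field off outside the ball of radius K: on a time interval
   on which the truncated solution stays inside the ball it is the solution of the
   fast-slow system. Since the noise is additive, the limit equation is solved
   pathwise: x = G(w), where G is the solution map of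
   x(t) = xi + w(t) + int_0^t F(x(s)) ds with F truncated as well, and by Gronwall's
   lemma G is Lipschitz for the sup norm on each compact time interval. Hence the
   invariance principle gives G(N_eps) ->_w G(sqrt(Sigma) W) for the noise
   N_eps(t) = eps^-1 int_0^t f_0(y(s)) ds.
   It remains to compare the truncated solution with G(N_eps). On short time windows
   the slow variable moves little, by tightness of N_eps; freezing it there, at one of
   finitely many points u, leaves time averages of f(u, .) - F(u) along the fast orbit,
   which tend to 0 in mean by the mean ergodic theorem (obtained from the ergodicity of
   the whole flow). Finally, as X does not blow up, K can be chosen so that G(sqrt(Sigma) W),
   hence also the truncated solution, leaves the ball with small probability; this also
   shows that the blow-up time tends to infinity in probability. *)

Require Import Defs.
From mathcomp Require Import all_boot all_order all_algebra.
From mathcomp Require Import all_classical all_reals all_analysis.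
From mathcomp Require Import measurable_realfun ring lra.

Set Implicit Arguments.
Unset Strict Implicit.
Unset Printing Implicit Defensive.

Import Order.TTheory GRing.Theory Num.Theory.
Import numFieldNormedType.Exports.
Local Open Scope classical_set_scope.
Local Open Scope ring_scope.

(** * Row vectors *)

(** The measure [mu] is ergodic for the flow as a whole, but the time-one map may fail to be
    ergodic, so the ergodic theorem cannot simply be quoted for it. What rescues the argument is
    that a shift in time changes an integral along the orbit by a bounded amount: the limsup sets of
    the averages are therefore invariant under every [phi t], and ergodicity of the flow makes them
    trivial. Weak convergence is used only through expectations of bounded functionals that are
    Lipschitz for the sup norm on some [0, T]. This class is stable under composition with the
    solution map, and it contains the modulus of continuity cut at 1, which replaces an explicit
    tightness statement. Lipschitz envelopes recover all bounded continuous functionals at the end.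
    Exceptional events are likewise replaced by functions of [eta] with small mean: one dominates
    the averaging error, and a Lipschitz cutoff dominates the exit from the ball. Measurability is a
    separate obstacle: the stopped path depends on [eta] through the blow-up time, for which only
    lower semicontinuity is shown. *)

Section row_vectors.
Context (R : realType) (n : nat).
Local Notation V := 'rV[R]_n.

Lemma row_norm_le (v : V) (a : R) : 0 <= a ->
  (forall j, `|v 0 j| <= a) -> `|v| <= a.
Proof.
move=> a0 va; rewrite [`|v|]mx_normrE; apply: (big_ind (fun x => x <= a)) => //.
  by move=> x y xa ya; rewrite ge_max xa.
by move=> [i j] _ /=; rewrite (ord1 i).
Qed.

Lemma coord_norm_le (v : V) j : `|v 0 j| <= `|v|.
Proof.
rewrite [`|v|]mx_normrE.
exact: (le_bigmax_cond _ (fun i : 'I_1 * 'I_n => `|v i.1 i.2|) (j := (0, j))).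
Qed.

Lemma cvg_row (T : Type) (F : set_system T) (FF : Filter F) (u : T -> V) (v : V) :
  (forall j, u x 0 j @[x --> F] --> v 0 j) -> u x @[x --> F] --> v.
Proof.
move=> uv A [B vB sBA].
suff : \forall x \near F, forall i j, B i j (u x i j).
  by apply: filterS => x Bx; apply: sBA.
suff : \forall x \near F, forall j, B 0 j (u x 0 j).
  by apply: filterS => x Bx i j; rewrite (ord1 i).
by apply: filter_forall => j; exact: (uv j _ (vB 0 j)).
Qed.

Lemma cvg_coord (T : Type) (F : set_system T) (FF : Filter F) (u : T -> V) (v : V) j :
  u x @[x --> F] --> v -> u x 0 j @[x --> F] --> v 0 j.
Proof.
move=> uv; apply: (cvg_comp u (fun w : V => w 0 j) uv).
exact: coord_continuous.
Qed.

Lemma continuous_row (T : topologicalType) (u : T -> V) :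
  (forall j, continuous (fun x => u x 0 j)) <-> continuous u.
Proof.
split=> [uc x|uc j x]; first by apply: cvg_row => j; exact: uc.
by apply: cvg_coord; exact: uc.
Qed.

Lemma is_derive_row (u : R -> V) (t : R) (v : V) :
  (forall j, is_derive t 1 (fun s => u s 0 j) (v 0 j)) <-> is_derive t 1 u v.
Proof.
split=> [uv|uv j].
  have H : h^-1 *: (u (h *: 1 + t) - u t) @[h --> 0^'] --> v.
    apply: cvg_row => j.
    have [/cvg_ex[w /= hw] <-] := uv j.
    under eq_fun do rewrite !mxE.
    by apply: cvg_trans; [apply: hw|rewrite /derive (cvg_lim _ hw)].
  by split; [apply/cvg_ex; exists v|exact: cvg_lim].
have [/cvg_ex[w /= hw] <-] := uv.
have H : h^-1 *: (u (h *: 1 + t) 0 j - u t 0 j) @[h --> 0^'] --> w 0 j.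
  rewrite (_ : (fun _ => _) = fun h => (h^-1 *: (u (h *: 1 + t) - u t)) 0 j).
    exact: cvg_coord.
  by apply/funext => h; rewrite !mxE.
split; first by apply/cvg_ex; exists (w 0 j).
rewrite (_ : 'D_1 u t = w); last exact: cvg_lim.
exact: cvg_lim.
Qed.

End row_vectors.

(** * Clipping to an interval *)

Section clip.
Context (R : realType).

Definition clip (a b t : R) : R := Num.max a (Num.min b t).

Lemma clip_cont a b : continuous (clip a b).
Proof.
move=> t; apply: (@continuous_max _ _ (cst a) (fun t => Num.min b t)).
  exact: cst_continuous.
by apply: (@continuous_min _ _ (cst b) id) => //; exact: cst_continuous.
Qed.

Lemma clip_itv a b t : a <= b -> a <= clip a b t <= b.
Proof. by move=> ab; rewrite /clip le_max lexx /= ge_max ab ge_min lexx. Qed.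

Lemma clip_id a b t : a <= t <= b -> clip a b t = t.
Proof. by move=> /andP[at_ tb]; rewrite /clip (min_idPr tb) (max_idPr at_). Qed.

Lemma within_clip (V : topologicalType) (u : R -> V) (J : set R) a b : a <= b ->
  [set` `[a, b]] `<=` J -> {within J, continuous u} -> continuous (u \o clip a b).
Proof.
move=> ab abJ cu t.
have cu' := (continuous_subspaceW abJ cu).
have Ht : [set` `[a, b]] (clip a b t) by rewrite /= in_itv /= clip_itv.
move/subspace_continuousP : cu' => /(_ _ Ht) H A /H.
rewrite /= !nbhs_simpl /= /within /= => hA.
have := @clip_cont a b t _ hA.
apply: (@filterS _ (nbhs t)) => s /=.
by apply; rewrite in_itv /= clip_itv.
Qed.

End clip.

(** * Time integrals *)

Section scalar_integral.
Context (R : realType).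
Notation leb := (@lebesgue_measure R).
Implicit Types (h k : R -> R) (t a : R).

Definition sint h t : R := \int[leb]_(s in `[0, t]) h s.

Lemma cont_integrable h a b : continuous h ->
  leb.-integrable `[a, b] (EFin \o h).
Proof.
move=> hc; apply: continuous_compact_integrable; first exact: segment_compact.
exact: continuous_subspaceT.
Qed.

Lemma sintN h t : t <= 0 -> sint h t = 0.
Proof.
rewrite /sint le_eqVlt => /predU1P[->|t0]; first by rewrite set_itv1 Rintegral_set1.
by rewrite set_itv_ge ?Rintegral_set0 // bnd_simp -ltNge.
Qed.

Lemma sintD h k t : continuous h -> continuous k ->
  sint (fun s => h s + k s) t = sint h t + sint k t.
Proof. by move=> hc kc; rewrite /sint RintegralD //; exact: cont_integrable. Qed.

Lemma sintB h k t : continuous h -> continuous k ->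
  sint (fun s => h s - k s) t = sint h t - sint k t.
Proof. by move=> hc kc; rewrite /sint RintegralB //; exact: cont_integrable. Qed.

Lemma sintZ h c t : continuous h -> sint (fun s => c * h s) t = c * sint h t.
Proof. by move=> hc; rewrite /sint RintegralZl //; exact: cont_integrable. Qed.

Lemma sint_cst c t : 0 <= t -> sint (fun _ => c) t = c * t.
Proof.
move=> t0; rewrite /sint Rintegral_cst //.
have H : leb [set` `[0, t]] = t%:E.
  rewrite lebesgue_measure_itv /= lte_fin oppr0 adde0.
  by case: ltgtP t0 => // <-.
by congr (_ * _); exact: (congr1 fine H).
Qed.

Lemma eq_sint h k t : (forall s, 0 <= s <= t -> h s = k s) -> sint h t = sint k t.
Proof.
move=> hk; apply: eq_Rintegral => s; rewrite inE /= in_itv /= => st.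
exact: hk.
Qed.

Lemma le_sint h k t : continuous h -> continuous k ->
  (forall s, 0 <= s <= t -> h s <= k s) -> sint h t <= sint k t.
Proof.
move=> hc kc hk; apply: le_Rintegral; [|exact: cont_integrable..|].
  exact: measurable_itv.
by move=> s /=; rewrite in_itv /=; exact: hk.
Qed.

Lemma norm_sint_le h k t : continuous h -> continuous k ->
  (forall s, 0 <= s <= t -> `|h s| <= k s) -> `|sint h t| <= sint k t.
Proof.
move=> hc kc hk.
have nhc : continuous (fun s => `|h s|).
  by move=> s; apply: cvg_norm; exact: hc.
rewrite (le_trans (le_normr_Rintegral _ (cont_integrable _ _ _))) //.
exact: le_sint.
Qed.

Lemma sint_is_derive h t : continuous h -> 0 < t ->
  is_derive t 1 (sint h) (h t).
Proof.
move=> hc t0.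
have [] := @continuous_FTC1_closed R h 0 t (t + 1) _ _ t0 (hc t).
- by rewrite ltrDl.
- exact: cont_integrable.
by move=> hd; rewrite derive1E => hv; split; [exact: hd|exact: hv].
Qed.

Lemma sint_cont h : continuous h -> continuous (sint h).
Proof.
move=> hc t.
(* Left of [|t| + 1] the integral is unchanged by clipping its upper limit to [0, [|t| + 1]],
   negative limits included. Continuity on that closed interval thus becomes two-sided continuity at
   [t]. *)
have E s : s < `|t| + 1 -> sint h s = (sint h \o clip 0 (`|t| + 1)) s.
  move=> st /=; have [s0|s0] := leP 0 s.
    by rewrite clip_id // s0 ltW.
  rewrite sintN ?(ltW s0) // /clip (max_idPl _) ?sintN //.
  by rewrite ge_min (ltW s0) orbT.
have tt : t < `|t| + 1 by rewrite (le_lt_trans (ler_norm t)) // ltrDl.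
apply: (@cvg_trans _ ((sint h \o clip 0 (`|t| + 1)) @ t)).
  by apply: near_eq_cvg; near=> s; apply: esym; apply: E; near: s; exact: lt_nbhsl.
rewrite E //.
have t10 : 0 <= `|t| + 1 by rewrite addr_ge0.
apply: (@within_clip _ _ _ [set` `[0, `|t| + 1]]) => //.
by apply: parameterized_integral_continuous => //; exact: cont_integrable.
Unshelve. all: by end_near. Qed.

Lemma sint_ftc (u b : R -> R) r : continuous b ->
  {within `[0, r], continuous u} ->
  (forall t, 0 < t < r -> is_derive t 1 u (b t)) ->
  forall t, 0 <= t <= r -> u t = u 0 + sint b t.
Proof.
move=> bc uc ub t /andP[]; rewrite le_eqVlt => /predU1P[<- _|t0 tr].
  by rewrite sintN // addr0.
have uc' : {within `[0, t], continuous u}.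
  by apply: continuous_subspaceW uc; apply: subset_itvl; rewrite bnd_simp.
have ubt s : s \in `]0, t[ -> is_derive s 1 u (b s).
  by rewrite in_itv /= => /andP[s0 st]; apply: ub; rewrite s0 (lt_le_trans st).
rewrite /sint /Rintegral (@continuous_FTC2 _ b u) //.
- by rewrite -EFinB /= addrC subrK.
- exact: continuous_subspaceT.
- move/(continuous_within_itvP _ t0) : uc' => [_ c0 c1].
  by split => // s /ubt[].
- by move=> s st; rewrite derive1E; case: (ubt s st).
Qed.

(** The function [v] below is nonincreasing: its derivative is expR (- L s) L times u(s) - (a + L
    int_0^s u), which the hypothesis makes nonpositive. Comparing [v t] with [v 0 = a] gives the
    bound. *)
Lemma gronwall (u : R -> R) (a L T : R) : continuous u -> 0 <= L ->
  (forall t, 0 <= t <= T -> u t <= a + L * sint u t) ->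
  forall t, 0 <= t <= T -> u t <= a * expR (L * t).
Proof.
move=> uc L0 hu t /andP[t0 tT].
pose v (s : R) : R := expR (- L * s) * (a + L * sint u s).
have dv (s : R) : 0 < s -> is_derive s (1 : R) v (expR (- L * s) * L * (u s - (a + L * sint u s))).
  move=> s0.
  have d1 : is_derive s (1 : R) (fun s : R => expR (- L * s)) (- L * expR (- L * s)).
    apply: is_derive_eq.
    rewrite /GRing.scale /=; lra.
  have d2 := sint_is_derive uc s0.
  rewrite /v; apply: is_derive_eq; rewrite /GRing.scale /=; lra.
have vc : {within `[0, t], continuous v}.
  apply: continuous_subspaceT => s; rewrite /v.
  apply: cvgM.
    apply: (@continuous_comp _ _ _ (fun s : R => - L * s) expR).
      by apply: cvgM; [exact: cvg_cst|exact: cvg_id].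
    exact: continuous_expR.
  apply: cvgD; first exact: cvg_cst.
  by apply: cvgM; [exact: cvg_cst|exact: sint_cont].
have : v t <= v (0 : R).
  apply: (@ler0_derive1_nincr _ v 0 t _ _ vc _ _ (lexx 0) t0 (lexx t)) => s;
    rewrite in_itv /= => /andP[s0 st]; first by have [] := dv s s0.
  rewrite derive1E; have [_ ->] := dv s s0.
  rewrite mulr_ge0_le0 ?mulr_ge0 ?expR_ge0 // subr_le0.
  by apply: hu; rewrite ltW //= (le_trans (ltW st)).
rewrite /v mulr0 expR0 mul1r (sintN _ (lexx 0)) mulr0 addr0 mulNr expRN.
rewrite mulrC ler_pdivrMr ?expR_gt0 // => vle.
by apply: le_trans vle; apply: hu; rewrite t0.
Qed.

End scalar_integral.

Section time_integrals.
Context (R : realType) (n : nat).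
Local Notation V := 'rV[R]_n.

(** This is a change of variables, obtained from the fundamental theorem: as functions of [t] both
    sides have the same derivative and the same value at 0. *)
Lemma sint_affine (h : R -> R) (s c t : R) : continuous h -> 0 <= s -> 0 < c ->
  0 <= t -> sint h (s + c * t) = sint h s + c * sint (fun q => h (s + c * q)) t.
Proof.
move=> hc s0 c0 t0.
have ac : continuous (fun q : R => s + c * q).
  move=> q; apply: cvgD; first exact: cvg_cst.
  by apply: cvgM; [exact: cvg_cst|exact: cvg_id].
have hac : continuous (fun q : R => h (s + c * q)).
  by move=> q; apply: (continuous_comp (ac q)); exact: hc.
rewrite -sintZ //.
have -> : sint h s = sint h (s + c * 0) by rewrite mulr0 addr0.
apply: (@sint_ftc R (fun t => sint h (s + c * t)) _ t) => //.
- by move=> q; apply: cvgM; [exact: cvg_cst|exact: hac].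
- apply: continuous_subspaceT => q.
  by apply: (continuous_comp (ac q)); exact: sint_cont.
- move=> q /andP[q0 _].
  have d1 : is_derive q (1 : R) (fun q : R => s + c * q) c.
    apply: is_derive_eq; rewrite /GRing.scale /=; lra.
  have d2 : is_derive (s + c * q) (1 : R) (sint h) (h (s + c * q)).
    by apply: sint_is_derive => //; rewrite ltr_wpDl // mulr_gt0.
  have := @is_derive1_comp R (sint h) (fun q : R => s + c * q) q _ _ d2 d1.
  by rewrite mulrC.
- by rewrite t0 lexx.
Qed.

Implicit Types (h k : R -> V).

Lemma tiE t h j : time_integral t h 0 j = sint (fun s => h s 0 j) t.
Proof. by rewrite /time_integral /row_integral mxE. Qed.

Lemma tiN t h : t <= 0 -> time_integral t h = 0.
Proof. by move=> t0; apply/rowP => j; rewrite tiE sintN // mxE. Qed.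

Lemma coord_cont h j : continuous h -> continuous (fun s => h s 0 j).
Proof. by move=> /continuous_row. Qed.

Lemma tiD t h k : continuous h -> continuous k ->
  time_integral t (fun s => h s + k s) = time_integral t h + time_integral t k.
Proof.
move=> hc kc; apply/rowP => j; rewrite [RHS]mxE !tiE -sintD; try exact: coord_cont.
by apply: eq_sint => s _; rewrite mxE.
Qed.

Lemma tiB t h k : continuous h -> continuous k ->
  time_integral t (fun s => h s - k s) = time_integral t h - time_integral t k.
Proof.
move=> hc kc; apply/rowP => j; rewrite [RHS]mxE [X in _ = _ + X]mxE !tiE -sintB; try exact: coord_cont.
by apply: eq_sint => s _; rewrite !mxE.
Qed.

Lemma tiZ t c h : continuous h ->
  time_integral t (fun s => c *: h s) = c *: time_integral t h.
Proof.
move=> hc; apply/rowP => j; rewrite [RHS]mxE !tiE -sintZ; try exact: coord_cont.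
by apply: eq_sint => s _; rewrite !mxE.
Qed.

Lemma eq_ti t h k : (forall s, 0 <= s <= t -> h s = k s) ->
  time_integral t h = time_integral t k.
Proof.
by move=> hk; apply/rowP => j; rewrite !tiE; apply: eq_sint => s /hk ->.
Qed.

Lemma ti_norm_le t h (k : R -> R) : continuous h -> continuous k ->
  (forall s, 0 <= s <= t -> `|h s| <= k s) -> `|time_integral t h| <= sint k t.
Proof.
move=> hc kc hk; apply: row_norm_le => [|j].
  apply: Rintegral_ge0 => s; rewrite /= in_itv /= => /hk.
  exact: le_trans.
rewrite tiE; apply: norm_sint_le => //; first exact: coord_cont.
by move=> s st; rewrite (le_trans (coord_norm_le _ _)) // hk.
Qed.

Lemma ti_norm_cst t h (M : R) : 0 <= t -> continuous h ->
  (forall s, 0 <= s <= t -> `|h s| <= M) -> `|time_integral t h| <= M * t.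
Proof.
move=> t0 hc hk; rewrite -sint_cst //; apply: ti_norm_le => //.
exact: cst_continuous.
Qed.

Lemma ti_cont h : continuous h -> continuous (fun t => time_integral t h).
Proof.
move=> hc; apply/continuous_row => j.
rewrite (_ : (fun _ => _) = sint (fun s => h s 0 j)); last first.
  by apply/funext => t; rewrite tiE.
by apply: sint_cont; exact: coord_cont.
Qed.

Lemma ti_is_derive (t : R) h : continuous h -> 0 < t ->
  is_derive t (1 : R) (fun t => time_integral t h) (h t).
Proof.
move=> hc t0; apply/is_derive_row => j.
rewrite (_ : (fun _ => _) = sint (fun s => h s 0 j)); last first.
  by apply/funext => s; rewrite tiE.
by apply: sint_is_derive => //; exact: coord_cont.
Qed.

Lemma ti_ftc (u b : R -> V) (r : R) : continuous b ->
  {within `[0, r], continuous u} ->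
  (forall t : R, 0 < t < r -> is_derive t (1 : R) u (b t)) ->
  forall t, 0 <= t <= r -> u t = u 0 + time_integral t b.
Proof.
move=> bc uc ub t tr; apply/rowP => j; rewrite [RHS]mxE tiE.
apply: (@sint_ftc R (fun t => u t 0 j) _ r) => //; first exact: coord_cont.
  by move=> q; apply: (@cvg_coord R n); exact: uc.
by move=> q /ub /is_derive_row.
Qed.

Lemma ti_affine (s c t : R) h : continuous h -> 0 <= s -> 0 < c -> 0 <= t ->
  time_integral (s + c * t) h =
  time_integral s h + c *: time_integral t (fun q => h (s + c * q)).
Proof.
move=> hc s0 c0 t0; apply/rowP => j; rewrite [RHS]mxE [X in _ = _ + X]mxE !tiE sint_affine //.
exact: coord_cont.
Qed.

Lemma ti_lip s t h (M : R) : 0 <= s <= t -> continuous h ->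
  (forall q, s <= q <= t -> `|h q| <= M) ->
  `|time_integral t h - time_integral s h| <= M * (t - s).
Proof.
move=> /andP[s0 st] hc hM.
have -> : t = s + 1 * (t - s) by rewrite mul1r addrC subrK.
rewrite ti_affine ?subr_ge0 // addrC addKr scale1r mul1r [s + _]addrC addrK.
apply: ti_norm_cst; first by rewrite subr_ge0.
  move=> q; apply: continuous_comp; last exact: hc.
  apply: cvgD; first exact: cvg_cst.
  by apply: cvgM; [exact: cvg_cst|exact: cvg_id].
by move=> q /andP[q0 qt]; apply: hM; rewrite mul1r lerDl q0 /= -lerBrDl.
Qed.

End time_integrals.

(** * Differential equations with a Lipschitz field *)

Section picard.
Context (R : realType) (n : nat).
Local Notation V := 'rV[R]_n.
Implicit Types (h : R -> V -> V) (w X Y : R -> V).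

(** The normalisation [1 <= L] makes [L] positive and is what bounds the first Picard increment,
    through t <= 1 + 2 L t <= expR (2 L t). *)
Definition lip_field (L M : R) h : Prop :=
  [/\ 1 <= L, (forall s x x', `|h s x - h s x'| <= L * `|x - x'|),
      (forall s x, `|h s x| <= M) & forall x, continuous (h^~ x)].

Lemma lip_field_cont L M h X : lip_field L M h -> continuous X ->
  continuous (fun s => h s (X s)).
Proof.
move=> [L1 hL _ hc] Xc s; have L0 : 0 < L by rewrite (lt_le_trans ltr01).
apply/cvgrPdist_lt => e e0.
have e2 : 0 < e / 2 by rewrite divr_gt0.
have e2L : 0 < e / 2 / L by rewrite divr_gt0.
near=> r.
rewrite (_ : h s (X s) - h r (X r) =
  (h s (X s) - h r (X s)) + (h r (X s) - h r (X r))); last first.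
  by rewrite addrA subrK.
rewrite (le_lt_trans (ler_normD _ _)) // (splitr e) ltrD //.
  by near: r; have /cvgrPdist_lt := hc (X s) s; exact.
rewrite (le_lt_trans (hL _ _ _)) // mulrC -ltr_pdivlMr //.
by near: r; have /cvgrPdist_lt := Xc s; exact.
Unshelve. all: by end_near. Qed.

(** The difference of the two paths is the difference of their driving terms plus the integral of
    [bX - bY], and Gronwall's lemma applies. The fields are compared only along the two paths, so a
    Lipschitz bound on a set that contains both suffices. With [a = 0] this is uniqueness. *)
Lemma integral_stability (X Y bX bY : R -> V) (L a T : R) : 0 <= L ->
  continuous X -> continuous Y -> continuous bX -> continuous bY ->
  (forall t, 0 <= t <= T -> `|bX t - bY t| <= L * `|X t - Y t|) ->
  (forall t, 0 <= t <= T ->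
    `|X t - time_integral t bX - (Y t - time_integral t bY)| <= a) ->
  forall t, 0 <= t <= T -> `|X t - Y t| <= a * expR (L * T).
Proof.
move=> L0 Xc Yc hXc hYc hL hXY t tT.
have XYc : continuous (fun t => X t - Y t).
  by move=> s; apply: cvgB; [exact: Xc|exact: Yc].
have uc : continuous (fun t => `|X t - Y t|).
  by move=> s; apply: cvg_norm; exact: XYc.
have a0 : 0 <= a by rewrite (le_trans _ (hXY _ tT)).
have G s : 0 <= s <= T -> `|X s - Y s| <= a + L * sint (fun t => `|X t - Y t|) s.
  move=> sT; have [s0 sT'] := andP sT.
  rewrite (_ : X s - Y s = (X s - time_integral s bX - (Y s - time_integral s bY)) +
     time_integral s (fun q => bX q - bY q)); last first.
    by rewrite tiB // opprD opprK addrACA subrK addrK.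
  rewrite (le_trans (ler_normD _ _)) // lerD // ?hXY // -sintZ //.
  apply: ti_norm_le.
  - by move=> q; apply: cvgB; [exact: hXc|exact: hYc].
  - by move=> q; apply: cvgM; [exact: cvg_cst|exact: uc].
  - by move=> q /andP[q0 qs]; apply: hL; rewrite q0 (le_trans qs).
rewrite (le_trans (gronwall uc L0 G tT)) // ler_wpM2l // ler_expR.
by case/andP: tT => _ tT; rewrite ler_wpM2l.
Qed.

(** The driving path: [X] solves X(t) = w(t) + int_0^t h(s, X(s)) ds exactly when its defect is
    w. *)
Definition ode_defect h X (t : R) : V := X t - time_integral t (fun s => h s (X s)).

Lemma ode_stability L M h X Y (a T : R) : lip_field L M h ->
  continuous X -> continuous Y ->
  (forall t, 0 <= t <= T -> `|ode_defect h X t - ode_defect h Y t| <= a) ->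
  forall t, 0 <= t <= T -> `|X t - Y t| <= a * expR (L * T).
Proof.
move=> hLM Xc Yc; have [L1 hL _ _] := hLM.
apply: integral_stability => //; first by rewrite (le_trans ler01).
- exact: lip_field_cont hLM Xc.
- exact: lip_field_cont hLM Yc.
Qed.

Fixpoint picard_iter w h (k : nat) : R -> V :=
  if k is k'.+1 then fun t => w t + time_integral t (fun s => h s (picard_iter w h k' s))
  else w.

Definition ode_sol w h (t : R) : V := lim (picard_iter w h k t @[k --> \oo]).

Context (L M : R) (w : R -> V) (h : R -> V -> V).
Hypotheses (hLM : lip_field L M h) (wc : continuous w).
Local Notation P := (picard_iter w h).

Lemma picard_iter_cont k : continuous (P k).
Proof.
elim: k => [|k ih] //= t; apply: cvgD; first exact: wc.
by apply: ti_cont; exact: lip_field_cont hLM ih.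
Qed.

Lemma sint_expR (c t : R) : 0 < c -> 0 <= t ->
  c * sint (fun s => expR (c * s)) t <= expR (c * t).
Proof.
move=> c0 t0.
have dc (q : R) : is_derive q (1 : R) (fun t : R => expR (c * t)) (c * expR (c * q)).
  apply: is_derive_eq; rewrite /GRing.scale /=; lra.
have ec : continuous (fun s : R => expR (c * s)).
  by move=> q; have [/derivable1_diffP/differentiable_continuous] := dc q.
rewrite -sintZ // -[leLHS](addKr (expR (c * 0))).
rewrite -(@sint_ftc _ (fun t => expR (c * t)) _ t) //.
- by rewrite mulr0 expR0 addrC lerBlDr lerDl.
- by move=> q; apply: cvgM; [exact: cvg_cst|exact: ec].
- exact: continuous_subspaceT.
- by rewrite t0 lexx.
Qed.

(** Measured with the weight expR (2 L t), the Picard map contracts by 1/2, since L int_0^t expR (2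
    L s) ds <= expR (2 L t) / 2. Convergence is therefore geometric on every interval, however long.
    For [t <= 0] the integrals vanish and all iterates equal [w]. *)
Lemma picard_iter_dist k (t T : R) : 0 <= T -> t <= T ->
  `|P k.+1 t - P k t| <= M * expR (2 * L * T) * 2 ^- k.
Proof.
have [L1 hL hM _] := hLM; have L0 : 0 < L by rewrite (lt_le_trans ltr01).
have M0 : 0 <= M := le_trans (normr_ge0 _) (hM 0 0).
move=> T0 tT; have [t0|t0] := leP t 0.
  case: k => [|k] /=; rewrite !tiN // ?addr0 subrr normr0;
    by rewrite mulr_ge0 ?mulr_ge0 ?expR_ge0 ?invr_ge0 ?exprn_ge0.
apply: (@le_trans _ _ (M * expR (2 * L * t) * 2 ^- k)); last first.
  rewrite ler_wpM2r ?invr_ge0 ?exprn_ge0 // ler_wpM2l // ler_expR.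
  by rewrite ler_wpM2l // mulr_ge0 // ltW.
elim: k t {tT} t0 => [t t0|k ih t t0].
  rewrite /= expr0 invr1 mulr1 addrC addKr.
  apply: (@le_trans _ _ (M * t)).
    by apply: ti_norm_cst => //; [exact: ltW|exact: lip_field_cont hLM wc].
  rewrite ler_wpM2l // (le_trans _ (expR_ge1Dx _)) //.
  rewrite -[leLHS]add0r lerD // -[leLHS]mul1r ler_wpM2r ?ltW //; lra.
have c k' := lip_field_cont hLM (@picard_iter_cont k').
have cn : continuous (fun s : R => expR (2 * L * s)).
  move=> s; apply: (@continuous_comp _ _ _ (fun s : R => 2 * L * s) expR).
    by apply: cvgM; [exact: cvg_cst|exact: cvg_id].
  exact: continuous_expR.
have -> : P k.+2 t - P k.+1 t = time_integral t (fun s => h s (P k.+1 s) - h s (P k s)).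
  rewrite tiB; [|exact: (c k.+1)|exact: (c k)].
  by rewrite [LHS]/= opprD addrACA subrr add0r.
apply: (@le_trans _ _ (sint (fun s => (L * M * 2 ^- k) * expR (2 * L * s)) t)).
  apply: ti_norm_le.
  - by move=> s; apply: cvgB; exact: c.
  - by move=> s; apply: cvgM; [exact: cvg_cst|exact: cn].
  move=> s /andP[]; rewrite le_eqVlt => /predU1P[<- _|s0 _].
    case: (k) => [|k'] /=; rewrite !tiN // ?addr0 subrr normr0;
    by rewrite !mulr_ge0 ?expR_ge0 ?invr_ge0 ?exprn_ge0 // ltW.
  rewrite (le_trans (hL _ _ _)) //.
  have := ih s s0; rewrite -(ler_pM2l L0) => /le_trans; apply.
  by rewrite le_eqVlt; apply/orP; left; apply/eqP; ring.
rewrite sintZ //.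
have := @sint_expR (2 * L) t; rewrite mulr_gt0 // ltW // => /(_ isT isT) H.
have -> : L * M * 2 ^- k = M * 2 ^- k.+1 * (2 * L).
  rewrite exprS invfM; field.
  by rewrite expf_neq0.
by rewrite -mulrA [leRHS]mulrAC ler_wpM2l // mulr_ge0 ?invr_ge0 ?exprn_ge0.
Qed.

Lemma picard_iter_tail k m (t T : R) : 0 <= T -> t <= T ->
  `|P (k + m) t - P k t| <= 2 * (M * expR (2 * L * T)) * 2 ^- k.
Proof.
move=> T0 tT; set C := M * expR (2 * L * T).
have M0 : 0 <= M by have [_ _ hM _] := hLM; exact: le_trans (normr_ge0 _) (hM 0 0).
have C0 : 0 <= C by rewrite mulr_ge0 ?expR_ge0.
(* The telescoping sum is proved with its remaining tail subtracted, since the plain bound would not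
   survive the induction on [m]. *)
suff H : `|P (k + m) t - P k t| <= 2 * C * 2 ^- k - 2 * C * 2 ^- (k + m).
  by apply: (le_trans H); rewrite gerBl !mulr_ge0 ?invr_ge0 ?exprn_ge0.
elim: m => [|m ih]; first by rewrite addn0 !subrr normr0.
rewrite addnS.
rewrite -[P _.+1 t - _](subrKA (P (k + m) t)) (le_trans (ler_normD _ _)) //.
have := picard_iter_dist (k + m) T0 tT; rewrite -/C => H.
apply: (le_trans (lerD H ih)).
have -> : 2 ^- (k + m) = 2 * 2 ^- (k + m).+1 :> R.
  by rewrite exprS invfM mulrA divff ?mul1r.
lra.
Qed.

Lemma geo_small (C e : R) : 0 < e -> \forall k \near \oo, C * 2 ^- k < e.
Proof.
move=> e0.
have : C * (2^-1) ^+ k @[k --> \oo] --> C * (0 : R).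
  apply: cvgM; first exact: cvg_cst.
  by apply: cvg_expr; rewrite ger0_norm ?invr_ge0 // invf_lt1 // ltr1n.
rewrite mulr0 => /cvgrPdist_lt /(_ _ e0); apply: filterS => k /=.
by rewrite sub0r normrN -exprVn; apply: le_lt_trans; exact: ler_norm.
Qed.

Lemma ode_sol_dist k (t T : R) : 0 <= T -> t <= T ->
  `|ode_sol w h t - P k t| <= 2 * (M * expR (2 * L * T)) * 2 ^- k.
Proof.
move=> T0 tT; set C := 2 * _.
have cP : cvg (P m t @[m --> \oo]).
  apply: cauchy_cvg; apply: cauchy_exP => e e0.
  near \oo => N; exists (P N t).
  exists N => // m /= Nm; rewrite -ball_normE /= distrC.
  rewrite -(subnKC Nm) (le_lt_trans (picard_iter_tail N _ T0 tT)) // -/C.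
  by near: N; exact: geo_small.
apply/ler_addgt0Pl => e e0; have /cvgrPdist_lt /(_ _ e0) H := cP.
near \oo => N; rewrite -(subrKA (P N t)) (le_trans (ler_normD _ _)) //.
rewrite lerD //; first by apply/ltW; near: N.
have kN : (k <= N)%N by near: N; exact: nbhs_infty_ge.
by rewrite -(subnKC kN) picard_iter_tail.
Unshelve. all: by end_near. Qed.

Lemma ode_sol_cont : continuous (ode_sol w h).
Proof.
move=> t; apply/cvgrPdist_lt => e e0; set T := `|t| + 1.
have T0 : 0 <= T by rewrite addr_ge0.
have e3 : 0 < e / 3 by rewrite divr_gt0.
near \oo => N.
have HN (s : R) : s <= T -> `|ode_sol w h s - P N s| < e / 3.
  move=> sT; apply: (le_lt_trans (ode_sol_dist N T0 sT)).
  by near: N; exact: geo_small.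
have tT : t < T by rewrite (le_lt_trans (ler_norm t)) // ltrDl.
near=> s; rewrite -(subrKA (P N t)) (le_lt_trans (ler_normD _ _)) //.
rewrite (_ : e = e / 3 + (e / 3 + e / 3)); last by field.
rewrite ltrD // ?HN ?(ltW tT) // -(subrKA (P N s)).
rewrite (le_lt_trans (ler_normD _ _)) // ltrD //.
  by near: s; have /cvgrPdist_lt := @picard_iter_cont N t; exact.
rewrite distrC HN //.
by apply/ltW; near: s; exact: (lt_nbhsl tT).
Unshelve. all: by end_near. Qed.

Lemma ode_solE t :
  ode_sol w h t = w t + time_integral t (fun s => h s (ode_sol w h s)).
Proof.
have [L1 hL hM _] := hLM; have L0 : 0 <= L by rewrite (le_trans ler01).
apply/subr0_eq/eqP; rewrite -normr_eq0 eq_le normr_ge0 andbT.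
set T := `|t|; have T0 : 0 <= T by exact: normr_ge0.
have tT : t <= T by exact: ler_norm.
apply/ler_addgt0Pl => e e0; rewrite addr0.
set C := 2 * (M * expR (2 * L * T)).
have C0 : 0 <= C by rewrite !mulr_ge0 ?expR_ge0 // (le_trans (normr_ge0 _) (hM 0 0)).
have Sc := ode_sol_cont.
near \oo => N.
rewrite -(subrKA (P N.+1 t)) (le_trans (ler_normD _ _)) //.
rewrite (_ : P N.+1 t - _ = time_integral t
   (fun s => h s (P N s) - h s (ode_sol w h s))); last first.
  rewrite tiB; [|exact: lip_field_cont hLM (@picard_iter_cont N)|
                 exact: lip_field_cont hLM Sc].
  by rewrite /= opprD addrACA subrr add0r.
have [t0|t0] := leP t 0.
  rewrite tiN // normr0 addr0.
  apply: (le_trans (ode_sol_dist _ T0 tT)); rewrite -/C.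
  apply: (@le_trans _ _ (C * 2 ^- N)); last first.
    by apply: ltW; near: N; exact: geo_small.
  rewrite ler_wpM2l // lef_pV2 ?posrE ?exprn_gt0 //.
  by rewrite ler_eXn2l // ltr1n.
apply: (@le_trans _ _ (C * 2 ^- N + (L * (C * 2 ^- N)) * t)).
  rewrite lerD //.
    apply: (le_trans (ode_sol_dist _ T0 tT)); rewrite -/C.
    rewrite ler_wpM2l // lef_pV2 ?posrE ?exprn_gt0 //.
    by rewrite ler_eXn2l // ltr1n.
  apply: ti_norm_cst; first exact: ltW.
    move=> s; apply: cvgB.
      exact: lip_field_cont hLM (@picard_iter_cont N) s.
    exact: lip_field_cont hLM Sc s.
  move=> s /andP[s0 st]; rewrite (le_trans (hL _ _ _)) // ler_wpM2l // distrC.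
  by apply: ode_sol_dist => //; rewrite (le_trans st).
rewrite (_ : _ + _ = (C * (1 + L * t)) * 2 ^- N); last by ring.
by apply/ltW; near: N; exact: geo_small.
Unshelve. all: by end_near. Qed.

End picard.

(** * The path space *)

Section path_topology.
Context (R : realType) (d : nat).
Local Notation V := 'rV[R]_d.
Local Notation path := (path_space R d).
Implicit Types (p q : path) (T t a : R).

Lemma to_half_subproof t : Num.max 0 t \in halfline R.
Proof. by rewrite inE /halfline /= le_max lexx. Qed.

Definition to_half t : halfline R := SigSub (to_half_subproof t).

(** A path is read as a function on the whole line, constant on negative times. Continuity and
    integrals then need no relative topology. *)
Definition pt p : R -> V := (path_fun p : halfline R -> V) \o to_half.

Lemma to_half_val (x : halfline R) : to_half (set_val x) = x.
Proof.
apply: val_inj; rewrite /= set_valE; apply/max_idPr.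
by case: x => x /= /set_mem.
Qed.

Lemma to_half_cont : continuous to_half.
Proof.
apply: continuous_comp_initial => t /=; rewrite set_valE /=.
by apply: (@continuous_max _ _ (cst 0) id) => //; exact: cst_continuous.
Qed.

Lemma pt_cont p : continuous (pt p).
Proof.
move=> t; apply: continuous_comp; first exact: to_half_cont.
exact: (@cts_fun _ _ (p : continuousType (halfline R) V)).
Qed.

Lemma pt_path_of (h : R -> V) t : {within halfline R, continuous h} -> 0 <= t ->
  pt (path_of h) t = h t.
Proof.
move=> /subspace_sigL_continuousP hc t0.
rewrite /pt /path_of /=; case: pselect => // hc' /=.
rewrite /path_fun -[LHS]/(h (set_val (to_half t))).
by rewrite set_valE /= (max_idPr t0).
Qed.

Definition sup_close T a p q : Prop := forall t, 0 <= t <= T -> `|pt p t - pt q t| <= a.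

Lemma sup_close_nbhs T a p : 0 <= T -> 0 < a -> nbhs p (sup_close T a p).
Proof.
move=> T0 a0.
pose A := to_half @` [set` `[0, T]].
have cA : compact A.
  apply: continuous_compact; last exact: segment_compact.
  exact: continuous_subspaceT to_half_cont.
have := @fam_nbhs _ V compact A _ (path_fun p) (entourage_ball V (PosNum a0)) cA.
move=> /(@initial_continuous _ _ (@path_fun R d) p).
apply: (@filterS _ (nbhs p)) => q /= qA t tT; apply/ltW.
have := qA (to_half t); rewrite -ball_normE; apply.
by exists t => //=; rewrite in_itv.
Qed.

(** With [sup_close_nbhs] this says that the sets [sup_close T a p] form a base of neighbourhoods of
    [p]. The filter they generate converges to [p] uniformly on compact sets, because a compact
    subset of the half-line lies in some [0, T]. *)
Lemma nbhs_sup_close p (O : set path) : nbhs p O ->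
  exists T a, [/\ 0 <= T, 0 < a & sup_close T a p `<=` O].
Proof.
move=> [Q [[W oW <-] Wp] WO].
pose B (e : R * R) := [set f : {family compact, halfline R -> V} |
  forall t, 0 <= t <= e.1 -> `|pt p t - f (to_half t)| <= e.2].
pose F := filter_from [set e : R * R | 0 <= e.1 /\ 0 < e.2] B.
have FF : Filter F.
  apply: filter_from_filter; first by exists (0, 1) => /=.
  move=> [T1 a1] [T2 a2] [/= T10 a10] [/= T20 a20].
  exists (Num.max T1 T2, Num.min a1 a2) => /=.
    by rewrite le_max T10 lt_min a10 a20.
  move=> f Hf; split=> t /= /andP[t0 tT].
    have := Hf t; rewrite t0 /= le_max tT => /(_ isT) /le_trans; apply.
    by rewrite ge_min lexx.
  have := Hf t; rewrite t0 /= le_max tT orbT => /(_ isT) /le_trans; apply.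
  by rewrite ge_min lexx orbT.
have : {family compact, F --> (path_fun p : halfline R -> V)}.
  apply/fam_cvgP => A cA U /uniform_nbhs[E [entE EU]].
  have [e e0 eE] : exists2 e : R, 0 < e & forall x y : V, `|x - y| < e -> E (x, y).
    move: entE; rewrite -entourage_ballE => -[e /= e0 eE].
    by exists e => // x y xy; apply: eE; rewrite /= -ball_normE.
  have [T T0 AT] : exists2 T, 0 <= T & forall x, A x -> set_val x <= T.
    have : compact (set_val @` A).
      apply: continuous_compact => //; apply: continuous_subspaceT.
      exact: initial_continuous.
    move=> /(@compact_bounded R R^o)[M0 [_ HM]].
    exists (`|M0| + 1); first by rewrite addr_ge0.
    move=> x Ax; rewrite (le_trans (ler_norm _)) //; apply: HM.
      by rewrite (le_lt_trans (ler_norm _)) // ltrDl.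
    by exists x.
  exists (T, e / 2) => /=; first by rewrite divr_gt0.
  move=> f Hf; apply: EU => x Ax; apply: eE.
  have x0 : 0 <= set_val x by rewrite set_valE; have /set_mem := valP x.
  have := Hf (set_val x); rewrite x0 AT // => /(_ isT).
  rewrite /pt /= to_half_val => /le_lt_trans; apply.
  by rewrite ltr_pdivrMr // ltr_pMr // ltr1n.
have nW : nbhs (path_fun p) W by move: oW; rewrite openE; exact.
move=> /(_ W nW)[[T a] /= [T0 a0] BW].
exists T, a; split => // q pq; apply: WO; apply: BW => t tT.
exact: pq.
Qed.

(** Any upper bound [a] of the distance on [0, T] may be used, so estimates apply without computing
    a supremum. Taking [a = 0] shows that [Psi] depends on the path on [0, T] only. *)
Definition path_lip (T k : R) (Psi : path -> R) : Prop :=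
  forall p q a, sup_close T a p q -> `|Psi p - Psi q| <= k * a.

Lemma path_lip_continuous T k Psi : 0 <= T -> path_lip T k Psi -> continuous Psi.
Proof.
move=> T0 Psik p; apply/(cvgrPdist_lt (FF := nbhs_filter p)) => e e0.
have ke : 0 < e / (`|k| + 1) by rewrite divr_gt0 // ltr_wpDl.
have := sup_close_nbhs p T0 ke.
apply: (@filterS _ (nbhs p)) => q /Psik /le_lt_trans; apply.
apply: (@le_lt_trans _ _ (`|k| * (e / (`|k| + 1)))).
  by rewrite ler_wpM2r ?ler_norm // ltW.
by rewrite mulrA ltr_pdivrMr ?ltr_wpDl // mulrC ltr_pM2l // ltrDl.
Qed.

End path_topology.

(** * Expectations of bounded functions *)

Section expectation.
Context (R : realType) (disp : measure_display) (T : measurableType disp)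
  (mu : probability T R) (D : set T).
Hypothesis mD : measurable D.
Implicit Types (u v : T -> R).
Local Notation E u := (\int[mu]_(x in D) u x).

Definition bounded_mfun u : Prop :=
  measurable_fun D u /\ exists M, forall x, D x -> `|u x| <= M.

Lemma bounded_mfun_integrable u : bounded_mfun u -> mu.-integrable D (EFin \o u).
Proof.
move=> [mu_ [M uM]]; apply: measurable_bounded_integrable => //.
  by rewrite (le_lt_trans (probability_le1 _ mD)) // ltry.
exists M; split; first exact: num_real.
by move=> x Mx t Dt; apply: (le_trans (uM _ Dt)); exact: ltW.
Qed.

Lemma bounded_mfun_cst c : bounded_mfun (fun _ => c).
Proof. by split; [exact: measurable_cst|exists `|c|]. Qed.

Lemma bounded_mfunD u v : bounded_mfun u -> bounded_mfun v ->
  bounded_mfun (fun x => u x + v x).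
Proof.
move=> [mu_ [M uM]] [mv [N vN]]; split; first exact: measurable_funD.
exists (M + N) => x Dx; rewrite (le_trans (ler_normD _ _)) // lerD ?uM ?vN //.
Qed.

Lemma bounded_mfunZ c u : bounded_mfun u -> bounded_mfun (fun x => c * u x).
Proof.
move=> [mu_ [M uM]]; split; first exact: measurable_funM.
by exists (`|c| * M) => x Dx; rewrite normrM ler_wpM2l ?uM.
Qed.

Lemma bounded_mfunN u : bounded_mfun u -> bounded_mfun (fun x => - u x).
Proof.
move=> /(bounded_mfunZ (-1)); under eq_fun do rewrite mulN1r.
exact.
Qed.

Lemma bounded_mfunB u v : bounded_mfun u -> bounded_mfun v ->
  bounded_mfun (fun x => u x - v x).
Proof. by move=> bu /bounded_mfunN; exact: bounded_mfunD. Qed.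

Lemma bounded_mfun_norm u : bounded_mfun u -> bounded_mfun (fun x => `|u x|).
Proof.
move=> [mu_ [M uM]]; split; last by exists M => x Dx; rewrite normr_id uM.
by apply: measurableT_comp => //; exact: measurable_normr.
Qed.

Lemma bounded_mfun_sum (I : Type) (r : seq I) (u : I -> T -> R) :
  (forall i, bounded_mfun (u i)) -> bounded_mfun (fun x => \sum_(i <- r) u i x).
Proof.
move=> bu; elim: r => [|i r ih].
  by under eq_fun do rewrite big_nil; exact: bounded_mfun_cst.
by under eq_fun do rewrite big_cons; apply: bounded_mfunD.
Qed.

Lemma le_expect u v : bounded_mfun u -> bounded_mfun v ->
  (forall x, D x -> u x <= v x) -> E u <= E v.
Proof. by move=> bu bv uv; apply: le_Rintegral => //; exact: bounded_mfun_integrable. Qed.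

Lemma expectD u v : bounded_mfun u -> bounded_mfun v ->
  E (fun x => u x + v x) = E u + E v.
Proof. by move=> bu bv; rewrite RintegralD //; exact: bounded_mfun_integrable. Qed.

Lemma expectB u v : bounded_mfun u -> bounded_mfun v ->
  E (fun x => u x - v x) = E u - E v.
Proof. by move=> bu bv; rewrite RintegralB //; exact: bounded_mfun_integrable. Qed.

Lemma expectZ c u : bounded_mfun u -> E (fun x => c * u x) = c * E u.
Proof. by move=> bu; rewrite RintegralZl //; exact: bounded_mfun_integrable. Qed.

Lemma expect_sum (I : Type) (r : seq I) (u : I -> T -> R) :
  (forall i, bounded_mfun (u i)) ->
  E (fun x => \sum_(i <- r) u i x) = \sum_(i <- r) E (u i).
Proof.
move=> bu; elim: r => [|i r ih].
  rewrite big_nil (eq_Rintegral mu (g := fun _ => 0)); last by move=> x _; rewrite big_nil.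
  by rewrite Rintegral_cst // mul0r.
rewrite big_cons -ih -expectD //; last exact: bounded_mfun_sum.
by apply: eq_Rintegral => x _; rewrite big_cons.
Qed.

Lemma norm_expect_le u : bounded_mfun u -> `|E u| <= E (fun x => `|u x|).
Proof. by move=> bu; apply: le_normr_Rintegral => //; exact: bounded_mfun_integrable. Qed.

Lemma expect_cst_le c : 0 <= c -> E (fun _ => c) <= c.
Proof.
move=> c0; rewrite Rintegral_cst // ler_piMr //.
have /fine_le := probability_le1 mu mD; apply => //.
by rewrite fin_num_measure.
Qed.

Lemma norm_expect_cst u c : bounded_mfun u -> 0 <= c ->
  (forall x, D x -> `|u x| <= c) -> `|E u| <= c.
Proof.
move=> bu c0 uc; rewrite (le_trans (norm_expect_le bu)) //.
rewrite (le_trans _ (expect_cst_le c0)) //; apply: le_expect => //.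
  exact: bounded_mfun_norm.
exact: bounded_mfun_cst.
Qed.

Lemma eq_expect_ae u v : bounded_mfun u -> bounded_mfun v ->
  {ae mu, forall x, D x -> u x = v x} -> E u = E v.
Proof.
move=> [mu_ _] [mv _] uv; congr fine; apply: ae_eq_integral => //.
- exact/measurable_EFinP.
- exact/measurable_EFinP.
by apply: filterS uv => x uv Dx; rewrite uv.
Qed.

Lemma expect_dct (u : nat -> T -> R) v (M : R) :
  (forall n, measurable_fun D (u n)) -> measurable_fun D v ->
  (forall n x, D x -> `|u n x| <= M) ->
  {ae mu, forall x, D x -> u n x @[n --> \oo] --> v x} ->
  E (u n) @[n --> \oo] --> E v.
Proof.
move=> mu_ mv uM uv.
have [] := @dominated_convergence _ _ _ mu D mD (fun n x => (u n x)%:E)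
  (fun x => (v x)%:E) (fun _ => M%:E).
- by move=> n; exact/measurable_EFinP.
- exact/measurable_EFinP.
- by apply: filterS uv => x uv Dx; apply: cvg_EFin; [exact: nearW|exact: uv].
- exact: (bounded_mfun_integrable (bounded_mfun_cst M)).
- by apply: aeW => x n Dx; rewrite lee_fin uM.
move=> iv _ H; apply: fine_cvg.
rewrite fineK //.
exact: integrable_fin_num.
Qed.

End expectation.

(** * The mean ergodic theorem *)

Section tiling.
Context (R : realType) (disp : measure_display) (T : measurableType disp)
  (mu : probability T R) (D : set T).
Hypotheses (mD : measurable D) (muD : mu D = 1%E).
Local Notation E u := (\int[mu]_(x in D) u x).
Local Notation bmf := (bounded_mfun D).
Context (tm : T -> T).
Hypotheses (tmD : forall x, D x -> D (tm x))
  (tm_bmf : forall u : T -> R, bmf u -> bmf (u \o tm))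
  (tm_expect : forall u : T -> R, bmf u -> E (u \o tm) = E u).

Implicit Types u : T -> R.

Definition birkhoff u n x : R := \sum_(k < n) u (iter k tm x).

Lemma birkhoffD u n m x :
  birkhoff u (n + m) x = birkhoff u n x + birkhoff u m (iter n tm x).
Proof.
rewrite /birkhoff big_split_ord /=; congr (_ + _).
by apply: eq_bigr => k _; rewrite -iterD addnC.
Qed.

Lemma iter_bmf u k : bmf u -> bmf (fun x => u (iter k tm x)).
Proof.
elim: k u => [|k ih] u bu //.
exact: (ih (u \o tm) (tm_bmf bu)).
Qed.

Lemma iter_expect u k : bmf u -> E (fun x => u (iter k tm x)) = E u.
Proof.
elim: k u => [|k ih] u bu //.
rewrite -[RHS]tm_expect //.
exact: (ih (u \o tm) (tm_bmf bu)).
Qed.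

Lemma iter_D k x : D x -> D (iter k tm x).
Proof. by move=> Dx; elim: k => //= k; exact: tmD. Qed.

Lemma birkhoff_bmf u n : bmf u -> bmf (birkhoff u n).
Proof. by move=> bu; apply: bounded_mfun_sum => k; exact: iter_bmf. Qed.

Lemma birkhoff_expect u n : bmf u -> E (birkhoff u n) = n%:R * E u.
Proof.
move=> bu; rewrite expect_sum //; last by move=> k; exact: iter_bmf.
rewrite (eq_bigr (fun _ => E u)) => [|k _]; last by rewrite iter_expect.
by rewrite sumr_const card_ord mulr_natl.
Qed.

Lemma birkhoff_ge u n x (m : R) : D x -> (forall y, D y -> m <= u y) ->
  m * n%:R <= birkhoff u n x.
Proof.
move=> Dx um; rewrite /birkhoff -[n in n%:R](card_ord n) mulr_natr -sumr_const.
by apply: ler_sum => k _; apply: um; exact: iter_D.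
Qed.

Context (u : T -> R) (M c : R).
Hypotheses (bu : bmf u) (uM : forall x, D x -> `|u x| <= M) (c0 : 0 < c)
  (Eu0 : E u = 0).

Definition lazy_set N : set T :=
  D `&` [set x | forall n, (0 < n <= N)%N -> birkhoff u n x <= c * n%:R].

Lemma measurable_lazy_set N : measurable (lazy_set N).
Proof.
rewrite (_ : lazy_set N = \bigcap_(n in [set n | (0 < n <= N)%N])
   (D `&` birkhoff u n @^-1` [set` `]-oo, c * n%:R]]) `&` D); last first.
  apply/seteqP; split=> [x [Dx Hx]|x [Hx Dx]].
    by split=> // n /= nN; split=> //=; rewrite in_itv /=; exact: Hx.
  by split=> // n nN; have [_ /=] := Hx _ nN; rewrite in_itv.
apply: measurableI => //; apply: bigcap_measurableType => n _.
by have [mb _] := birkhoff_bmf n bu; apply: mb => //; exact: measurable_itv.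
Qed.

Lemma indic_bmf (A : set T) : measurable A -> bmf (\1_A : T -> R).
Proof.
move=> mA; split; first by apply: measurable_funTS; exact: measurable_indic.
by exists 1 => x _; rewrite indicE; case: (_ \in _); rewrite ?normr1 ?normr0.
Qed.

(* Every orbit segment is cut greedily into blocks over which the average of u
   exceeds c, and single points of the lazy set, where u is raised to c. *)
Lemma tiling_bound N : c <= (M + c) * E (\1_(lazy_set N)).
Proof.
have [x0 Dx0] : D !=set0.
  apply/set0P/eqP => D0; move: muD; rewrite D0 measure0 => /eqP.
  by rewrite eq_sym onee_eq0.
have M0 : 0 <= M := le_trans (normr_ge0 _) (uM Dx0).
pose v x := u x + (M + c) * \1_(lazy_set N) x.
have b1 : bmf (fun x => (M + c) * \1_(lazy_set N) x).
  by apply: bounded_mfunZ; apply: indic_bmf; exact: measurable_lazy_set.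
have bv : bmf v by exact: bounded_mfunD.
have uv y : u y <= v y.
  by rewrite /v lerDl mulr_ge0 ?addr_ge0 ?(ltW c0) // indicE.
have vM y : D y -> - M <= v y.
  by move=> /uM; rewrite ler_norml => /andP[uy _]; exact: le_trans (uv y).
(* The deficit (M + c) N pays for the final stretch of at most N points, where only [v >= - M] is
   known. Blocks have variable length, hence the induction on a bound [K] of [L]. *)
have S_ge L x : D x -> c * L%:R - (M + c) * N%:R <= birkhoff v L x.
  move: {2}(L) (leqnn L) => K; elim: K L x => [|K ih] L x LK Dx.
    move: LK; rewrite leqn0 => /eqP ->.
    rewrite /birkhoff big_ord0 mulr0 sub0r oppr_le0 mulr_ge0 //.
    by rewrite addr_ge0 // ltW.
  have [LN|NL] := leqP L N.
    apply: (le_trans _ (birkhoff_ge L Dx vM)).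
    have : (L%:R : R) <= N%:R by rewrite ler_nat.
    move: (L%:R : R) (N%:R : R) => l n ln.
    have : (M + c) * l <= (M + c) * n by rewrite ler_wpM2l // addr_ge0 // ltW.
    lra.
  have [xB|xB] := boolP (x \in lazy_set N).
    case: L LK NL => // L LK NL.
    rewrite -add1n birkhoffD /=.
    have := ih L (tm x) LK (tmD Dx) => H.
    have : c <= birkhoff v 1 x.
      rewrite /birkhoff big_ord1 /= /v indicE xB mulr1.
      have := uM Dx; rewrite ler_norml => /andP[? _]; lra.
    rewrite natrD; lra.
  have [n nN Sn] : exists2 n, (0 < n <= N)%N & c * n%:R < birkhoff u n x.
    apply: contrapT => H; move/negP: xB; apply; rewrite inE; split=> // n nN.
    by rewrite leNgt; apply/negP => Sn; apply: H; exists n.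
  have [n0 nN'] := andP nN.
  have nL : (n <= L)%N by rewrite (leq_trans nN') // ltnW.
  rewrite -(subnKC nL) birkhoffD natrD.
  have LK' : (L - n <= K)%N.
    by rewrite leq_subLR (leq_trans LK) // -addn1 addnC leq_add2r.
  have := ih (L - n)%N (iter n tm x) LK' (iter_D n Dx).
  have : birkhoff u n x <= birkhoff v n x by apply: ler_sum => k _; exact: uv.
  lra.
set p := (M + c) * _.
have Ev : E v = p by rewrite expectD // Eu0 add0r expectZ //; apply: indic_bmf; exact: measurable_lazy_set.
(* The deficit does not depend on [L], so after integration it becomes negligible compared with [L];
   this forces [c <= p]. *)
have H L : c * L%:R - (M + c) * N%:R <= L%:R * p.
  have Ec r : r = E (fun _ => r) by rewrite Rintegral_cst // [X in _ * X](congr1 fine muD) mulr1.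
  rewrite -Ev -birkhoff_expect // [leLHS]Ec; apply: le_expect => //.
  - exact: bounded_mfun_cst.
  - exact: birkhoff_bmf.
  - by move=> x; exact: S_ge.
rewrite leNgt; apply/negP => pc.
have cp0 : 0 < c - p by rewrite subr_gt0.
have := archi_boundP (normr_ge0 ((M + c) * N%:R / (c - p))).
set L := Num.bound _; move/(le_lt_trans (ler_norm _)).
rewrite ltr_pdivrMr //; have := H L; lra.
Qed.

(** This plays the part of the maximal ergodic theorem. The lower bound of [tiling_bound] is uniform
    in [N], whereas if almost every point left the decreasing lazy sets, dominated convergence would
    send their measure to 0. *)
Lemma lazy_set_not_vanishing : ~ {ae mu, forall x, D x -> exists N, ~ lazy_set N x}.
Proof.
move=> H.
have : E (\1_(lazy_set N)) @[N --> \oo] --> E (fun _ => 0 : R).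
  apply: (@expect_dct _ _ _ mu D mD _ _ 1).
  - by move=> N; case: (indic_bmf (measurable_lazy_set N)).
  - exact: measurable_cst.
  - by move=> N x _; rewrite indicE; case: (_ \in _); rewrite ?normr1 ?normr0.
  apply: filterS H => x Hx Dx; have [N0 N0x] := Hx Dx.
  apply/cvgrPdist_lt => e e0; near=> N.
  rewrite indicE memNset ?subrr ?normr0 // => -[_ HN]; apply: N0x; split=> // n nN.
  apply: HN; case/andP: nN => -> /leq_trans; apply.
  by near: N; exact: nbhs_infty_ge.
rewrite Rintegral_cst // mul0r => H0.
have : (M + c) * E (\1_(lazy_set N)) @[N --> \oo] --> (M + c) * 0.
  by apply: cvgM => //; exact: cvg_cst.
rewrite mulr0 => /cvgrPdist_lt /(_ _ c0)[N _ /(_ N (leqnn N))] /=.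
rewrite sub0r normrN ltNge => /negP; apply.
by rewrite (le_trans (tiling_bound N)) // ler_norm.
Unshelve. all: by end_near. Qed.

End tiling.

Section mean_ergodic.
Context (R : realType) (disp : measure_display) (T : measurableType disp)
  (mu : probability T R) (D : set T).
Hypotheses (mD : measurable D) (muD : mu D = 1%E).
Local Notation E u := (\int[mu]_(x in D) u x).
Local Notation bmf := (bounded_mfun D).
Context (tm : T -> T).
Hypotheses (tmD : forall x, D x -> D (tm x))
  (tm_bmf : forall u : T -> R, bmf u -> bmf (u \o tm))
  (tm_expect : forall u : T -> R, bmf u -> E (u \o tm) = E u).
Implicit Types u : T -> R.

(* The points of D where the limsup of the Birkhoff averages is at least c. *)
Definition limsup_set u c : set T :=
  D `&` [set x | forall j N : nat, exists n : nat,
    (N < n)%N /\ (c - j.+1%:R^-1) * n%:R < birkhoff tm u n x].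

Lemma measurable_limsup_set u c : bmf u -> measurable (limsup_set u c).
Proof.
move=> bu.
rewrite (_ : limsup_set u c = \bigcap_(j in [set: nat]) \bigcap_(N in [set: nat])
    \bigcup_(n in [set n | (N < n)%N])
   (D `&` birkhoff tm u n @^-1` [set` `](c - j.+1%:R^-1) * n%:R, +oo[])); last first.
  apply/seteqP; split=> [x [Dx Hx] j _ N _|x Hx].
    have [n [Nn Hn]] := Hx j N; exists n => //; split => //=.
    by rewrite in_itv /= andbT.
  have [n _ [Dx _]] := Hx 0%N I 0%N I; split=> // j N.
  have [m Nm [_ /=]] := Hx j I N I; rewrite in_itv /= andbT => Hm.
  by exists m.
apply: bigcap_measurableType => j _; apply: bigcap_measurableType => N _.
apply: bigcup_measurable => n _.
have [mb _] := birkhoff_bmf tm_bmf n bu; apply: mb => //; exact: measurable_itv.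
Qed.

(** If the limsup set had full measure, almost every point would have an average above c / 2 over
    some positive length and would leave the lazy sets of level c / 2. Halving [c] leaves room for
    the slack 1 / (j + 1) in the definition of the limsup set. *)
Lemma limsup_set_null u c : bmf u -> E u = 0 -> 0 < c ->
  (mu (limsup_set u c) = 0%E \/ mu (limsup_set u c) = 1%E) ->
  mu (limsup_set u c) = 0%E.
Proof.
move=> bu Eu0 c0 [//|H1]; exfalso.
have [_ [M uM]] := bu.
have c20 : 0 < c / 2 by rewrite divr_gt0.
apply: (lazy_set_not_vanishing mD muD tmD tm_bmf tm_expect bu uM c20 Eu0).
have mL := measurable_limsup_set c bu.
exists (~` limsup_set u c); split.
- exact: measurableC.
- by rewrite probability_setC // H1 subee.
move=> x /= Hx Lx; apply: Hx => Dx.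
have [_ HL] := Lx.
have [j Hj] : exists j : nat, (j.+1%:R^-1 : R) < c / 2.
  have [j _ Hj] := near_infty_natSinv_lt (PosNum c20).
  by exists j; apply: (Hj j) => /=.
have [n [n0 Hn]] := HL j 0%N.
exists n => -[_ /(_ n)]; rewrite n0 leqnn => /(_ isT).
rewrite leNgt => /negP; apply; apply: le_lt_trans Hn.
rewrite ler_wpM2r //.
by have : forall q : R, q < c / 2 -> c / 2 <= c - q; [move=> q; lra|apply].
Qed.

Lemma birkhoffN u n x : birkhoff tm (fun x => - u x) n x = - birkhoff tm u n x.
Proof. by rewrite /birkhoff sumrN. Qed.

(** The zero-one alternatives are hypotheses because [tm] is not assumed ergodic. They make the
    limsup sets of [u] and of [- u] null at every positive level, which is almost sure convergence
    to 0; boundedness of [u] turns it into convergence in mean. *)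
Lemma mean_ergodic u : bmf u -> E u = 0 ->
  (forall c, mu (limsup_set u c) = 0%E \/ mu (limsup_set u c) = 1%E) ->
  (forall c, mu (limsup_set (fun x => - u x) c) = 0%E \/
             mu (limsup_set (fun x => - u x) c) = 1%E) ->
  E (fun x => `|birkhoff tm u n x| / n%:R) @[n --> \oo] --> (0 : R).
Proof.
move=> bu Eu0 H1 H2.
have bNu := bounded_mfunN bu.
have ENu0 : E (fun x => - u x) = 0.
  rewrite (eq_Rintegral mu (g := fun x => -1 * u x)); last by move=> x _; rewrite mulN1r.
  by rewrite (@expectZ _ _ _ mu D mD) // Eu0 mulr0.
have [_ [M uM]] := bu.
rewrite -[X in _ --> X](_ : E (fun _ => 0 : R) = 0); last first.
  by rewrite Rintegral_cst // mul0r.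
have bb n : bmf (fun x => `|birkhoff tm u n x| / n%:R).
  under eq_fun do rewrite mulrC.
  by apply: bounded_mfunZ; apply: bounded_mfun_norm; exact: birkhoff_bmf.
apply: (@expect_dct _ _ _ mu D mD _ _ M).
- by move=> n; case: (bb n).
- exact: measurable_cst.
- move=> n x Dx; rewrite normrM normr_id normfV normr_nat.
  have M0 : 0 <= M := le_trans (normr_ge0 _) (uM _ Dx).
  case: n => [|n]; first by rewrite invr0 mulr0.
  rewrite ler_pdivrMr ?ltr0n // /birkhoff (le_trans (ler_norm_sum _ _ _)) //.
  rewrite -[X in M * X%:R](card_ord n.+1) mulr_natr -sumr_const.
  by apply: ler_sum => k _; apply: uM; exact: (iter_D tmD).
(* The countably many levels 1 / (i + 1) suffice and keep the exceptional set negligible. *)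
pose N := \bigcup_(i in [set: nat]) (limsup_set u i.+1%:R^-1 `|`
   limsup_set (fun x => - u x) i.+1%:R^-1).
have mN : mu.-negligible N.
  apply: negligible_bigcup => i.
  apply: negligibleU; apply/negligibleP; try exact: measurable_limsup_set.
    by apply: limsup_set_null => //.
  by apply: limsup_set_null => //.
apply: negligibleS mN => x /=; apply: contra_notP => Nx Dx.
apply/cvgrPdist_lt => e e0.
have [i Hi] : exists i : nat, (i.+1%:R^-1 : R) < e.
  have [j _ Hj] := near_infty_natSinv_lt (PosNum e0).
  by exists j; apply: (Hj j) => /=.
have key v : (forall i, ~ limsup_set v i.+1%:R^-1 x) ->
    \forall n \near \oo, birkhoff tm v n x <= i.+1%:R^-1 * n%:R.
  move=> Hv; have := Hv i; rewrite /limsup_set /= => /not_andP[//|].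
  move=> /existsNP[j] /existsNP[K] HK; exists K.+1 => // n /= Kn.
  rewrite leNgt; apply/negP => Hn; apply: HK; exists n; split=> //.
  by apply: le_lt_trans Hn; rewrite ler_wpM2r // gerBl.
have k1 : \forall n \near \oo, birkhoff tm u n x <= i.+1%:R^-1 * n%:R.
  by apply: key => i' Hi'; apply: Nx; exists i' => //; left.
have k2 : \forall n \near \oo, birkhoff tm (fun x => - u x) n x <= i.+1%:R^-1 * n%:R.
  by apply: key => i' Hi'; apply: Nx; exists i' => //; right.
near=> n.
have n0 : (0 < n)%N by near: n; exact: nbhs_infty_gt.
rewrite sub0r normrN normrM normr_id normfV normr_nat.
rewrite ltr_pdivrMr ?ltr0n // (@le_lt_trans _ _ (i.+1%:R^-1 * n%:R)) //.
  rewrite ler_norml lerNl -birkhoffN; apply/andP; split; by near: n.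
by rewrite ltr_pM2r ?ltr0n.
Unshelve. all: by end_near. Qed.

End mean_ergodic.

(** * Lipschitz functions on compact sets *)

Definition lip_on (R : realType) (V W : normedModType R) (A : set V) (h : V -> W) (L : R) :=
  forall x y, A x -> A y -> `|h x - h y| <= L * `|x - y|.

Definition bounded_on (R : realType) (V : Type) (W : normedModType R) (A : set V) (h : V -> W) (M : R) :=
  forall x, A x -> `|h x| <= M.

Section local_lipschitz.
Context (R : realType) (V W : normedModType R).
Implicit Types (A : set V) (h : V -> W).

Lemma locally_lipschitzP A h x : locally_lipschitz A h -> A x ->
  exists r k, [/\ 0 < r, 0 <= k & lip_on (A `&` ball x r) h k].
Proof.
move=> hA Ax; have [U /nbhs_ballP[r /= r0 rU] [k0 [_ kU]]] := hA x Ax.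
exists r, (`|k0| + 1); split => //.
move=> y z [Ay yr] [Az zr].
have /kU : k0 < `|k0| + 1 by rewrite (le_lt_trans (ler_norm _)) // ltrDl.
by move=> /(_ (y, z)); apply; split => /=; split => //; exact: rU.
Qed.

Lemma locally_lipschitzS A B h : B `<=` A -> locally_lipschitz A h ->
  locally_lipschitz B h.
Proof.
move=> BA hA x /BA /hA[U xU [k0 [k0r kU]]]; exists U => //.
exists k0; split => // k /kU H [y z] [/= [By Uy] [Bz Uz]].
by apply: (H (y, z)); split=> /=; split=> //; exact: BA.
Qed.

Lemma locally_lipschitz_bounded A h : compact A -> locally_lipschitz A h ->
  exists M, 0 <= M /\ bounded_on A h M.
Proof.
move=> cA hA.
have : \forall M \near +oo, A `<=` [set x | `|h x| <= M].
  have cA' := (near_covering_withinP A).2 ((compact_near_coveringP A).1 cA).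
  apply: (cA' R (pinfty_nbhs R) (fun M x => `|h x| <= M)) => x Ax.
  have [r [k [r0 k0 kh]]] := locally_lipschitzP hA Ax.
  exists (ball x r, [set M | k * r + `|h x| <= M]).
    by split; [exact: nbhsx_ballx|apply: nbhs_pinfty_ge; exact: num_real].
  move=> [y M] /= [yr hM] Ay.
  rewrite -(subrK (h x) (h y)) (le_trans (ler_normD _ _)) //.
  apply: (@le_trans _ _ (k * r + `|h x|)).
    rewrite lerD2r (le_trans (kh _ _ (conj Ay yr) (conj Ax (ballxx x r0)))) //.
    rewrite ler_wpM2l // ltW // -normrN opprB.
    by move: yr; rewrite -ball_normE.
  exact: hM.
move=> [M0 [_ HM]]; exists (`|M0| + 1); split; first by rewrite addr_ge0.
by move=> x Ax; apply: (HM (`|M0| + 1)) => //; rewrite (le_lt_trans (ler_norm _)) // ltrDl.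
Qed.

(** For close points the local constant serves; for points at distance at least r / 2 the bound [M]
    on [h] gives the constant 2 M / (r / 2). Halving the radius keeps both points in the ball where
    the local constant is valid, and compactness makes one [L] large enough everywhere. *)
Lemma locally_lipschitz_compact A h : compact A -> locally_lipschitz A h ->
  exists L, 1 <= L /\ lip_on A h L.
Proof.
move=> cA hA; have [M [M0 HM]] := locally_lipschitz_bounded cA hA.
have : \forall L \near +oo, A `<=` [set x | forall y, A y -> `|h x - h y| <= L * `|x - y|].
  have cA' := (near_covering_withinP A).2 ((compact_near_coveringP A).1 cA).
  apply: (cA' R (pinfty_nbhs R)
    (fun L x => forall y, A y -> `|h x - h y| <= L * `|x - y|)) => x Ax.
  have [r [k [r0 k0 kh]]] := locally_lipschitzP hA Ax.
  have r20 : 0 < r / 2 by rewrite divr_gt0.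
  exists (ball x (r / 2), [set L | k <= L /\ (M + M) / (r / 2) <= L]).
    split; first exact: nbhsx_ballx.
    by near=> L; split; near: L; apply: nbhs_pinfty_ge; exact: num_real.
  move=> [y L] /= [yr [kL ML]] Ay z Az.
  have [yz|yz] := ltP `|y - z| (r / 2).
    have zr : ball x r z.
      by rewrite (splitr r); apply: ball_triangle yr _; rewrite -ball_normE.
    have yr' : ball x r y by apply: le_ball yr; rewrite ler_pdivrMr // ler_pMr // ler1n.
    rewrite (le_trans (kh _ _ (conj Ay yr') (conj Az zr))) // ler_wpM2r //.
  apply: (@le_trans _ _ (M + M)).
    by rewrite (le_trans (ler_normB _ _)) // lerD // HM.
  apply: (@le_trans _ _ (L * (r / 2))); first by rewrite -ler_pdivrMr.
  by rewrite ler_wpM2l // (le_trans k0).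
move=> [L0 [_ HL]]; exists (`|L0| + 1); split; first by rewrite lerDr.
by move=> x y Ax; apply: (HL (`|L0| + 1)) => //; rewrite (le_lt_trans (ler_norm _)) // ltrDl.
Unshelve. all: by end_near. Qed.

End local_lipschitz.

(** * The fast flow *)

Section borel_on_compact.
Context (R : realType) (V : normedModType R) (K : set V).
Hypothesis cK : compact K.
Local Notation T := (borel V).

Lemma compact_borel : measurable (K : set T).
Proof.
have oK : open (~` K) by apply: closed_openC; exact: compact_closed.
rewrite -[K]setCK; apply: measurableC.
exact: (@sub_sigma_algebra _ setT (@open V) _ oK).
Qed.

Lemma open_borel (O : set V) : open O -> measurable (O : set T).
Proof. by move=> oO; exact: (@sub_sigma_algebra _ setT (@open V) _ oO). Qed.

(** Maps are controlled only on [K], hence relative openness. The open set that cuts out [A] on [K]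
    is the interior of the union of [A] with the complement of [K]. *)
Lemma rel_open_borel (A : set V) :
  (forall x, K x -> A x -> exists2 r, 0 < r &
     forall y, K y -> `|x - y| < r -> A y) ->
  measurable (K `&` A : set T).
Proof.
move=> HA.
rewrite (_ : K `&` A = K `&` (A `|` ~` K)°); last first.
  apply/seteqP; split=> x [Kx Ax]; split => //.
    have [r r0 Hr] := HA x Kx Ax; apply/nbhs_ballP; exists r => //= y xy.
    have [Ky|Ky] := pselect (K y); [left|by right].
    by apply: Hr => //; move: xy; rewrite -ball_normE.
  by have [] := nbhs_singleton Ax.
by apply: measurableI; [exact: compact_borel|apply: open_borel; exact: open_interior].
Qed.

Definition cont_on (S : pseudoMetricType R) (h : V -> S) : Prop :=
  forall x, K x -> forall e, 0 < e -> exists2 r, 0 < r &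
    forall y, K y -> `|x - y| < r -> ball (h x) e (h y).

Lemma cont_on_preimage (S : pseudoMetricType R) (h : V -> S) (O : set S) :
  cont_on h -> open O -> measurable (K `&` h @^-1` O : set T).
Proof.
move=> hc oO; apply: rel_open_borel => x Kx Ox.
have : nbhs (h x) O by exact: open_nbhs_nbhs.
move=> /nbhs_ballP[e /= e0 eO].
have [r r0 Hr] := hc x Kx e e0; exists r => // y Ky xy.
by apply: eO; exact: Hr.
Qed.

Lemma cont_on_measurable_real (h : V -> R) : cont_on (h : V -> R^o) ->
  measurable_fun (K : set T) (h : T -> R).
Proof.
move=> hc; apply: (measurability _ (@RGenOInfty.measurableE R)).
move=> _ [_ [x ->] <-]; exact: (@cont_on_preimage R^o h).
Qed.

Lemma cont_on_measurable (W : normedModType R) (h : V -> W) : cont_on h ->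
  measurable_fun (K : set T) (h : T -> borel W).
Proof.
move=> hc; apply: (@measurability _ _ T (borel W) K h (@open W)) => //.
by move=> _ [U oU <-]; exact: cont_on_preimage.
Qed.

Lemma lip_on_cont (W : normedModType R) (h : V -> W) L : lip_on K h L -> cont_on h.
Proof.
move=> hL x Kx e e0; exists (e / (`|L| + 1)).
  by rewrite divr_gt0 // ltr_wpDl.
move=> y Ky xy; rewrite -ball_normE /=.
apply: (le_lt_trans (hL _ _ Kx Ky)).
apply: (@le_lt_trans _ _ ((`|L| + 1) * `|x - y|)).
  by rewrite ler_wpM2r // (le_trans (ler_norm _)) // lerDl.
by rewrite mulrC -ltr_pdivlMr // ltr_wpDl.
Qed.

End borel_on_compact.

(** * Uniqueness and regularity of the flow *)

Section flow.
Context (R : realType) (l : nat).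
Local Notation V := 'rV[R]_l.
Context (g : V -> V) (Lambda : set V) (phi : R -> V -> V).
Hypotheses (cL : compact Lambda) (glip : locally_lipschitz setT g)
  (fl : invariant_flow g Lambda phi).

Lemma locally_lipschitz_continuous : continuous g.
Proof.
move=> x; have [r [k [r0 k0 gk]]] := locally_lipschitzP glip (I : setT x).
apply/(cvgrPdist_lt (FF := nbhs_filter x)) => e e0.
have e1 : 0 < e / (k + 1) by rewrite divr_gt0 // ltr_wpDl.
apply/nbhs_ballP; exists (Num.min r (e / (k + 1))) => /=; first by rewrite lt_min r0.
move=> y xy; have yr : ball x r y by apply: le_ball xy; rewrite ge_min lexx.
have ye : ball x (e / (k + 1)) y by apply: le_ball xy; rewrite ge_min lexx orbT.
apply: (le_lt_trans (gk x y (conj I (ballxx x r0)) (conj I yr))).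
apply: (@le_lt_trans _ _ ((k + 1) * `|x - y|)); first by rewrite ler_wpM2r // lerDl.
rewrite mulrC -ltr_pdivlMr ?ltr_wpDl //.
by move: ye; rewrite -ball_normE.
Qed.

Lemma flow_in t eta : Lambda eta -> Lambda (phi t eta).
Proof. by have [_ _ H] := fl => Le; rewrite -(H t); exists eta. Qed.

Lemma flow_cont eta : Lambda eta -> continuous (phi^~ eta).
Proof.
have [_ H _] := fl => Le t.
by have [/derivable1_diffP/differentiable_continuous] := H eta t Le.
Qed.

Lemma flow_is_derive eta (c s t : R) : Lambda eta ->
  is_derive t (1 : R) (fun t => phi (s + c * t) eta) (c *: g (phi (s + c * t) eta)).
Proof.
have [_ H _] := fl => Le; apply/is_derive_row => j.
have d1 : is_derive t (1 : R) (fun q : R => s + c * q) c.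
  apply: is_derive_eq; rewrite /GRing.scale /=; lra.
have /is_derive_row/(_ j) d2 := H eta (s + c * t) Le.
have := @is_derive1_comp R (fun s => phi s eta 0 j) (fun q : R => s + c * q) t _ _ d2 d1.
by rewrite [X in is_derive _ _ _ X]mulrC [in X in _ -> X]mxE.
Qed.

Lemma flow_affine_cont eta (c s : R) : Lambda eta -> continuous (fun t : R => phi (s + c * t) eta).
Proof.
move=> Le t.
apply: (@continuous_comp _ _ _ (fun t : R => s + c * t) (phi^~ eta)); last exact: flow_cont.
apply: cvgD; first exact: cvg_cst.
by apply: cvgM; [exact: cvg_cst|exact: cvg_id].
Qed.

(** Both trajectories stay in the compact set [Lambda], on which [g] has a single Lipschitz
    constant, so Gronwall's lemma applies on all of [0, T]. The factor [c] will be the time change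
    eps^-2; clipping the time extends [y] continuously to the whole line. *)
Lemma flow_unique (y : R -> V) (c T : R) : 0 < c -> 0 <= T ->
  {within `[0, T], continuous y} ->
  (forall t, 0 <= t <= T -> Lambda (y t)) ->
  (forall t : R, 0 < t < T -> is_derive t (1 : R) y (c *: g (y t))) ->
  forall t, 0 <= t <= T -> y t = phi (c * t) (y 0).
Proof.
move=> c0 T0 yc yL dy.
have [L [L1 gL]] := locally_lipschitz_compact cL (locally_lipschitzS (@subsetT _ _) glip).
have gc := locally_lipschitz_continuous.
have L0 : Lambda (y 0) by apply: yL; rewrite lexx.
pose X := y \o clip 0 T.
have Xc : continuous X by exact: (within_clip T0 _ yc).
pose Y t := phi (0 + c * t) (y 0).
have Yc : continuous Y by exact: flow_affine_cont.
have bc (Z : R -> V) : continuous Z -> continuous (fun t => c *: g (Z t)).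
  move=> Zc t; apply: cvgZr; apply: (@continuous_comp _ _ _ Z g); [exact: Zc|exact: gc].
have yX t : 0 <= t <= T -> y t = X t by move=> tT; rewrite /X /= clip_id.
have EX t : 0 <= t <= T -> X t = y 0 + time_integral t (fun t => c *: g (X t)).
  move=> tT; rewrite -yX //; apply: (@ti_ftc _ _ y _ T) => //; first exact: bc.
  move=> s /andP[s0 sT]; rewrite -yX; last by rewrite !ltW.
  by apply: dy; rewrite s0.
have EY t : 0 <= t <= T -> Y t = y 0 + time_integral t (fun t => c *: g (Y t)).
  move=> tT; rewrite (_ : y 0 = Y 0); last first.
    by rewrite /Y mulr0 addr0; have [-> ] := fl.
  apply: (@ti_ftc _ _ Y _ T) => //; first exact: bc.
    exact: continuous_subspaceT.
  by move=> s _; exact: flow_is_derive.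
move=> t tT; rewrite yX // -[c * t]add0r -/(Y t).
apply/eqP; rewrite -subr_eq0 -normr_eq0 eq_le normr_ge0 andbT.
have := @integral_stability _ _ X Y _ _ (c * L) 0 T _ Xc Yc (bc _ Xc) (bc _ Yc).
rewrite mul0r; apply => //.
- by rewrite mulr_ge0 ?ltW // (lt_le_trans _ L1).
- move=> s sT; rewrite -scalerBr normrZ gtr0_norm // -mulrA ler_wpM2l ?(ltW c0) //.
  apply: gL; first by rewrite -yX //; exact: yL.
  exact: flow_in.
- by move=> s sT; rewrite EX // EY // !addrK subrr normr0.
Qed.

(** [invariant_flow] does not postulate the group law; it follows from uniqueness. The first time
    [t] may be negative, which later allows a shift along the orbit to be undone. *)
Lemma flow_semigroup s t eta : Lambda eta -> 0 <= s -> phi s (phi t eta) = phi (t + s) eta.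
Proof.
move=> Le s0.
have : phi (t + 1 * s) eta = phi (1 * s) (phi (t + 1 * 0) eta).
  apply: (@flow_unique (fun s => phi (t + 1 * s) eta) 1 s) => //.
  - by apply: continuous_subspaceT; exact: flow_affine_cont.
  - by move=> q _; exact: flow_in.
  - by move=> q _; exact: flow_is_derive.
  - by rewrite s0 lexx.
by rewrite mulr0 addr0 !mul1r.
Qed.

Lemma flow_int eta t : Lambda eta -> 0 <= t ->
  phi t eta = eta + time_integral t (fun s => g (phi s eta)).
Proof.
move=> Le t0; have [phi0 H _] := fl.
rewrite -{2}(phi0 eta Le); apply: (@ti_ftc _ _ (phi^~ eta) _ t).
- move=> s; apply: (@continuous_comp _ _ _ (phi^~ eta) g); first exact: flow_cont.
  exact: locally_lipschitz_continuous.
- by apply: continuous_subspaceT; exact: flow_cont.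
- by move=> s _; exact: H.
- by rewrite t0 lexx.
Qed.

Lemma flow_lip T : exists C, 0 <= C /\ forall eta eta' t, Lambda eta -> Lambda eta' ->
  0 <= t <= T -> `|phi t eta - phi t eta'| <= C * `|eta - eta'|.
Proof.
have [L [L1 gL]] := locally_lipschitz_compact cL (locally_lipschitzS (@subsetT _ _) glip).
have gc eta : Lambda eta -> continuous (fun s => g (phi s eta)).
  move=> Le s; apply: (@continuous_comp _ _ _ (phi^~ eta) g); first exact: flow_cont.
  exact: locally_lipschitz_continuous.
exists (expR (L * T)); split; first exact: expR_ge0.
move=> eta eta' t Le Le' tT; rewrite mulrC.
apply: (@integral_stability _ _ (phi^~ eta) (phi^~ eta') _ _ L _ T _
  (flow_cont Le) (flow_cont Le') (gc _ Le) (gc _ Le')) => //.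
- by rewrite (le_trans ler01).
- by move=> s _; apply: gL; exact: flow_in.
- by move=> s /andP[s0 _]; rewrite !flow_int // !addrK.
Qed.

End flow.

Lemma lip_on_comp_cont (R : realType) (V W : normedModType R) (A : set V)
    (h : V -> W) L (p : R -> V) :
  lip_on A h L -> (forall s, A (p s)) -> continuous p -> continuous (h \o p).
Proof.
move=> hL Ap pc s; apply/cvgrPdist_lt => e e0.
have L0 : 0 < `|L| + 1 by rewrite ltr_wpDl.
near=> t; apply: (le_lt_trans (hL _ _ (Ap s) (Ap t))).
apply: (@le_lt_trans _ _ ((`|L| + 1) * `|p s - p t|)).
  by rewrite ler_wpM2r // (le_trans (ler_norm _)) // lerDl.
rewrite mulrC -ltr_pdivlMr //.
near: t; have /cvgrPdist_lt := pc s; apply; exact: divr_gt0.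
Unshelve. all: by end_near. Qed.

(** A bounded discrepancy between Birkhoff sums disappears after division by n and cannot change the
    limsup. *)
Lemma limsup_set_stable (R : realType) (disp : measure_display)
    (T : measurableType disp) (D : set T) (tm : T -> T)
    (v : T -> R) (c C : R) x y : D y ->
  (forall n, `|birkhoff tm v n x - birkhoff tm v n y| <= C) ->
  limsup_set D tm v c x -> limsup_set D tm v c y.
Proof.
move=> Dy vC [_ Hx]; split=> // j N.
have j0 : 0 < (j.+1%:R : R) by rewrite ltr0n.
set N' := maxn N (Num.bound (`|C| * 2 * j.+1%:R)).
(* The index 2 j + 1 leaves the slack 1 / (2 (j + 1)), half of the one allowed; [N'] is large enough
   for the other half to absorb [C / n]. *)
have [n [N'n Hn]] := Hx (2 * j).+1 N'.
exists n; split; first by rewrite (leq_ltn_trans _ N'n) // leq_maxl.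
have E2 : ((2 * j).+2%:R : R) = 2 * j.+1%:R by rewrite -natrM mulnS.
have C1 : C * 2 <= n%:R * j.+1%:R^-1.
  rewrite ler_pdivlMr //; apply: ltW.
  apply: (@le_lt_trans _ _ (`|C| * 2 * j.+1%:R)).
    by rewrite ler_wpM2r // ler_wpM2r // ler_norm.
  apply: lt_trans (archi_boundP _) _; first by rewrite !mulr_ge0.
  by rewrite ltr_nat (leq_ltn_trans _ N'n) // leq_maxr.
have := vC n; rewrite ler_norml => /andP[_ vn].
move: Hn; rewrite E2 invfM.
move: (j.+1%:R^-1 : R) (n%:R : R) C1 vn => q m C1 vn Hn.
have -> : (c - q) * m = (c - 2^-1 * q) * m - (m * q) / 2 by field.
lra.
Qed.

(** * The flow as a measure-preserving map *)

Section flow_ergodic.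
Context (R : realType) (l : nat).
Local Notation V := 'rV[R]_l.
Context (g : V -> V) (Lambda : set V) (phi : R -> V -> V).
Context (mu : probability (borel V) R).
Hypotheses (cL : compact Lambda) (glip : locally_lipschitz setT g)
  (fl : invariant_flow g Lambda phi) (erg : ergodic_measure Lambda phi mu).
Local Notation D := (Lambda : set (borel V)).
Local Notation E u := (\int[mu]_(x in D) u x).
Local Notation bmf := (bounded_mfun D).

Let mD : measurable D := compact_borel cL.

Lemma lip_on_bmf (h : V -> R) L M : lip_on Lambda (h : V -> R^o) L ->
  bounded_on Lambda (h : V -> R^o) M -> bmf h.
Proof.
move=> hL hM; split; last by exists M.
by apply: cont_on_measurable_real => //; exact: lip_on_cont hL.
Qed.

(** The identity outside [Lambda], where nothing is known about [phi]: a push-forward of [mu] needs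
    a measurable map on the whole space. *)
Definition flow_map (t : R) (x : borel V) : borel V :=
  if pselect (Lambda x) then phi t x else x.

Lemma flow_mapE t x : Lambda x -> flow_map t x = phi t x.
Proof. by rewrite /flow_map; case: pselect. Qed.

Lemma flow_map_in t x : Lambda x -> Lambda (flow_map t x).
Proof. by move=> Lx; rewrite flow_mapE //; exact: (flow_in fl). Qed.

Lemma flow_map_cont_on t : 0 <= t -> cont_on Lambda (phi t).
Proof.
move=> t0; have [C [_ HC]] := flow_lip cL glip fl t.
apply: (@lip_on_cont _ _ _ _ _ C) => x y Lx Ly.
by apply: HC; rewrite // t0 lexx.
Qed.

Lemma flow_map_preimage t (A : set (borel V)) :
  flow_map t @^-1` A = (D `&` phi t @^-1` A) `|` (A `&` ~` D).
Proof.
apply/seteqP; split=> x /=; rewrite /flow_map; case: pselect => Lx.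
- by move=> Ax; left.
- by move=> Ax; right.
- by move=> [[]//|[_ /(_ Lx)]].
- by move=> [[]//|[]].
Qed.

Lemma flow_map_measurable t : 0 <= t -> measurable_fun setT (flow_map t).
Proof.
move=> t0 _ A mA; rewrite setTI.
have mp := cont_on_measurable cL (flow_map_cont_on t0).
rewrite flow_map_preimage.
apply: measurableU; first exact: mp.
by apply: measurableI => //; exact: measurableC.
Qed.

Lemma flow_map_bmf t (u : borel V -> R) : 0 <= t -> bmf u -> bmf (u \o flow_map t).
Proof.
move=> t0 [mu_ [M uM]]; split; last first.
  by exists M => x Lx; apply: uM; exact: flow_map_in.
apply: (measurable_comp mD _ mu_).
  by move=> _ [x Lx <-]; exact: flow_map_in.
by apply: measurable_funTS; exact: flow_map_measurable.
Qed.

(** After extension of [u] by 0 this is the image measure formula. The image of [mu] is [mu] itself: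
    the part in [Lambda] is the invariance hypothesis, and the complement of [Lambda] is null. *)
Lemma flow_map_expect t (u : borel V -> R) : 0 <= t -> bmf u ->
  E (u \o flow_map t) = E u.
Proof.
move=> t0 bu; have mF := flow_map_measurable t0.
have mu1 : mu D = 1%E by case: erg.
have mur : measurable_fun setT ((u \_ D) : borel V -> R).
  by apply/(measurable_restrictT u mD); case: bu.
have Ecomp : (u \o flow_map t) \_ D = (u \_ D) \o flow_map t.
  apply/funext => x; rewrite /patch /= /flow_map.
  case: pselect => Lx; last by rewrite memNset // memNset.
  by rewrite !mem_set //; exact: (flow_in fl).
have iu : mu.-integrable setT (EFin \o ((u \_ D) \o flow_map t)).
  rewrite -Ecomp -restrict_EFin; apply/integrable_restrict => //.
  by rewrite setTI; apply: bounded_mfun_integrable => //; exact: flow_map_bmf.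
rewrite Rintegral_mkcond Ecomp [RHS]Rintegral_mkcond; congr fine.
have := @integral_pushforward _ _ _ _ _ _ mF mu setT (EFin \o (u \_ D)).
rewrite preimage_setT => <- //; last exact/measurable_EFinP.
apply: eq_measure_integral => A mA _.
rewrite /pushforward.
have [_ inv _] := erg.
rewrite -[RHS](inv t A mA) -[LHS]/(mu (flow_map t @^-1` A)).
rewrite flow_map_preimage.
have mC : measurable (A `&` ~` D) by apply: measurableI => //; exact: measurableC.
rewrite measureU //.
- rewrite [X in (_ + X)%E](_ : _ = 0%E) ?adde0 //.
  have mC' : measurable (~` D) by exact: measurableC.
  apply: (@subset_measure0 _ _ _ mu _ (~` D)) => //.
  by have := @probability_setC _ _ _ mu D mD; rewrite mu1 subee.
- exact: (cont_on_measurable cL (flow_map_cont_on t0)).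
- by apply/seteqP; split=> x //= [[Lx _] [_ /(_ Lx)]].
Qed.

End flow_ergodic.

(** * Averaging along the fast flow *)

Section time_average.
Context (R : realType) (l : nat).
Local Notation V := 'rV[R]_l.
Context (g : V -> V) (Lambda : set V) (phi : R -> V -> V).
Context (mu : probability (borel V) R).
Hypotheses (cL : compact Lambda) (glip : locally_lipschitz setT g)
  (fl : invariant_flow g Lambda phi) (erg : ergodic_measure Lambda phi mu).
Local Notation D := (Lambda : set (borel V)).
Local Notation E u := (\int[mu]_(x in D) u x).
Local Notation bmf := (bounded_mfun D).
Context (h : V -> R) (L M : R).
Hypotheses (hL : lip_on Lambda (h : V -> R^o) L) (L0 : 0 <= L) (M0 : 0 <= M)
  (hM : bounded_on Lambda (h : V -> R^o) M) (Eh0 : E h = 0).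

Let mD : measurable D := compact_borel cL.

Definition time_sum (t : R) (x : V) : R := sint (fun s => h (phi s x)) t.

Lemma obs_flow_cont x : Lambda x -> continuous (fun s => h (phi s x)).
Proof.
move=> Lx.
apply: (@lip_on_comp_cont _ _ R^o _ _ _ (phi^~ x) hL); last exact: (flow_cont fl).
by move=> s; exact: (flow_in fl).
Qed.

Lemma time_sumD s t x : Lambda x -> 0 <= s -> 0 <= t ->
  time_sum (s + t) x = time_sum s x + time_sum t (phi s x).
Proof.
move=> Lx s0 t0; rewrite /time_sum -[t in LHS]mul1r sint_affine //; last exact: obs_flow_cont.
rewrite mul1r; congr (_ + _); apply: eq_sint => q /andP[q0 _].
by rewrite mul1r (flow_semigroup cL glip fl).
Qed.

Lemma time_sum_le t x : Lambda x -> 0 <= t -> `|time_sum t x| <= M * t.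
Proof.
move=> Lx t0; rewrite -sint_cst //; apply: norm_sint_le.
- exact: obs_flow_cont.
- exact: cst_continuous.
- by move=> s _; apply: hM; exact: (flow_in fl).
Qed.

Lemma time_sum_bmf t : 0 <= t -> bmf (time_sum t).
Proof.
move=> t0; have [C [C0 HC]] := flow_lip cL glip fl t.
apply: (@lip_on_bmf _ _ _ cL _ (L * C * t) (M * t)).
  move=> x y Lx Ly; rewrite /time_sum -sintB; try exact: obs_flow_cont.
  have -> : L * C * t * `|x - y| = (L * C * `|x - y|) * t by ring.
  rewrite -sint_cst //; apply: norm_sint_le.
  - by move=> s; apply: cvgB; exact: obs_flow_cont.
  - exact: cst_continuous.
  - move=> s st; rewrite (le_trans (hL (flow_in fl s Lx) (flow_in fl s Ly))) //.
    by rewrite -mulrA ler_wpM2l // HC.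
by move=> x Lx; exact: time_sum_le.
Qed.

Lemma obs_bmf : bmf h.
Proof. exact: (@lip_on_bmf _ _ _ cL _ L M). Qed.

Lemma expect_time_sumD s t : 0 <= s -> 0 <= t ->
  E (time_sum (s + t)) = E (time_sum s) + E (time_sum t).
Proof.
move=> s0 t0.
rewrite -(flow_map_expect cL glip fl erg s0 (time_sum_bmf t0)).
rewrite -expectD //; [|exact: time_sum_bmf|].
  apply: eq_Rintegral => x; rewrite inE => Lx.
  by rewrite time_sumD //= flow_mapE.
by apply: (flow_map_bmf cL glip fl) => //; exact: time_sum_bmf.
Qed.

Lemma flow_speed : exists G, 0 <= G /\ forall x s, Lambda x -> 0 <= s ->
  `|phi s x - x| <= G * s.
Proof.
have [G [G0 HG]] := locally_lipschitz_bounded cL (locally_lipschitzS (@subsetT _ _) glip).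
exists G; split => // x s Lx s0.
rewrite {1}(flow_int glip fl Lx s0) addrAC subrr add0r; apply: ti_norm_cst => //.
  move=> q; apply: (@continuous_comp _ _ _ (phi^~ x) g); first exact: (flow_cont fl).
  exact: (locally_lipschitz_continuous glip).
by move=> q _; apply: HG; exact: (flow_in fl).
Qed.

(* t |-> E (time_sum t) is additive and O(t^2) at 0, hence vanishes. *)
Lemma expect_time_sum1 : E (time_sum 1) = 0.
Proof.
have [G [G0 HG]] := flow_speed.
have quad t : 0 <= t -> `|E (time_sum t)| <= L * G * t * t.
  move=> t0; have bt := time_sum_bmf t0.
  (* [t * h] has mean zero, and its distance to [time_sum t] is the integral of h(phi_s x) - h(x),
     which is at most L G s at time s. *)
  have -> : E (time_sum t) = E (fun x => time_sum t x - t * h x).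
    rewrite expectB //; last by apply: bounded_mfunZ; exact: obs_bmf.
    by rewrite expectZ //; [rewrite Eh0 mulr0 subr0|exact: obs_bmf].
  apply: norm_expect_cst => //.
  - by apply: bounded_mfunB => //; apply: bounded_mfunZ; exact: obs_bmf.
  - by rewrite !mulr_ge0.
  move=> x Lx; rewrite [t * h x]mulrC -(sint_cst (h x) t0) /time_sum -sintB.
  - rewrite -[leRHS]sint_cst //; apply: norm_sint_le.
    + move=> s; apply: cvgB; first exact: obs_flow_cont.
      exact: cvg_cst.
    + exact: cst_continuous.
    + move=> s /andP[s0 st]; rewrite (le_trans (hL (flow_in fl s Lx) Lx)) //.
      rewrite -mulrA ler_wpM2l // (le_trans (HG _ _ Lx s0)) // ler_wpM2l //.
  - exact: obs_flow_cont.
  - exact: cst_continuous.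
have addi (m k : nat) : E (time_sum (k%:R / m.+1%:R)) = k%:R * E (time_sum (m.+1%:R^-1)).
  elim: k => [|k ih].
    rewrite !mul0r (eq_Rintegral mu (g := fun _ => 0)).
      by rewrite Rintegral_cst // mul0r.
    by move=> x _; rewrite /time_sum sintN.
  rewrite -[k.+1%:R]natr1 [X in time_sum X]mulrDl mul1r.
  by rewrite expect_time_sumD ?divr_ge0 ?invr_ge0 // ih mulrDl mul1r.
apply/eqP; rewrite -normr_eq0 eq_le normr_ge0 andbT.
apply/ler_addgt0Pl => e e0; rewrite addr0.
(* By additivity over m + 1 equal pieces the mean is at most (m + 1) L G / (m + 1)^2, which this
   choice brings below [e]. *)
set m := Num.bound (L * G / e).
have m1 : (0 : R) < m.+1%:R by rewrite ltr0n.
have -> : time_sum 1 = time_sum (m.+1%:R / m.+1%:R) by rewrite divff // gt_eqF.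
rewrite addi normrM normr_nat.
rewrite (@le_trans _ _ (m.+1%:R * (L * G * m.+1%:R^-1 * m.+1%:R^-1))) //.
  by rewrite ler_wpM2l // quad // invr_ge0.
have -> : m.+1%:R * (L * G * m.+1%:R^-1 * m.+1%:R^-1) = L * G / m.+1%:R.
  by field; rewrite gt_eqF.
rewrite ler_pdivrMr // [e * _]mulrC -ler_pdivrMr //.
apply/ltW; apply: lt_trans (archi_boundP _) _.
  by rewrite divr_ge0 ?mulr_ge0 // ltW.
by rewrite ltr_nat.
Qed.

Local Notation tm := (flow_map Lambda phi 1).

Lemma iter_flow_map k x : Lambda x -> iter k tm x = phi k%:R x.
Proof.
move=> Lx; elim: k => [|k ih] /=; first by have [-> ] := fl.
rewrite ih flow_mapE; last exact: (flow_in fl).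
by rewrite (flow_semigroup cL glip fl) // -natr1.
Qed.

Lemma birkhoff_time_sum n x : Lambda x -> birkhoff tm (time_sum 1) n x = time_sum n%:R x.
Proof.
move=> Lx; elim: n => [|n ih].
  by rewrite /birkhoff big_ord0 /time_sum sintN.
rewrite /birkhoff big_ord_recr /= -/(birkhoff tm (time_sum 1) n x) ih.
by rewrite iter_flow_map // -natr1 time_sumD.
Qed.

(** The orbit segments over [0, n] and [t, t + n] differ by two end pieces of length [|t|]. A
    negative shift is reduced to a positive one by starting from [phi t x]. *)
Lemma time_sum_shift t n x : Lambda x ->
  `|time_sum n%:R x - time_sum n%:R (phi t x)| <= 2 * M * `|t|.
Proof.
have pos s y : Lambda y -> 0 <= s ->
  `|time_sum n%:R y - time_sum n%:R (phi s y)| <= 2 * M * s.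
  move=> Ly s0.
  have := time_sumD Ly s0 (ler0n _ n); rewrite addrC time_sumD // => H.
  have -> : time_sum n%:R y - time_sum n%:R (phi s y) =
            time_sum s y - time_sum s (phi n%:R y) by lra.
  rewrite (le_trans (ler_normB _ _)) //.
  have := time_sum_le Ly s0; have := time_sum_le (flow_in fl n%:R Ly) s0; lra.
move=> Lx; have [t0|t0] := leP 0 t; first by rewrite (ger0_norm t0) pos.
have Nt0 : 0 <= - t by rewrite oppr_ge0 ltW.
have := pos _ _ (flow_in fl t Lx) Nt0.
rewrite (flow_semigroup cL glip fl) // subrr.
by have [-> // _ _] := fl; rewrite distrC (ltr0_norm t0).
Qed.

(** By [time_sum_shift] and [limsup_set_stable] the limsup set is invariant under every [phi t],
    which is what ergodicity of the flow requires. The hypothesis on [v] covers both [time_sum 1]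
    and its opposite. *)
Lemma limsup_set01 (v : borel V -> R) c : bmf v ->
  (forall n x y, Lambda x -> Lambda y -> `|birkhoff tm v n x - birkhoff tm v n y| =
     `|time_sum n%:R x - time_sum n%:R y|) ->
  mu (limsup_set D tm v c) = 0%E \/ mu (limsup_set D tm v c) = 1%E.
Proof.
move=> bv vE; have [_ _] := erg; apply.
- apply: measurable_limsup_set => //.
  by move=> u bu; apply: (flow_map_bmf cL glip fl).
- by move=> x [].
move=> t; apply/seteqP; split=> [x [Lx /= Hx]|x Hx].
  apply: (limsup_set_stable _ _ Hx) => // n.
  rewrite vE //; last exact: (flow_in fl).
  by rewrite distrC; exact: time_sum_shift.
have Lx : Lambda x by case: Hx.
split=> //=; apply: (limsup_set_stable _ _ Hx); first exact: (flow_in fl).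
move=> n; rewrite vE //; last exact: (flow_in fl).
exact: time_sum_shift.
Qed.

(** The Birkhoff sums of [time_sum 1] under the time-one map are the integrals of [h] along the
    orbit over [0, n], so the discrete theorem applies. *)
Theorem time_average_cvg :
  E (fun x => `|time_sum n%:R x| / n%:R) @[n --> \oo] --> (0 : R).
Proof.
have mu1 : mu D = 1%E by case: erg.
have bu := time_sum_bmf ler01.
have bN := bounded_mfunN bu.
suff : E (fun x => `|birkhoff tm (time_sum 1) n x| / n%:R) @[n --> \oo] --> (0 : R).
  apply: cvg_trans; apply: near_eq_cvg; apply: nearW => n.
  apply: eq_Rintegral => x; rewrite inE => Lx.
  by rewrite birkhoff_time_sum.
apply: (@mean_ergodic _ _ _ mu D mD mu1 tm _ _ _ (time_sum 1) bu expect_time_sum1).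
- by move=> x Lx; exact: (flow_map_in fl).
- by move=> u; exact: (flow_map_bmf cL glip fl).
- by move=> u; exact: (flow_map_expect cL glip fl erg).
- move=> c; apply: limsup_set01 => //.
  by move=> n x y Lx Ly; rewrite !birkhoff_time_sum.
- move=> c; apply: limsup_set01 => //.
  move=> n x y Lx Ly; rewrite !birkhoffN !birkhoff_time_sum // opprK addrC.
  by rewrite distrC.
Qed.

End time_average.

Lemma cvg_big_sum (R : realType) (I J : Type) (F : set_system I) (FF : Filter F)
    (r : seq J) (u : J -> I -> R) :
  (forall j, u j i @[i --> F] --> (0 : R)) ->
  (\sum_(j <- r) u j i) @[i --> F] --> (0 : R).
Proof.
move=> u0; elim: r => [|j r ih].
  by under eq_fun do rewrite big_nil; exact: cvg_cst.
under eq_fun do rewrite big_cons.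
have := cvgD (u0 j) ih; rewrite addr0; exact.
Qed.

(** * Averages along the accelerated flow *)

Section fast_average.
Context (R : realType) (l d : nat).
Local Notation V := 'rV[R]_l.
Context (g : V -> V) (Lambda : set V) (phi : R -> V -> V).
Context (mu : probability (borel V) R).
Hypotheses (cL : compact Lambda) (glip : locally_lipschitz setT g)
  (fl : invariant_flow g Lambda phi) (erg : ergodic_measure Lambda phi mu).
Local Notation D := (Lambda : set (borel V)).
Local Notation E u := (\int[mu]_(x in D) u x).
Local Notation bmf := (bounded_mfun D).

Let mD : measurable D := compact_borel cL.

Definition fast_integral (W : nat) (h : V -> 'rV[R]_W) (c t : R) (x : V) :=
  time_integral t (fun s => h (phi (c * s) x)).

Section observable.
Context (W : nat) (h : V -> 'rV[R]_W) (L M : R).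
Hypotheses (hL : lip_on Lambda h L) (L0 : 0 <= L) (M0 : 0 <= M)
  (hM : bounded_on Lambda h M).

Lemma fast_obs_cont (c : R) x : Lambda x -> continuous (fun s : R => h (phi (c * s) x)).
Proof.
move=> Lx; apply: (@lip_on_comp_cont _ _ _ _ _ _ (fun s : R => phi (c * s) x) hL).
  by move=> s; exact: (flow_in fl).
have := flow_affine_cont (c := c) (s := 0) fl Lx.
by under eq_fun do rewrite add0r.
Qed.

Lemma fast_integral_lip c t : 0 <= c -> 0 <= t -> exists C, 0 <= C /\
  forall x y s, Lambda x -> Lambda y -> 0 <= s <= t ->
  `|fast_integral h c s x - fast_integral h c s y| <= C * `|x - y|.
Proof.
move=> c0 t0; have [C [C0 HC]] := flow_lip cL glip fl (c * t).
exists (L * C * t); split; first by rewrite !mulr_ge0.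
move=> x y s Lx Ly /andP[s0 st]; rewrite /fast_integral -tiB; try exact: fast_obs_cont.
have -> : L * C * t * `|x - y| = (L * C * `|x - y|) * t by ring.
apply: (@le_trans _ _ (L * C * `|x - y| * s)); last by rewrite ler_wpM2l // !mulr_ge0.
apply: ti_norm_cst => //.
  by move=> q; apply: cvgB; exact: fast_obs_cont.
move=> q /andP[q0 qs]; rewrite (le_trans (hL (flow_in fl _ Lx) (flow_in fl _ Ly))) //.
rewrite -mulrA ler_wpM2l // HC // mulr_ge0 //= ler_wpM2l //.
exact: le_trans st.
Qed.

Lemma fast_integral_bmf c t : 0 <= c -> 0 <= t ->
  bmf (fun x => `|fast_integral h c t x|).
Proof.
move=> c0 t0; have [C [C0 HC]] := fast_integral_lip c0 t0.
apply: (@lip_on_bmf _ _ _ cL _ C (M * t)).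
  move=> x y Lx Ly; apply: le_trans (ler_dist_dist _ _) _.
  by apply: HC => //; rewrite t0 lexx.
move=> x Lx; rewrite normr_id; apply: ti_norm_cst => //; first exact: fast_obs_cont.
by move=> s _; apply: hM; exact: (flow_in fl).
Qed.

End observable.

Lemma row_norm_sum (v : 'rV[R]_d) : `|v| <= \sum_j `|v 0 j|.
Proof.
apply: row_norm_le => [|j]; first exact: sumr_ge0.
by rewrite (bigD1 j) //= lerDl sumr_ge0.
Qed.

Lemma fast_average_cvg (h : V -> 'rV[R]_d) (L M t : R) :
  lip_on Lambda h L -> 0 <= L -> 0 <= M -> bounded_on Lambda h M ->
  row_integral mu D h = 0 -> 0 <= t ->
  E (fun x => `|fast_integral h (eps ^+ 2)^-1 t x|) @[eps --> 0^'+] --> (0 : R).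
Proof.
move=> hL L0 M0 hM h0; rewrite le_eqVlt => /predU1P[<-|t0].
  rewrite (_ : (fun _ => _) = fun _ => 0); first exact: cvg_cst.
  apply/funext => eps; rewrite (eq_Rintegral mu (g := fun _ => 0)) => [|x _].
    by rewrite Rintegral_cst // mul0r.
  by rewrite /fast_integral tiN // normr0.
pose hj j (x : V) : R := h x 0 j.
have hjL j : lip_on Lambda (hj j : V -> R^o) L.
  move=> x y Lx Ly; apply: le_trans (hL x y Lx Ly).
  by have := coord_norm_le (h x - h y) j; rewrite !mxE.
have hjM j : bounded_on Lambda (hj j : V -> R^o) M.
  by move=> x Lx; apply: le_trans (hM x Lx); exact: coord_norm_le.
have hj0 j : E (hj j) = 0.
  by have /rowP/(_ j) := h0; rewrite !mxE.
pose a n := \sum_j E (fun x => `|time_sum phi (hj j) n%:R x| / n%:R).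
have acvg : a n @[n --> \oo] --> (0 : R).
  apply: (@cvg_big_sum R _ _ _ _ _
    (fun j n => E (fun x => `|time_sum phi (hj j) n%:R x| / n%:R))) => j.
  exact: (time_average_cvg cL glip fl erg (hjL j) L0 (hjM j) (hj0 j)).
have bj j n : bmf (fun x => `|time_sum phi (hj j) n%:R x| / n%:R).
  under eq_fun do rewrite mulrC.
  apply: bounded_mfunZ; apply: bounded_mfun_norm.
  exact: (time_sum_bmf cL glip fl (hjL j) L0 (hjM j)).
(* A change of variables gives c^-1 times the integral over [0, c t]. Replacing c t by its integer
   part drops a piece shorter than 1, which costs at most M / c in each of the [d] coordinates. *)
have key (c : R) : 0 < c ->
    E (fun x => `|fast_integral h c t x|) <=
    t * a (Num.trunc (c * t)) + d%:R * M * c^-1.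
  move=> c0; have ct0 : 0 <= c * t by rewrite mulr_ge0 // ltW.
  set n := Num.trunc _.
  have /andP[nct ctn] := truncn_itv ct0.
  rewrite -/n in nct ctn.
  apply: (@le_trans _ _ (E (fun x => t * (\sum_j `|time_sum phi (hj j) n%:R x| / n%:R)
     + d%:R * M * c^-1))).
    apply: le_expect => //.
    - exact: (fast_integral_bmf hL L0 hM (ltW c0) (ltW t0)).
    - apply: bounded_mfunD; last exact: bounded_mfun_cst.
      by apply: bounded_mfunZ; exact: bounded_mfun_sum.
    move=> x Lx; apply: (le_trans (row_norm_sum _)).
    have -> : d%:R * M * c^-1 = \sum_(j < d) M * c^-1.
      by rewrite sumr_const card_ord -[RHS]mulr_natl mulrA.
    rewrite mulr_sumr -big_split /=; apply: ler_sum => j _.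
    rewrite tiE.
    have oc := obs_flow_cont fl (hjL j) Lx.
    have -> : sint (fun s => h (phi (c * s) x) 0 j) t = c^-1 * time_sum phi (hj j) (c * t) x.
      have := @sint_affine R (fun s => hj j (phi s x)) 0 c t oc (lexx 0) c0 (ltW t0).
      rewrite add0r (sintN _ (lexx 0)) add0r /time_sum => ->.
      rewrite mulrA mulVf ?gt_eqF // mul1r.
      by apply: eq_sint => s _; rewrite add0r.
    have -> : c * t = n%:R + (c * t - n%:R) by rewrite addrC subrK.
    have r0 : 0 <= c * t - n%:R by rewrite subr_ge0.
    rewrite (time_sumD cL glip fl (hjL j)) // normrM (gtr0_norm (x := c^-1)) ?invr_gt0 //.
    apply: (@le_trans _ _ (c^-1 * (`|time_sum phi (hj j) n%:R x| + M))).
      rewrite ler_wpM2l ?invr_ge0 ?(ltW c0) // (le_trans (ler_normD _ _)) // lerD2l.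
      apply: (le_trans (time_sum_le fl (hjL j) (hjM j) (flow_in fl _ Lx) r0)).
      rewrite ler_piMr // lerBlDr [1 + _]addrC natr1; exact: ltW.
    rewrite mulrDr [c^-1 * M]mulrC lerD2r mulrC.
    (* For n = 0 the quotient by n is harmless: the integral over [0, 0] vanishes, and so do both
       sides. *)
    have [n0|n0] := posnP n.
      by rewrite n0 /time_sum sintN // normr0 !mul0r mulr0.
    have nR : 0 < (n%:R : R) by rewrite ltr0n.
    rewrite mulrCA ler_wpM2l //.
    by rewrite ler_pdivlMr // mulrC ler_pdivrMr // mulrC.
  rewrite expectD //; [|by apply: bounded_mfunZ; exact: bounded_mfun_sum|exact: bounded_mfun_cst].
  rewrite expectZ // ?expect_sum //; last exact: bounded_mfun_sum.
  by rewrite lerD2l; apply: expect_cst_le => //; rewrite !mulr_ge0 ?invr_ge0 // ltW.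
apply/cvgrPdist_lt => e e0.
have e2 : 0 < e / 2 / t by rewrite !divr_gt0.
have /cvgrPdist_lt /(_ _ e2)[N _ HN] := acvg.
have dM : 0 <= d%:R * M by rewrite mulr_ge0.
have dM1 : 0 < d%:R * M + 1 by apply: (le_lt_trans dM); rewrite ltrDl.
near=> eps.
have eps0 : 0 < eps by near: eps; exact: nbhs_right_gt.
have c0 : 0 < (eps ^+ 2)^-1 by rewrite invr_gt0 exprn_gt0.
have eps1 : eps <= 1 by near: eps; apply: nbhs_right_le; exact: ltr01.
have epsq : eps ^+ 2 <= eps by rewrite expr2 ler_piMl // ltW.
have E0 : 0 <= E (fun x => `|fast_integral h (eps ^+ 2)^-1 t x|) by apply: Rintegral_ge0.
rewrite sub0r normrN ger0_norm // (le_lt_trans (key _ c0)) //.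
rewrite (splitr e) ltrD //.
  have : `|0 - a (Num.trunc ((eps ^+ 2)^-1 * t))| < e / 2 / t.
    apply: HN => /=.
    rewrite truncn_ge_nat; last by rewrite mulr_ge0 ?(ltW t0) ?(ltW c0).
    rewrite mulrC ler_pdivlMr ?exprn_gt0 // mulrC.
    apply: (@le_trans _ _ (eps * N%:R)); first by rewrite ler_wpM2r.
    apply: (@le_trans _ _ (eps * N.+1%:R)).
      by rewrite ler_wpM2l ?ltW // ltr_nat.
    rewrite -ler_pdivlMr ?ltr0n //.
    by near: eps; apply: nbhs_right_le; rewrite divr_gt0.
  rewrite sub0r normrN => /(le_lt_trans (ler_norm _)).
  by rewrite ltr_pdivlMr // mulrC.
rewrite invrK.
apply: (@le_lt_trans _ _ ((d%:R * M + 1) * eps)).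
  by apply: ler_pM => //; [rewrite exprn_ge0 // ltW|rewrite lerDl].
rewrite mulrC -ltr_pdivlMr //.
by near: eps; apply: nbhs_right_lt; rewrite !divr_gt0.
Unshelve. all: by end_near. Qed.

End fast_average.

(** * The truncated slow equation *)

Section clip_vector.
Context (R : realType) (d : nat).
Local Notation V := 'rV[R]_d.

(** Clipping each coordinate suits the max norm: the map is 1-Lipschitz, takes its values in the
    ball of radius [K] and fixes that ball. *)
Definition clipv (K : R) (x : V) : V := \row_j clip (- K) K (x 0 j).

Lemma clip_lip (a b s t : R) : `|clip a b s - clip a b t| <= `|s - t|.
Proof.
wlog st : s t / s <= t.
  move=> H; have [/H//|ts] := leP s t.
  by rewrite distrC [leRHS]distrC; apply/H/ltW.
rewrite (distrC s) (ger0_norm (x := t - s)) ?subr_ge0 // distrC ger0_norm.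
  rewrite /clip; case: (ltP b s) => bs; case: (ltP b t) => bt;
    do 2?[case: (ltP a _) => ?]; lra.
rewrite subr_ge0 /clip; case: (ltP b s) => bs; case: (ltP b t) => bt;
    do 2?[case: (ltP a _) => ?]; lra.
Qed.

Lemma clipv_lip K x y : `|clipv K x - clipv K y| <= `|x - y|.
Proof.
apply: row_norm_le => // j; rewrite !mxE (le_trans (clip_lip _ _ _ _)) //.
by have := coord_norm_le (x - y) j; rewrite !mxE.
Qed.

Lemma clipv_norm K x : 0 <= K -> `|clipv K x| <= K.
Proof.
move=> K0; apply: row_norm_le => // j; rewrite mxE ler_norml clip_itv //.
by rewrite ge0_cp.
Qed.

Lemma clipv_id K x : `|x| <= K -> clipv K x = x.
Proof.
move=> xK; apply/rowP => j; rewrite mxE clip_id // -ler_norml.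
exact: le_trans (coord_norm_le _ _) xK.
Qed.

Lemma compact_norm_ball K : compact [set x : V | `|x| <= K].
Proof.
apply: bounded_closed_compact.
  exists K; split; first exact: num_real.
  by move=> M KM x /= xK; rewrite (le_trans xK) // ltW.
rewrite (_ : [set x | _] = (fun x : V => `|x|) @^-1` [set` `]-oo, K]]).
  apply: preimage_closed; last exact: interval_closed.
  by move=> x _; exact: norm_continuous.
by apply/seteqP; split=> x /=; rewrite in_itv.
Qed.

End clip_vector.

Section truncated_fields.
Context (R : realType) (d l : nat).
Local Notation V := 'rV[R]_d.
Local Notation Y := 'rV[R]_l.
Context (g : Y -> Y) (Lambda : set Y) (phi : R -> Y -> Y).
Context (f0 : Y -> V) (f : V * Y -> V) (xi : V).
Hypotheses (cL : compact Lambda) (glip : locally_lipschitz setT g)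
  (fl : invariant_flow g Lambda phi)
  (f0lip : locally_lipschitz Lambda f0)
  (flip : locally_lipschitz (setT `*` Lambda) f).

Lemma truncation_bounds K : 0 <= K -> exists L M, [/\ 1 <= L, 0 <= M,
  forall x x' y y', Lambda y -> Lambda y' ->
    `|f (clipv K x, y) - f (clipv K x', y')| <= L * `|x - x'| + L * `|y - y'| &
  forall x y, Lambda y -> `|f (clipv K x, y)| <= M].
Proof.
move=> K0; pose A := [set x : V | `|x| <= K] `*` Lambda.
have cA : compact A by apply: compact_setX => //; exact: compact_norm_ball.
have fA : locally_lipschitz A f by apply: locally_lipschitzS flip => -[x y] [].
have [L [L1 HL]] := locally_lipschitz_compact cA fA.
have [M [M0 HM]] := locally_lipschitz_bounded cA fA.
have inA x y : Lambda y -> A (clipv K x, y) by move=> Ly; split => //=; exact: clipv_norm.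
exists L, M; split => //; last by move=> x y Ly; apply: HM; exact: inA.
move=> x x' y y' Ly Ly'; rewrite (le_trans (HL _ _ (inA _ _ Ly) (inA _ _ Ly'))) //.
have L0 : 0 <= L by rewrite (le_trans ler01).
rewrite -mulrDr ler_wpM2l // prod_normE /= ge_max; apply/andP; split.
  by rewrite (le_trans (clipv_lip _ _ _)) // lerDl.
by rewrite lerDr.
Qed.

Definition slow_field K (c : R) eta (s : R) (x : V) : V := f (clipv K x, phi (c * s) eta).

Lemma slow_field_lip K : 0 <= K -> exists L M, [/\ 1 <= L, 0 <= M &
  forall c eta, Lambda eta -> lip_field L M (slow_field K c eta)].
Proof.
move=> K0; have [L [M [L1 M0 HL HM]]] := truncation_bounds K0.
exists L, M; split => // c eta Le; split => //.
- move=> s x x'; have := HL x x' _ _ (flow_in fl (c * s) Le) (flow_in fl (c * s) Le).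
  by rewrite subrr normr0 mulr0 addr0.
- by move=> s x; apply: HM; exact: (flow_in fl).
move=> x.
apply: (@lip_on_comp_cont _ _ _ Lambda (fun y => f (clipv K x, y)) L
  (fun s => phi (c * s) eta)).
- move=> y y' Ly Ly'; have := HL x x y y' Ly Ly'.
  by rewrite subrr normr0 mulr0 add0r.
- by move=> s; exact: (flow_in fl).
- have := flow_affine_cont (c := c) (s := 0) fl Le.
  by under eq_fun do rewrite add0r.
Qed.

Definition noise (eps : R) eta (t : R) : V :=
  eps^-1 *: fast_integral phi f0 (eps ^+ 2)^-1 t eta.

(** The singular term is placed in the driving path, so the vector field keeps Lipschitz and sup
    bounds that do not depend on [eps]. *)
Definition trunc_sol K (eps : R) eta : R -> V :=
  ode_sol (fun t => xi + noise eps eta t) (slow_field K (eps ^+ 2)^-1 eta).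

Lemma f0_bounds : exists L M, [/\ 1 <= L, 0 <= M, lip_on Lambda f0 L & bounded_on Lambda f0 M].
Proof.
have [L [L1 HL]] := locally_lipschitz_compact cL f0lip.
have [M [M0 HM]] := locally_lipschitz_bounded cL f0lip.
by exists L, M; split.
Qed.

Lemma noise_cont eps eta : Lambda eta -> continuous (noise eps eta).
Proof.
move=> Le t; apply: cvgZr.
have [L [M [_ _ HL _]]] := f0_bounds.
by apply: ti_cont; exact: (fast_obs_cont fl HL).
Qed.

Lemma noise0 eps eta t : t <= 0 -> noise eps eta t = 0.
Proof. by move=> t0; rewrite /noise /fast_integral tiN // scaler0. Qed.

Lemma noise_lip_eta eps T : 0 < eps -> 0 <= T -> exists C, 0 <= C /\
  forall eta eta' t, Lambda eta -> Lambda eta' -> 0 <= t <= T ->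
  `|noise eps eta t - noise eps eta' t| <= C * `|eta - eta'|.
Proof.
move=> e0 T0; have [L [M [L1 _ HL _]]] := f0_bounds.
have c0 : 0 <= (eps ^+ 2)^-1 by rewrite invr_ge0 exprn_ge0 // ltW.
have [C [C0 HC]] := fast_integral_lip cL glip fl HL (le_trans ler01 L1) c0 T0.
exists (eps^-1 * C); split; first by rewrite mulr_ge0 // invr_ge0 ltW.
move=> eta eta' t Le Le' tT; rewrite /noise -scalerBr normrZ gtr0_norm ?invr_gt0 //.
by rewrite -mulrA ler_wpM2l ?invr_ge0 ?(ltW e0) // HC.
Qed.

Lemma noise_lip_t eps : 0 < eps -> exists C, 0 <= C /\
  forall eta s t, Lambda eta -> 0 <= s <= t ->
  `|noise eps eta t - noise eps eta s| <= C * (t - s).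
Proof.
move=> e0; have [L [M [L1 M0 HL HM]]] := f0_bounds.
exists (eps^-1 * M); split; first by rewrite mulr_ge0 // invr_ge0 ltW.
move=> eta s t Le st; rewrite /noise -scalerBr normrZ gtr0_norm ?invr_gt0 //.
rewrite -mulrA ler_wpM2l ?invr_ge0 ?(ltW e0) //; apply: ti_lip => //.
  exact: (fast_obs_cont fl HL).
by move=> q _; apply: HM; exact: (flow_in fl).
Qed.

Lemma trunc_sol_cont K eps eta : 0 <= K -> Lambda eta -> continuous (trunc_sol K eps eta).
Proof.
move=> K0 Le; have [L [M [_ _ H]]] := slow_field_lip K0.
apply: (ode_sol_cont (H _ _ Le)) => t; apply: cvgD; first exact: cvg_cst.
exact: noise_cont.
Qed.

Lemma trunc_solE K eps eta t : 0 <= K -> Lambda eta ->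
  trunc_sol K eps eta t = xi + noise eps eta t +
    time_integral t (fun s => slow_field K (eps ^+ 2)^-1 eta s (trunc_sol K eps eta s)).
Proof.
move=> K0 Le; have [L [M [_ _ H]]] := slow_field_lip K0.
rewrite {1}/trunc_sol (ode_solE (H _ _ Le)) // => {}t; apply: cvgD; first exact: cvg_cst.
exact: noise_cont.
Qed.

Lemma trunc_field_cont K eps eta : 0 <= K -> Lambda eta ->
  continuous (fun s => slow_field K (eps ^+ 2)^-1 eta s (trunc_sol K eps eta s)).
Proof.
move=> K0 Le; have [L [M [_ _ H]]] := slow_field_lip K0.
by apply: (lip_field_cont (H _ _ Le)); exact: trunc_sol_cont.
Qed.

(** Meant for a fixed [eps], on which the constant depends: it serves the measurability of the
    blow-up time and of the stopped path. *)
Lemma trunc_sol_lip_eta K eps T : 0 <= K -> 0 < eps -> 0 <= T -> exists C, 0 <= C /\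
  forall eta eta' t, Lambda eta -> Lambda eta' -> 0 <= t <= T ->
  `|trunc_sol K eps eta t - trunc_sol K eps eta' t| <= C * `|eta - eta'|.
Proof.
move=> K0 e0 T0; have [L [M [L1 M0 H]]] := slow_field_lip K0.
have [C [C0 HC]] := noise_lip_eta e0 T0.
have [L' [M' [L1' M0' HL' _]]] := truncation_bounds K0.
have L0' : 0 <= L' by rewrite (le_trans ler01).
have c0 : 0 <= (eps ^+ 2)^-1 by rewrite invr_ge0 exprn_ge0 // ltW.
have [G [G0 HG]] := flow_lip cL glip fl ((eps ^+ 2)^-1 * T).
exists ((C + L' * G * T) * expR (L * T)); split.
  by rewrite mulr_ge0 ?expR_ge0 // addr_ge0 // !mulr_ge0.
move=> eta eta' t Le Le' tT.
rewrite mulrAC.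
apply: (ode_stability (H (eps ^+ 2)^-1 _ Le)) => //; try exact: trunc_sol_cont.
move=> s sT; have [s0 sT'] := andP sT.
have Fc := trunc_field_cont (eps := eps) K0 Le'.
have Fc' := lip_field_cont (H (eps ^+ 2)^-1 _ Le) (trunc_sol_cont (eps := eps) K0 Le').
rewrite /ode_defect {1}(trunc_solE eps s K0 Le) addrK (trunc_solE eps s K0 Le').
have zmod (x a b i j : V) : x + a - (x + b + i - j) = (a - b) + (j - i).
  by apply/rowP => k; rewrite !mxE; ring.
rewrite zmod -(tiB _ Fc' Fc) mulrDl; apply: (le_trans (ler_normD _ _)).
(* What remains compares the slow field at one and the same slow state along two fast orbits. *)
apply: lerD; first exact: HC.
rewrite (_ : L' * G * T * `|eta - eta'| = L' * (G * `|eta - eta'|) * T); last by ring.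
apply: (@le_trans _ _ (L' * (G * `|eta - eta'|) * s)); last first.
  by rewrite ler_wpM2l // !mulr_ge0.
apply: ti_norm_cst => //; first by move=> q; apply: cvgB; [exact: Fc'|exact: Fc].
move=> q /andP[q0 qs].
have := HL' (trunc_sol K eps eta' q) (trunc_sol K eps eta' q) _ _
  (flow_in fl ((eps ^+ 2)^-1 * q) Le) (flow_in fl ((eps ^+ 2)^-1 * q) Le').
rewrite subrr normr0 mulr0 add0r => /le_trans; apply.
rewrite ler_wpM2l // HG // mulr_ge0 //= ler_wpM2l //.
exact: le_trans qs sT'.
Qed.

Lemma trunc_sol_lip_t K eps : 0 <= K -> 0 < eps -> exists C, 0 <= C /\
  forall eta s t, Lambda eta -> 0 <= s <= t ->
  `|trunc_sol K eps eta t - trunc_sol K eps eta s| <= C * (t - s).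
Proof.
move=> K0 e0; have [L [M [L1 M0 H]]] := slow_field_lip K0.
have [C [C0 HC]] := noise_lip_t e0.
exists (C + M); split; first by rewrite addr_ge0.
move=> eta s t Le st.
rewrite !(trunc_solE eps _ K0 Le).
have zmod (x a b i j : V) : x + a + i - (x + b + j) = (a - b) + (i - j).
  by apply/rowP => k; rewrite !mxE; ring.
rewrite zmod mulrDl (le_trans (ler_normD _ _)) // lerD ?HC //.
apply: ti_lip => //; first exact: trunc_field_cont.
by move=> q _; have [_ _ HM _] := H (eps ^+ 2)^-1 _ Le; exact: HM.
Qed.

(** * Comparison with the maximal solution *)

Section maximal.
Context (eps : R) (eta : Y) (tau : \bar R) (x : R -> V) (y : R -> Y).
Hypotheses (e0 : 0 < eps) (Le : Lambda eta)
  (sol : maximal_solution f0 f g Lambda xi eps eta tau x y).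
Local Notation c := ((eps ^+ 2)^-1).

Let c0 : 0 < c. Proof. by rewrite invr_gt0 exprn_gt0. Qed.

Lemma tau_gt0 : (0 < tau)%E. Proof. by have [[]] := sol. Qed.

Lemma sol_subset T : 0 <= T -> (T%:E < tau)%E ->
  [set` `[0, T]] `<=` [set t : R | 0 <= t /\ (t%:E < tau)%E].
Proof.
move=> T0 Tt t /=; rewrite in_itv /= => /andP[t0 tT]; split => //.
by rewrite (le_lt_trans _ Tt) // lee_fin.
Qed.

Lemma sol_fast T t : 0 <= T -> (T%:E < tau)%E -> 0 <= t <= T -> y t = phi (c * t) eta.
Proof.
move=> T0 Tt tT; have [[_ [_ <-] [_ yc] yL dxy] _] := sol.
have S := sol_subset T0 Tt.
apply: (flow_unique cL glip fl c0 T0 _ _ _ tT).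
- exact: continuous_subspaceW S yc.
- by move=> s sT; apply: yL; apply: S; rewrite /= in_itv.
- move=> s /andP[s0 sT]; have [] := dxy s _ s0 => //.
  by apply: S; rewrite /= in_itv /= !ltW.
Qed.

Lemma sol_bounded T : 0 <= T -> (T%:E < tau)%E ->
  exists K, 0 <= K /\ forall t, 0 <= t <= T -> `|x t| <= K.
Proof.
move=> T0 Tt; have [[_ _ [xc _] _ _] _] := sol.
have := continuous_subspaceW (sol_subset T0 Tt) xc.
move=> /continuous_compact /(_ (@segment_compact R 0 T)) /compact_bounded[M [_ HM]].
exists (`|M| + 1); split; first by rewrite addr_ge0.
move=> t tT; apply: HM; first by rewrite (le_lt_trans (ler_norm _)) // ltrDl.
by exists t => //; rewrite /= in_itv.
Qed.

Lemma trunc_sol_unique K T : 0 <= K -> 0 <= T -> (T%:E < tau)%E ->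
  (forall t, 0 <= t <= T -> `|x t| <= K) ->
  forall t, 0 <= t <= T -> x t = trunc_sol K eps eta t.
Proof.
move=> K0 T0 Tt xK.
have S := sol_subset T0 Tt.
have [[_ [x0 y0] [xc yc] yL dxy] _] := sol.
have [L [M [_ _ H]]] := slow_field_lip K0; have Hf := H c _ Le.
pose X := x \o clip 0 T.
have Xc : continuous X by exact: (within_clip T0 S xc).
have xX t : 0 <= t <= T -> x t = X t by move=> tT; rewrite /X /= clip_id.
have [L0 [M0 [_ _ HL0 _]]] := f0_bounds.
have f0c := fast_obs_cont (c := c) fl HL0 Le.
have fXc := lip_field_cont Hf Xc.
have EX t : 0 <= t <= T ->
    X t = xi + noise eps eta t + time_integral t (fun s => slow_field K c eta s (X s)).
  move=> tT; rewrite -xX // /noise /fast_integral -tiZ // -addrA -tiD //; last first.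
    by move=> s; apply: cvgZr; exact: f0c.
  rewrite -x0; apply: (@ti_ftc _ _ x _ T); last exact: tT.
  - by move=> s; apply: cvgD; [apply: cvgZr; exact: f0c|exact: fXc].
  - exact: continuous_subspaceW S xc.
  - move=> s /andP[s0 sT]; have sT' : 0 <= s <= T by rewrite !ltW.
    have [] := dxy s _ s0; first by apply: S; rewrite /= in_itv.
    by rewrite (sol_fast T0 Tt sT') /slow_field -xX // clipv_id // xK.
move=> t tT; rewrite xX //.
apply/eqP; rewrite -subr_eq0 -normr_eq0 eq_le normr_ge0 andbT.
have := ode_stability Hf Xc (trunc_sol_cont (eps := eps) K0 Le) (a := 0) (T := T).
rewrite mul0r; apply => // s sT.
by rewrite /ode_defect EX // trunc_solE // !addrK subrr normr0.
Qed.

(** By continuity the strict bound persists a little beyond [T]. There the truncation is inactive,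
    so the truncated solution together with the flow solves the fast-slow system on [0, T'), and
    maximality gives T < T' <= tau. *)
Lemma trunc_sol_tau K T : 0 <= K -> 0 <= T ->
  (forall t, 0 <= t <= T -> `|trunc_sol K eps eta t| < K) -> (T%:E < tau)%E.
Proof.
move=> K0 T0 HK.
have Xc := trunc_sol_cont (eps := eps) K0 Le.
have [r r0 Hr] : exists2 r, 0 < r & forall t, `|T - t| < r -> `|trunc_sol K eps eta t| < K.
  have KT : 0 < K - `|trunc_sol K eps eta T| by rewrite subr_gt0 HK // T0 lexx.
  have /cvgrPdist_lt /(_ _ KT) := Xc T; move=> /nbhs_ballP[r /= r0 Hr].
  exists r => // t Tt.
  have : `|trunc_sol K eps eta T - trunc_sol K eps eta t| < K - `|trunc_sol K eps eta T|.
    by apply: Hr; rewrite -ball_normE.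
  have := ler_normB (trunc_sol K eps eta T)
    (trunc_sol K eps eta T - trunc_sol K eps eta t).
  rewrite opprB addrC subrK; lra.
pose T' := T + r / 2.
have XK t : 0 <= t < T' -> `|trunc_sol K eps eta t| < K.
  move=> /andP[t0 tT]; have [tT'|Tt] := leP t T; first by apply: HK; rewrite t0.
  by apply: Hr; rewrite distrC ger0_norm; rewrite /T' in tT; lra.
have TT' : T < T' by rewrite ltrDl divr_gt0.
have [_ /(_ T'%:E (trunc_sol K eps eta) (fun t => phi (c * t) eta))] := sol.
move=> H; apply: (@lt_le_trans _ _ T'%:E); first by rewrite lte_fin.
have [L0 [M0 [_ _ HL0 _]]] := f0_bounds.
have f0c := fast_obs_cont (c := c) fl HL0 Le.
have fXc := trunc_field_cont (eps := eps) K0 Le.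
apply: H; split.
- by rewrite lte_fin (le_lt_trans T0).
- split; last by rewrite mulr0; have [-> ] := fl.
  by rewrite trunc_solE // noise0 // tiN // !addr0.
- split; apply: continuous_subspaceT; first exact: Xc.
  have := flow_affine_cont (c := c) (s := 0) fl Le.
  by under eq_fun do rewrite add0r.
- by move=> t _; exact: (flow_in fl).
move=> t [t0]; rewrite lte_fin => tT' tp; split; last first.
  have := flow_is_derive fl c 0 t Le.
  by rewrite add0r; under eq_fun do rewrite add0r.
rewrite (_ : trunc_sol K eps eta = (fun t => xi + (eps^-1 *: fast_integral phi f0 c t eta +
   time_integral t (fun s => slow_field K c eta s (trunc_sol K eps eta s))))); last first.
  by apply/funext => s; rewrite {1}trunc_solE // addrA.
have d1 := ti_is_derive f0c tp.
have d2 := ti_is_derive fXc tp.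
have -> : f (xi + (eps^-1 *: fast_integral phi f0 c t eta +
   time_integral t (fun s => slow_field K c eta s (trunc_sol K eps eta s))), phi (c * t) eta)
   = slow_field K c eta t (trunc_sol K eps eta t).
  rewrite /slow_field clipv_id; last by rewrite ltW // XK // t0.
  by rewrite trunc_solE // addrA.
rewrite -[X in is_derive _ _ _ X]add0r.
apply: is_deriveD.
Qed.

(** No bound of [x] by [K] is known beforehand, but [x] is bounded by some [K1] on [0, T]. With [K2]
    the larger of the two, both [x] and the [K]-truncated solution solve the [K2]-truncated
    equation, so uniqueness avoids a continuation argument. *)
Lemma trunc_sol_eq K T : 0 <= K -> 0 <= T ->
  (forall t, 0 <= t <= T -> `|trunc_sol K eps eta t| < K) ->
  forall t, 0 <= t <= T -> x t = trunc_sol K eps eta t.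
Proof.
move=> K0 T0 HK; have Tt := trunc_sol_tau K0 T0 HK.
have [K1 [K10 HK1]] := sol_bounded T0 Tt.
pose K2 := Num.max K K1.
have K20 : 0 <= K2 by rewrite le_max K0.
have HK2 t : 0 <= t <= T -> `|x t| <= K2 by move=> tT; rewrite le_max HK1 // orbT.
move=> t tT; rewrite (trunc_sol_unique K20 T0 Tt HK2 tT).
have [L [M [_ _ H]]] := slow_field_lip K20; have Hf := H c _ Le.
apply/eqP; rewrite -subr_eq0 -normr_eq0 eq_le normr_ge0 andbT.
have := ode_stability Hf (trunc_sol_cont (eps := eps) K20 Le)
  (trunc_sol_cont (eps := eps) K0 Le) (a := 0) (T := T).
rewrite mul0r; apply => // s /andP[s0 sT].
have dE K' : 0 <= K' ->
    ode_defect (slow_field K' c eta) (trunc_sol K' eps eta) s = xi + noise eps eta s.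
  by move=> K'0; rewrite /ode_defect {1}(trunc_solE eps s K'0 Le) addrK.
rewrite (dE _ K20); have -> : ode_defect (slow_field K2 c eta) (trunc_sol K eps eta) s =
    xi + noise eps eta s; last by rewrite subrr normr0.
rewrite -(dE _ K0) /ode_defect; congr (_ - _); apply: eq_ti => q /andP[q0 qs]; have qT : `|trunc_sol K eps eta q| < K.
  by apply: HK; rewrite q0 (le_trans qs).
by rewrite /slow_field !clipv_id // ?le_max ltW.
Qed.

End maximal.

End truncated_fields.

(** * Measurability of the stopped solution *)

Lemma min_dist (R : realFieldType) (t a b : R) :
  `|Num.min t a - Num.min t b| <= `|a - b|.
Proof.
wlog ab : a b / a <= b.
  move=> H; have [/H//|ba] := leP a b.
  by rewrite distrC [leRHS]distrC; apply/H/ltW.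
have mab : Num.min t a <= Num.min t b by rewrite le_min !ge_min lexx ab orbT.
rewrite distrC [leRHS]distrC !ger0_norm ?subr_ge0 //.
by case: (leP t a) => h1; case: (leP t b) => h2; lra.
Qed.

Section measurable_by_time.
Context (R : realType) (V : normedModType R) (K : set V) (d : nat).
Hypothesis cK : compact K.
Local Notation T := (borel V).
Context (tau : V -> \bar R) (h : V -> path_space R d).
Hypothesis mtau : measurable_fun (K : set T) (tau : T -> \bar R).

(** A countable family of neighbourhoods for blow-up times; [None] encodes those of +oo. *)
Definition rat_itv (p : rat * option rat) : set (\bar R) :=
  if p.2 is Some b then [set` `](ratr p.1 : R)%:E, (ratr b : R)%:E[]
  else [set` `](ratr p.1 : R)%:E, +oo[].

(* h may jump where tau does. Since tau is measurable and rational intervals are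
   countably many, it suffices that h be continuous along points of close tau. *)
Lemma measurable_by_time :
  (forall U x, open U -> K x -> U (h x) -> exists p, rat_itv p (tau x) /\
     exists2 r, 0 < r & forall y, K y -> `|x - y| < r -> rat_itv p (tau y) -> U (h y)) ->
  measurable_fun (K : set T) (h : T -> borel (path_space R d)).
Proof.
move=> H; have mK : measurable (K : set T) := compact_borel cK.
apply: (@measurability _ _ T (borel (path_space R d)) K h (@open (path_space R d))) => //.
move=> _ [U oU <-].
pose A p := [set x | K x /\ exists2 r, 0 < r & forall y, K y -> `|x - y| < r ->
  rat_itv p (tau y) -> U (h y)].
rewrite (_ : K `&` h @^-1` U =
  \bigcup_p ((K `&` A p) `&` (K `&` tau @^-1` (rat_itv p)))); last first.
  apply/seteqP; split=> x.
    move=> [Kx Ux]; have [p [px [r r0 Hr]]] := H U x oU Kx Ux.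
    by exists p => //; split; split => //; split => //; exists r.
  move=> [p _ [[Kx [_ [r r0 Hr]]] [_ px]]]; split => //.
  by apply: Hr => //; rewrite subrr normr0.
apply: countable_bigcupT_measurable; first exact: countableP.
move=> p.
apply: measurableI; last first.
  apply: mtau => //; rewrite /rat_itv; case: p.2 => [b|]; exact: emeasurable_itv.
apply: rel_open_borel => // x Kx [_ [r r0 Hr]].
exists (r / 2); first by rewrite divr_gt0.
move=> y Ky xy; split => //; exists (r / 2); first by rewrite divr_gt0.
move=> z Kz yz; apply: Hr => //.
rewrite -(subrKA y) (le_lt_trans (ler_normD _ _)) // (splitr r).
by rewrite ltrD.
Qed.

End measurable_by_time.

Section stopped_measurable.
Context (R : realType) (d l : nat).
Local Notation V := 'rV[R]_d.
Local Notation Y := 'rV[R]_l.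
Context (g : Y -> Y) (Lambda : set Y) (phi : R -> Y -> Y).
Context (f0 : Y -> V) (f : V * Y -> V) (xi : V).
Hypotheses (cL : compact Lambda) (glip : locally_lipschitz setT g)
  (fl : invariant_flow g Lambda phi)
  (f0lip : locally_lipschitz Lambda f0)
  (flip : locally_lipschitz (setT `*` Lambda) f).
Context (eps : R) (tau : Y -> \bar R) (x : Y -> R -> V) (y : Y -> R -> Y).
Hypotheses (e0 : 0 < eps) (sol : forall eta, Lambda eta ->
  maximal_solution f0 f g Lambda xi eps eta (tau eta) (x eta) (y eta)).
Local Notation X := (trunc_sol phi f0 f xi).

(** Lower semicontinuity of [tau] and continuity of the solution in [eta], at once. The radius [K]
    exceeds the bound of the given solution by 1, and nearby truncated solutions move by less than
    1, so they stay strictly inside the ball and are genuine solutions. *)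
Lemma nearby_solutions T delta eta : 0 <= T -> 0 < delta -> Lambda eta ->
  (T%:E < tau eta)%E -> exists K r : R, [/\ 0 <= K, 0 < r &
  forall eta', Lambda eta' -> `|eta - eta'| < r -> (T%:E < tau eta')%E /\
    forall t, 0 <= t <= T ->
    x eta' t = X K eps eta' t /\ `|X K eps eta t - X K eps eta' t| < delta].
Proof.
move=> T0 d0 Le Tt.
have [K0 [K00 HK0]] := sol_bounded (sol Le) T0 Tt.
pose K := K0 + 1; have KK : 0 <= K by rewrite addr_ge0.
have XK t : 0 <= t <= T -> `|X K eps eta t| <= K0.
  move=> tT; rewrite -(trunc_sol_unique cL glip fl f0lip flip e0 Le (sol Le) KK T0 Tt) ?HK0 //.
  by move=> s sT; rewrite (le_trans (HK0 _ sT)) // lerDl.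
have [C [C0 HC]] := trunc_sol_lip_eta xi cL glip fl f0lip flip KK e0 T0.
pose m := Num.min delta 1.
have m0 : 0 < m by rewrite lt_min d0 ltr01.
exists K, (m / (C + 1)); split => //; first by rewrite divr_gt0 // ltr_wpDl.
move=> eta' Le' ee'.
have Hm t : 0 <= t <= T -> `|X K eps eta t - X K eps eta' t| < m.
  move=> tT; rewrite (le_lt_trans (HC _ _ _ Le Le' tT)) //.
  apply: (@le_lt_trans _ _ ((C + 1) * `|eta - eta'|)).
    by rewrite ler_wpM2r // lerDl.
  by rewrite mulrC -ltr_pdivlMr // ltr_wpDl.
have HK' t : 0 <= t <= T -> `|X K eps eta' t| < K.
  move=> tT; have := Hm t tT; have := XK t tT.
  have := ler_normB (X K eps eta t) (X K eps eta t - X K eps eta' t).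
  rewrite opprB addrC subrK /K.
  have : m <= 1 by rewrite ge_min lexx orbT.
  lra.
split; first exact: (trunc_sol_tau cL fl f0lip flip Le' (sol Le') KK T0 HK').
move=> t tT; split.
  exact: (trunc_sol_eq cL glip fl f0lip flip e0 Le' (sol Le') KK T0 HK').
by rewrite (lt_le_trans (Hm t tT)) // ge_min lexx.
Qed.

Lemma measurable_tau : measurable_fun (Lambda : set (borel Y)) (tau : borel Y -> \bar R).
Proof.
have mL := compact_borel cL.
apply: (measurability _ (@ErealGenOInfty.measurableE R)).
move=> _ [_ [r ->] <-].
rewrite (_ : tau @^-1` _ = [set eta | (r%:E < tau eta)%E]); last first.
  by apply/seteqP; split=> eta /=; rewrite in_itv /= andbT.
apply: rel_open_borel => // eta Le rt.
have [r0|r0] := leP 0 r; last first.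
  exists 1 => // eta' Le' _; rewrite /= (lt_trans _ (tau_gt0 (sol Le'))) //.
have [K [e [_ ee He]]] := nearby_solutions r0 ltr01 Le rt.
by exists e => // eta' Le' /(He _ Le')[].
Qed.

Local Notation stopped eta := (stopped_path (tau eta) (x eta)).

(** A finite stopping time [T1] below the blow-up time stands for tau / 2 or for no stopping, so
    continuity needs no case distinction. *)
Lemma stopped_local eta T : Lambda eta -> 0 <= T -> exists T1, [/\ 0 <= T1, (T1%:E < tau eta)%E &
  forall t, 0 <= t <= T -> stopped eta t = x eta (Num.min t T1)].
Proof.
move=> Le T0; have := tau_gt0 (sol Le); rewrite /stopped_path.
case: (tau eta) => [r| |] //.
  rewrite lte_fin => r0; exists (r / 2); split => //.
    by rewrite divr_ge0 // ltW.
  by rewrite lte_fin ltr_pdivrMr // ltr_pMr // ltr1n.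
move=> _; exists T; split => //; first exact: ltry.
by move=> t /andP[_ tT]; rewrite (min_idPl tT).
Qed.

Lemma stopped_within eta : Lambda eta ->
  {within halfline R, continuous (stopped eta)}.
Proof.
move=> Le; apply/subspace_continuousP => t /= t0.
have t10 : 0 <= t + 1 by rewrite addr_ge0.
have [T1 [T10 T1t Hs]] := stopped_local Le t10.
have [K [r [K0 r0 HK]]] := nearby_solutions T10 ltr01 Le T1t.
have [_ HX] : (T1%:E < tau eta)%E /\ forall t, 0 <= t <= T1 ->
    x eta t = X K eps eta t /\ `|X K eps eta t - X K eps eta t| < 1.
  by apply: HK => //; rewrite subrr normr0.
have E s : 0 <= s <= t + 1 -> stopped eta s = X K eps eta (Num.min s T1).
  move=> st; rewrite Hs //; have [|-> //] := HX (Num.min s T1).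
  by rewrite le_min T10 ge_min lexx orbT !andbT; case/andP: st.
have mc : continuous (fun q : R => X K eps eta (Num.min q T1)).
  move=> q; apply: (@continuous_comp _ _ _ (fun q : R => Num.min q T1) (X K eps eta)).
    by apply: (@continuous_min _ _ id (cst T1)) => //; exact: cst_continuous.
  exact: (trunc_sol_cont cL fl f0lip flip K0 Le).
rewrite /from_subspace E; last by rewrite t0 lerDl ler01.
apply: (@cvg_trans _ ((fun s => X K eps eta (Num.min s T1)) @ within (halfline R) (nbhs t))).
  apply: near_eq_cvg; rewrite near_withinE; near=> s.
  move=> s0; apply: esym; apply: E; rewrite [0 <= s]s0 /=.
  by apply/ltW; near: s; apply: lt_nbhsl; rewrite ltrDl.
by apply: cvg_within_filter; exact: mc.
Unshelve. all: by end_near. Qed.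

Lemma pt_stopped eta t : Lambda eta -> 0 <= t -> pt (path_of (stopped eta)) t = stopped eta t.
Proof. by move=> Le t0; rewrite pt_path_of //; exact: stopped_within. Qed.

Lemma random_stopped :
  random_path (Lambda : set (borel Y)) (fun eta => stopped eta).
Proof.
split; first by move=> eta /stopped_within /subspace_sigL_continuousP.
apply: (measurable_by_time cL measurable_tau) => U eta oU Le Ueta.
have : nbhs (path_of (stopped eta)) U by move: oU; rewrite openE; exact.
move=> /nbhs_sup_close[T [a [T0 a0 TaU]]].
have a20 : 0 < a / 2 by rewrite divr_gt0.
have dist eta1 eta2 t : Lambda eta1 -> Lambda eta2 -> 0 <= t ->
    forall b, `|stopped eta1 t - stopped eta2 t| <= b ->
    `|pt (path_of (stopped eta1)) t - pt (path_of (stopped eta2)) t| <= b.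
  move=> L1 L2 t0 b; apply: le_trans; rewrite le_eqVlt; apply/orP; left; apply/eqP.
  by congr (`|_ - _|); exact: pt_stopped.
have [tfin|tinf] : (exists2 r : R, 0 < r & tau eta = r%:E) \/ tau eta = +oo%E.
  have := tau_gt0 (sol Le); case: (tau eta) => [r| |] //; last by right.
  by rewrite lte_fin => r0; left; exists r.
- have [r r0 Er] := tfin.
  (* Blow-up times within r / 2 of r have halves at most 3 r / 4, so both paths are stopped before
     [T1], which is still below [tau eta]. *)
  pose T1 := 3 / 4 * r.
  have T10 : 0 <= T1 by rewrite mulr_ge0 // ltW.
  have T1t : (T1%:E < tau eta)%E by rewrite Er lte_fin /T1; lra.
  have [K [s [K0 s0 Hs]]] := nearby_solutions T10 a20 Le T1t.
  have [C [C0 HC]] := trunc_sol_lip_t xi cL fl f0lip flip K0 e0.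
  (* The second term bounds by a / 2 the effect of stopping the same path at two different times;
     the other a / 2 is the distance between the two solutions. *)
  pose m := Num.min (r / 2) (a / 2 / (C + 1)).
  have C1 : 0 < C + 1 by rewrite ltr_wpDl.
  have m0 : 0 < m by rewrite lt_min !divr_gt0.
  have /rat_in_itvoo[p /itvP pr] : r - m < r by rewrite ltrBlDr ltrDl.
  have /rat_in_itvoo[q /itvP qr] : r < r + m by rewrite ltrDl.
  exists (p, Some q); split.
    by rewrite /rat_itv /= in_itv /= Er !lte_fin pr qr.
  exists s; [exact: s0|move=> eta' Le' ee'; rewrite /rat_itv /= in_itv /= => /andP[t1 t2]].
  have [r' Er'] : exists r', tau eta' = r'%:E by move: t1 t2; case: (tau eta') => // r'; exists r'.
  rewrite Er' lte_fin in t1; rewrite Er' lte_fin in t2.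
  have pm : r - m < ratr p by rewrite pr.
  have qm : ratr q < r + m by rewrite qr.
  have mr : m <= r / 2 by rewrite ge_min lexx.
  have mC : C * m <= a / 2.
    apply: (@le_trans _ _ ((C + 1) * m)); first by rewrite ler_wpM2r ?(ltW m0) // lerDl.
    by rewrite mulrC -ler_pdivlMr // ge_min lexx orbT.
  apply: TaU => t /andP[t0 tT]; apply: (dist _ _ _ Le Le' t0); rewrite /stopped_path Er Er'.
  set u := Num.min t (r / 2); set u' := Num.min t (r' / 2).
  have uT : 0 <= u <= T1.
    rewrite le_min t0 ge_min divr_ge0 ?(ltW r0) //=.
    by apply/orP; right; rewrite /T1; lra.
  have uT' : 0 <= u' <= T1.
    rewrite le_min t0 ge_min /=; apply/andP; split; first by lra.
    by apply/orP; right; rewrite /T1; lra.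
  have [_ H1] := Hs eta' Le' ee'.
  have [_ H2] : (T1%:E < tau eta)%E /\ forall t, 0 <= t <= T1 ->
    x eta t = X K eps eta t /\ `|X K eps eta t - X K eps eta t| < a / 2.
    by apply: Hs => //; rewrite subrr normr0.
  have [-> _] := H2 _ uT; have [-> d1] := H1 _ uT'.
  rewrite -(subrKA (X K eps eta u')) (le_trans (ler_normD _ _)) // (splitr a).
  apply: lerD; last exact: ltW.
  apply: le_trans mC.
  have uu : `|u - u'| <= m.
    by apply: (le_trans (min_dist _ _ _)); rewrite ler_norml; apply/andP; split; lra.
  have [uu'|u'u] := leP u u'.
    rewrite distrC (le_trans (HC _ _ _ Le _)) // ?uu' ?andbT; first by case/andP: uT.
    rewrite ler_wpM2l // (le_trans _ uu) // distrC ler_norm //.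
  rewrite (le_trans (HC _ _ _ Le _)) // ?(ltW u'u) ?andbT; first by case/andP: uT'.
  by rewrite ler_wpM2l // (le_trans _ uu) // ler_norm.
- have Tt : (T%:E < tau eta)%E by rewrite tinf ltry.
  have [K [s [K0 s0 Hs]]] := nearby_solutions T0 a0 Le Tt.
  (* A blow-up time above 2 T means that stopping at its half does not act on [0, T]. *)
  have /rat_in_itvoo[p /itvP pr] : 2 * T < 2 * T + 1 by rewrite ltrDl.
  exists (p, None); split; first by rewrite /rat_itv /= in_itv /= tinf ltry.
  exists s; [exact: s0|move=> eta' Le' ee'; rewrite /rat_itv /= in_itv /= andbT => t1].
  have [_ H1] := Hs eta' Le' ee'.
  have [_ H2] : (T%:E < tau eta)%E /\ forall t, 0 <= t <= T ->
    x eta t = X K eps eta t /\ `|X K eps eta t - X K eps eta t| < a.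
    by apply: Hs => //; rewrite subrr normr0.
  apply: TaU => t tT; have [t0 tT'] := andP tT.
  apply: (dist _ _ _ Le Le' t0); rewrite /stopped_path tinf.
  have -> : match tau eta' with r'%:E => x eta' (Num.min t (r' / 2)) | _ => x eta' t end
          = x eta' t.
    move: t1; case: (tau eta') => [r'| |] //; rewrite lte_fin => t1.
    have pm : 2 * T < ratr p by rewrite pr.
    by rewrite (min_idPl _) //; lra.
  have [-> _] := H2 _ tT; have [-> d1] := H1 _ tT.
  exact: ltW.
Qed.

End stopped_measurable.

(** * Sup norm and modulus of continuity of paths *)

Section path_functionals.
Context (R : realType) (d : nat).
Local Notation V := 'rV[R]_d.
Local Notation path := (path_space R d).
Implicit Types (p q : path) (T k : R).

Lemma cont_bounded (u : R -> V) T : continuous u ->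
  exists M, 0 <= M /\ forall t, 0 <= t <= T -> `|u t| <= M.
Proof.
move=> uc.
have := @continuous_compact _ _ u [set` `[0, T]] (continuous_subspaceT uc) (@segment_compact R 0 T).
move=> /compact_bounded[M [_ HM]].
exists (`|M| + 1); split; first by rewrite addr_ge0.
move=> t tT; apply: HM; first by rewrite (le_lt_trans (ler_norm _)) // ltrDl.
by exists t => //; rewrite /= in_itv.
Qed.

Lemma unif_cont (u : R -> V) T e : continuous u -> 0 < e -> exists2 r, 0 < r &
  forall s t, 0 <= s <= T -> `|s - t| < r -> `|u s - u t| < e.
Proof.
move=> uc e0.
have cK := (near_covering_withinP [set` `[0, T]]).2
  ((compact_near_coveringP [set` `[0, T]]).1 (@segment_compact R 0 T)).
have := cK R (0^'+) (fun r s => forall t, `|s - t| < r -> `|u s - u t| < e) _.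
have H : forall s : R, [set` `[0, T]] s -> \forall s' \near s & r \near (0 : R)^'+,
    [set` `[0, T]] s' -> forall t, `|s' - t| < r -> `|u s' - u t| < e.
  move=> s _; have e2 : 0 < e / 2 by rewrite divr_gt0.
  have /cvgrPdist_lt /(_ _ e2) := uc s; move=> /nbhs_ballP[a /= a0 Ha].
  have a2 : 0 < a / 2 by rewrite divr_gt0.
  exists (ball s (a / 2), [set r | r < a / 2]).
    by split; [exact: nbhsx_ballx|exact: nbhs_right_lt].
  move=> [s' r] /= [ss' ra] _ t st.
  have ss'' : `|s - s'| < a / 2 by move: ss'; rewrite -ball_normE.
  have h1 : `|u s - u s'| < e / 2.
    by apply: Ha; rewrite -ball_normE /= (lt_trans ss'') // ltr_pdivrMr // ltr_pMr // ltr1n.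
  have h2 : `|u s - u t| < e / 2.
    apply: Ha; rewrite -ball_normE /= -(subrKA s') (le_lt_trans (ler_normD _ _)) //.
    by rewrite (splitr a) ltrD // (lt_trans st).
  by rewrite -(subrKA (u s)) (le_lt_trans (ler_normD _ _)) // (splitr e) ltrD // distrC.
move=> /(_ _ H) Hr; near (0 : R)^'+ => r.
exists r; first by near: r; exact: nbhs_right_gt.
move=> s t sT st.
have Hr' : [set` `[0, T]] `<=` (fun s : R => forall t, `|s - t| < r -> `|u s - u t| < e).
  by near: r.
by apply: Hr' => //; rewrite /= in_itv.
Unshelve. all: by end_near. Qed.

Definition sup_norm T (u : R -> V) : R := sup [set `|u t| | t in [set` `[0, T]]].

Lemma sup_norm_ge T u t : continuous u -> 0 <= t <= T -> `|u t| <= sup_norm T u.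
Proof.
move=> uc tT; have [M [M0 HM]] := cont_bounded T uc.
apply: ub_le_sup; last by exists t => //; rewrite /= in_itv.
by exists M => _ [s /= + <-]; rewrite in_itv; exact: HM.
Qed.

Lemma sup_norm_le T u (M : R) : 0 <= T -> (forall t, 0 <= t <= T -> `|u t| <= M) ->
  sup_norm T u <= M.
Proof.
move=> T0 HM; apply: ge_sup; first by exists `|u 0|; exists 0 => //=; rewrite in_itv /= lexx.
by move=> _ [s /= + <-]; rewrite in_itv; exact: HM.
Qed.

Lemma sup_norm_ge0 T u : 0 <= T -> continuous u -> 0 <= sup_norm T u.
Proof.
move=> T0 uc; rewrite (le_trans (normr_ge0 (u 0))) // sup_norm_ge //.
by rewrite lexx.
Qed.

Lemma sup_norm_dist T (u v : R -> V) a : 0 <= T -> continuous u -> continuous v ->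
  (forall t, 0 <= t <= T -> `|u t - v t| <= a) ->
  `|sup_norm T u - sup_norm T v| <= a.
Proof.
have half (u1 v1 : R -> V) : 0 <= T -> continuous v1 ->
    (forall t, 0 <= t <= T -> `|u1 t - v1 t| <= a) ->
    sup_norm T u1 <= sup_norm T v1 + a.
  move=> T0 vc uv; apply: sup_norm_le => // t tT.
  rewrite -(subrK (v1 t) (u1 t)) addrC (le_trans (ler_normD _ _)) //.
  by apply: lerD; [exact: sup_norm_ge|exact: uv].
move=> T0 uc vc uv; rewrite ler_norml; apply/andP; split.
  rewrite lerNl opprB lerBlDr addrC; apply: half => // t tT.
  by rewrite distrC uv.
by rewrite lerBlDr addrC; exact: half.
Qed.

Definition modulus T (e : R) p : R :=
  sup [set r | exists s t, [/\ 0 <= s <= T, 0 <= t <= T, `|s - t| <= e & r = `|pt p s - pt p t|]].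

Lemma modulus_le T e p (M : R) : 0 <= T -> 0 <= e ->
  (forall s t, 0 <= s <= T -> 0 <= t <= T -> `|s - t| <= e -> `|pt p s - pt p t| <= M) ->
  modulus T e p <= M.
Proof.
move=> T0 e0 HM; apply: ge_sup.
  by exists `|pt p 0 - pt p 0|; exists 0, 0; rewrite lexx subrr normr0.
by move=> _ [s [t [sT tT st ->]]]; exact: HM.
Qed.

Lemma modulus_ge T e p s t : 0 <= s <= T -> 0 <= t <= T -> `|s - t| <= e ->
  `|pt p s - pt p t| <= modulus T e p.
Proof.
move=> sT tT st; have [M [M0 HM]] := cont_bounded T (@pt_cont _ _ p).
apply: ub_le_sup; last by exists s, t.
exists (M + M) => _ [a [b [aT bT _ ->]]].
by rewrite (le_trans (ler_normB _ _)) // lerD ?HM.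
Qed.

Lemma modulus_ge0 T e p : 0 <= T -> 0 <= e -> 0 <= modulus T e p.
Proof.
move=> T0 e0; rewrite (le_trans (normr_ge0 (pt p 0 - pt p 0))) // modulus_ge //.
- by rewrite lexx.
- by rewrite lexx.
- by rewrite subrr normr0.
Qed.

(** The factor 2 accounts for the two times of an increment. This makes the modulus, cut at 1, a
    test functional for the invariance principle. *)
Lemma modulus_lip T e : 0 <= T -> 0 <= e -> path_lip T 2 (modulus T e).
Proof.
move=> T0 e0.
have half p q a : sup_close T a p q -> modulus T e p <= modulus T e q + 2 * a.
  move=> pq; apply: modulus_le => // s t sT tT st.
  have := modulus_ge q sT tT st; have := pq s sT; have := pq t tT.
  have -> : pt p s - pt p t = (pt q s - pt q t) + ((pt p s - pt q s) - (pt p t - pt q t)).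
    by apply/rowP => k; rewrite !mxE; ring.
  have := ler_normD (pt q s - pt q t) ((pt p s - pt q s) - (pt p t - pt q t)).
  have := ler_normB (pt p s - pt q s) (pt p t - pt q t).
  lra.
move=> p q a pq; have qp : sup_close T a q p by move=> t tT; rewrite distrC pq.
have := half _ _ _ pq; have := half _ _ _ qp.
rewrite ler_norml => ? ?; apply/andP; split; lra.
Qed.

Lemma modulus_cvg0 T c p : 0 <= T -> 0 <= c ->
  modulus T (c / m.+1%:R) p @[m --> \oo] --> (0 : R).
Proof.
move=> T0 c0; apply/cvgrPdist_le => e e0.
have [r r0 Hr] := unif_cont T (@pt_cont _ _ p) e0.
near=> m; have cm0 : 0 <= c / m.+1%:R by rewrite divr_ge0.
rewrite sub0r normrN ger0_norm ?modulus_ge0 //.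
apply: modulus_le => // s t sT tT st; apply/ltW/Hr => //; apply: (le_lt_trans st).
rewrite ltr_pdivrMr // mulrC -ltr_pdivrMr // -natr1.
apply: ltr_wpDr => //; near: m; exact: nbhs_infty_gtr.
Unshelve. all: by end_near. Qed.

Lemma path_lip_min1 T k (Psi : path -> R) : path_lip T k Psi ->
  path_lip T k (fun p => Num.min 1 (Psi p)).
Proof.
move=> H p q a /H; rewrite !ler_norml => /andP[h1 h2].
case: (leP 1 (Psi p)) => h3; case: (leP 1 (Psi q)) => h4; apply/andP; split; lra.
Qed.

End path_functionals.

(** * Averaging *)

(** The Lipschitz bound on the oscillation is used when m < 1 and the sup bound 4 M otherwise. Only
    the bounded quantity [Num.min 1 m] remains, and weak convergence can be tested on it. *)
Lemma window_arith (R : realFieldType) (L M m e x o p q : R) :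
  0 <= L -> 0 <= M -> 0 <= m -> 0 <= e -> o <= 2 * L * x -> x <= m + M * e ->
  o <= p + q -> p <= M + M -> q <= M + M ->
  o <= (2 * L + 4 * M) * Num.min 1 m + 2 * L * M * e.
Proof.
move=> L0 M0 m0 e0 h1 hx h2 h3 h4.
have h5 : 2 * L * x <= 2 * L * (m + M * e) by rewrite ler_wpM2l // mulr_ge0.
have h6 : 0 <= L * M * e by rewrite !mulr_ge0.
have h7 : 0 <= M * m by rewrite mulr_ge0.
case: (leP 1 m) => hm; lra.
Qed.

Lemma norm_ball_net (R : realType) (d : nat) (K e : R) : 0 < e ->
  exists s : seq 'rV[R]_d, forall x : 'rV[R]_d, `|x| <= K ->
    exists2 u, u \in s & `|x - u| < e.
Proof.
move=> e0; have := @compact_norm_ball R d K; rewrite compact_cover => cK.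
pose f (u : 'rV[R]_d) := ball u e.
have [||D _ DK] := cK _ [set x : 'rV[R]_d | `|x| <= K] f.
- by move=> u _; exact: ball_open.
- by move=> x Kx; exists x => //; exact: ballxx.
exists (finmap.enum_fset D) => x /DK[u uD xu]; exists u => //.
by rewrite distrC; move: xu; rewrite /f -ball_normE.
Qed.

Section averaging.
Context (R : realType) (d l : nat).
Local Notation V := 'rV[R]_d.
Local Notation Y := 'rV[R]_l.
Context (g : Y -> Y) (Lambda : set Y) (phi : R -> Y -> Y) (mu : probability (borel Y) R).
Context (f0 : Y -> V) (f : V * Y -> V) (xi : V).
Hypotheses (cL : compact Lambda) (glip : locally_lipschitz setT g)
  (fl : invariant_flow g Lambda phi) (erg : ergodic_measure Lambda phi mu)
  (f0lip : locally_lipschitz Lambda f0)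
  (flip : locally_lipschitz (setT `*` Lambda) f).
Local Notation D := (Lambda : set (borel Y)).
Local Notation E u := (\int[mu]_(x in D) u x).
Local Notation F z := (row_integral mu D (fun eta => f (z, eta))).

Definition avg_field (K s : R) (x : V) : V := F (clipv K x).

Definition osc (K : R) (u : V) (y : Y) : V := f (clipv K u, y) - F (clipv K u).

(** One pair of constants for a given [K], uniform in the time scale [c] and in [eta], shared by the
    slow field, its average and their difference. *)
Record trunc_fields (K L M : R) : Prop := TruncFields {
  tf_L : 1 <= L;
  tf_M : 0 <= M;
  tf_slow : forall c eta, Lambda eta -> lip_field L M (slow_field phi f K c eta);
  tf_avg : lip_field L M (avg_field K);
  tf_osc : forall u, [/\ lip_on Lambda (osc K u) L, bounded_on Lambda (osc K u) (M + M) &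
    row_integral mu D (osc K u) = 0] }.

Lemma trunc_fields_exist K : 0 <= K -> exists L M, trunc_fields K L M.
Proof.
move=> K0; have [L [M [L1 M0 HL HM]]] := truncation_bounds cL flip K0.
have mD : measurable D := compact_borel cL.
have mu1 : mu D = 1%E by case: erg.
have L0 : 0 <= L by rewrite (le_trans ler01).
have fLx y : Lambda y -> forall x x', `|f (clipv K x, y) - f (clipv K x', y)| <= L * `|x - x'|.
  by move=> Ly x x'; have := HL x x' y y Ly Ly; rewrite subrr normr0 mulr0 addr0.
have fLy x : lip_on Lambda (fun y => f (clipv K x, y)) L.
  by move=> y y' Ly Ly'; have := HL x x y y' Ly Ly'; rewrite subrr normr0 mulr0 add0r.
have bf x j : bounded_mfun D (fun y => f (clipv K x, y) 0 j).
  apply: (@lip_on_bmf _ _ _ cL _ L M) => [y y' Ly Ly'|y Ly].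
    rewrite (le_trans _ (fLy x y y' Ly Ly')) //.
    by have := coord_norm_le (f (clipv K x, y) - f (clipv K x, y')) j; rewrite !mxE.
  by rewrite (le_trans (coord_norm_le _ _)) // HM.
have FE x j : F (clipv K x) 0 j = E (fun y => f (clipv K x, y) 0 j) by rewrite mxE.
have FL x x' : `|F (clipv K x) - F (clipv K x')| <= L * `|x - x'|.
  apply: row_norm_le => [|j]; first by rewrite mulr_ge0.
  rewrite [X in `|X|]mxE [X in `|_ + X|]mxE !FE -expectB //.
  apply: norm_expect_cst => //; [exact: bounded_mfunB|by rewrite mulr_ge0|].
  move=> y Ly; rewrite (le_trans _ (fLx y Ly x x')) //.
  by have := coord_norm_le (f (clipv K x, y) - f (clipv K x', y)) j; rewrite !mxE.
have FM x : `|F (clipv K x)| <= M.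
  apply: row_norm_le => // j; rewrite FE; apply: norm_expect_cst => //.
  by move=> y Ly; rewrite (le_trans (coord_norm_le _ _)) // HM.
exists L, M; split => //.
- move=> c eta Le; split => //.
  + by move=> s x x'; apply: fLx; exact: (flow_in fl).
  + by move=> s x; apply: HM; exact: (flow_in fl).
  + move=> x; apply: (@lip_on_comp_cont _ _ _ Lambda (fun y => f (clipv K x, y)) L
      (fun s : R => phi (c * s) eta)) => //.
      by move=> s; exact: (flow_in fl).
    have := flow_affine_cont (c := c) (s := 0) fl Le.
    by under eq_fun do rewrite add0r.
- by split => // x; exact: cst_continuous.
move=> u; split.
- by move=> y y' Ly Ly'; rewrite /osc opprB addrA subrK; exact: fLy.
- by move=> y Ly; rewrite (le_trans (ler_normB _ _)) // lerD // HM.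
apply/rowP => j; rewrite [LHS]mxE [RHS]mxE.
rewrite (eq_Rintegral mu (g := fun y => f (clipv K u, y) 0 j - F (clipv K u) 0 j)); last first.
  by move=> y _; rewrite /osc [LHS]mxE [X in _ + X]mxE.
rewrite expectB //; last exact: bounded_mfun_cst.
rewrite FE [X in _ - X]Rintegral_cst // [X in _ - _ * X](congr1 fine mu1) mulr1 subrr //.
Qed.

Definition avg_sol K (p : path_space R d) : R -> V :=
  ode_sol (fun t => xi + pt p t) (avg_field K).

Definition noise_path eps eta : path_space R d := path_of (noise phi f0 eps eta).

Lemma pt_noise eps eta t : Lambda eta -> 0 <= t ->
  pt (noise_path eps eta) t = noise phi f0 eps eta t.
Proof.
move=> Le t0; rewrite pt_path_of //; apply: continuous_subspaceT.
exact: (noise_cont cL fl f0lip).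
Qed.

(** The integrals start at time 0, because an integral over a window is the difference of two of
    them. *)
Definition osc_sum K (s : seq V) (c delta : R) N eta : R :=
  \sum_(j < N.+1) \sum_(u <- s) `|fast_integral phi (osc K u) c (j%:R * delta) eta|.

Section estimate.
Context (K L M : R) (K0 : 0 <= K) (tf : trunc_fields K L M).

Lemma avg_sol_cont p : continuous (avg_sol K p).
Proof.
apply: (ode_sol_cont (tf_avg tf)) => t; apply: cvgD; first exact: cvg_cst.
exact: pt_cont.
Qed.

Lemma avg_solE p t : avg_sol K p t = xi + pt p t +
  time_integral t (fun s => avg_field K s (avg_sol K p s)).
Proof.
rewrite {1}/avg_sol (ode_solE (tf_avg tf)) // => {}t; apply: cvgD; first exact: cvg_cst.
exact: pt_cont.
Qed.

Lemma avg_sol_lip T a p q : sup_close T a p q ->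
  forall t, 0 <= t <= T -> `|avg_sol K p t - avg_sol K q t| <= a * expR (L * T).
Proof.
move=> pq; apply: (ode_stability (tf_avg tf)); [exact: avg_sol_cont..|].
move=> t tT; rewrite /ode_defect {1}(avg_solE p t) {1}(avg_solE q t).
have zmod (x1 a1 b1 i1 j1 : V) : x1 + a1 + i1 - i1 - (x1 + b1 + j1 - j1) = a1 - b1.
  by apply/rowP => k; rewrite !mxE; ring.
by rewrite zmod; exact: pq.
Qed.

Context (eps : R) (eta : Y) (e0 : 0 < eps) (Le : Lambda eta).
Local Notation c := ((eps ^+ 2)^-1).
Local Notation X := (trunc_sol phi f0 f xi K eps eta).
Local Notation Q t := (time_integral t (fun s => osc K (X s) (phi (c * s) eta))).

Lemma osc_lip x x' y : Lambda y -> `|osc K x y - osc K x' y| <= 2 * L * `|x - x'|.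
Proof.
move=> Ly; have zmod (a b a' b' : V) : a - b - (a' - b') = (a - a') - (b - b').
  by apply/rowP => k; rewrite !mxE; ring.
rewrite zmod (le_trans (ler_normB _ _)) //.
have [_ h1 _ _] := tf_avg tf; have [_ h2 _ _] := tf_slow tf 0 Le.
have := h1 0 x x'; rewrite /avg_field => H1.
(* At time 0 the orbit started at [y] is [y] itself, so the bound on [slow_field] is the Lipschitz
   bound of f(., y). *)
have [_ h3 _ _] := tf_slow tf 0 Ly; have := h3 0 x x'.
rewrite /slow_field mul0r; have [-> // _ _] := fl => H2.
lra.
Qed.

Lemma osc_cont (Z : R -> V) : continuous Z -> continuous (fun s => osc K (Z s) (phi (c * s) eta)).
Proof.
move=> Zc s; apply: cvgB.
  exact: (lip_field_cont (tf_slow tf c Le) Zc).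
exact: (lip_field_cont (tf_avg tf) Zc).
Qed.

Lemma osc_clip x y : osc K (clipv K x) y = osc K x y.
Proof. by rewrite /osc (clipv_id (clipv_norm x K0)). Qed.

Let Xc : continuous X := trunc_sol_cont cL fl f0lip flip K0 Le.
Let M0 : 0 <= M := tf_M tf.
Let L0 : 0 <= L := le_trans ler01 (tf_L tf).

Lemma trunc_sol_increment T delta s t : 0 <= s -> s <= t -> t <= T -> t - s <= delta ->
  `|X t - X s| <= modulus T delta (noise_path eps eta) + M * delta.
Proof.
move=> s0 st tT td; rewrite !(trunc_solE xi cL fl f0lip flip eps _ K0 Le).
have zmod (x a b i j : V) : x + a + i - (x + b + j) = (a - b) + (i - j).
  by apply/rowP => k; rewrite !mxE; ring.
have t0 := le_trans s0 st.
rewrite zmod (le_trans (ler_normD _ _)) // lerD //.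
  rewrite -!pt_noise //; apply: modulus_ge; rewrite ?t0 ?tT ?s0 ?(le_trans st) //.
  by rewrite ger0_norm // subr_ge0.
apply: (@le_trans _ _ (M * (t - s))); last by rewrite ler_wpM2l.
apply: ti_lip; first by rewrite s0.
  exact: (lip_field_cont (tf_slow tf c Le) Xc).
by move=> q _; have [_ _ HM _] := tf_slow tf c Le; exact: HM.
Qed.

Lemma window_bound T delta (gamma : R) (us : seq V) N j :
  0 <= delta -> (j.+1 <= N)%N -> j.+1%:R * delta <= T ->
  (forall x, `|x| <= K -> exists2 u, u \in us & `|x - u| < gamma) ->
  `|Q (j.+1%:R * delta) - Q (j%:R * delta)| <=
  ((2 * L + 4 * M) * Num.min 1 (modulus T delta (noise_path eps eta)) +
    2 * L * M * delta + 2 * L * gamma) * delta + 2 * osc_sum K us c delta N eta.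
Proof.
move=> d0 jN jT Hus; set m := modulus _ _ _.
set a := j%:R * delta; set b := j.+1%:R * delta.
have a0 : 0 <= a by rewrite mulr_ge0.
have ba : b - a = delta by rewrite /a /b -mulrBl -natr1 addrAC subrr add0r mul1r.
have ab : a <= b by rewrite -subr_ge0 ba.
have [u us_u xu] := Hus _ (clipv_norm (X a) K0).
have m0 : 0 <= m by apply: modulus_ge0 => //; rewrite (le_trans a0) // (le_trans ab).
have uc : continuous (fun s => osc K u (phi (c * s) eta)).
  exact: (osc_cont (@cst_continuous _ _ u)).
have xc := osc_cont Xc.
(* The first bracket is the error of freezing the slow variable at [u]; the second involves the fast
   orbit only and is controlled by two terms of [osc_sum]. *)
have -> : Q b - Q a =
    (time_integral b (fun s => osc K (X s) (phi (c * s) eta) - osc K u (phi (c * s) eta)) -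
     time_integral a (fun s => osc K (X s) (phi (c * s) eta) - osc K u (phi (c * s) eta))) +
    (fast_integral phi (osc K u) c b eta - fast_integral phi (osc K u) c a eta).
  have tB t : time_integral t
        (fun s => osc K (X s) (phi (c * s) eta) - osc K u (phi (c * s) eta)) =
      Q t - fast_integral phi (osc K u) c t eta by exact: (tiB t xc uc).
  have zmod (x1 x2 y1 y2 : V) : x1 - x2 = (x1 - y1 - (x2 - y2)) + (y1 - y2).
    by apply/rowP => k; rewrite !mxE; ring.
  by rewrite (tB a) (tB b) -zmod.
rewrite (le_trans (ler_normD _ _)) // lerD //.
  rewrite -[X in _ <= _ * X]ba; apply: ti_lip; first by rewrite a0.
    by move=> s; apply: cvgB; [exact: xc|exact: uc].
  move=> s /andP[as_ sb]; have s0 := le_trans a0 as_.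
  have Ly := flow_in fl (c * s) Le.
  have inc : `|X s - X a| <= m + M * delta.
    apply: trunc_sol_increment => //; first by rewrite (le_trans sb).
    by rewrite -ba lerD2r.
  have o1 : `|osc K (X s) (phi (c * s) eta) - osc K (X a) (phi (c * s) eta)| <=
      (2 * L + 4 * M) * Num.min 1 m + 2 * L * M * delta.
    have B z : `|osc K z (phi (c * s) eta)| <= M + M by have [_ + _] := tf_osc tf z; apply.
    exact: (window_arith L0 M0 m0 d0 (osc_lip (X s) (X a) Ly) inc
      (ler_normB _ _) (B (X s)) (B (X a))).
  have o2 : `|osc K (X a) (phi (c * s) eta) - osc K u (phi (c * s) eta)| <= 2 * L * gamma.
    rewrite -osc_clip (le_trans (osc_lip _ _ Ly)) // ler_wpM2l ?mulr_ge0 //.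
    exact: ltW.
  rewrite -(subrKA (osc K (X a) (phi (c * s) eta))) (le_trans (ler_normD _ _)) //.
  exact: lerD.
have S i : (i < N.+1)%N ->
    `|fast_integral phi (osc K u) c (i%:R * delta) eta| <= osc_sum K us c delta N eta.
  move=> iN; rewrite /osc_sum (bigD1 (Ordinal iN)) //= (big_rem u) //= -addrA lerDl.
  by rewrite addr_ge0 ?sumr_ge0 // => i' _; apply: sumr_ge0.
rewrite (le_trans (ler_normB _ _)) //.
by rewrite mulr_natl mulr2n; apply: lerD; [exact: (S j.+1 jN)|exact: (S j (ltnW jN))].
Qed.

(* On each window [j delta, (j + 1) delta] the slow variable is replaced by its value at
   the left end, then by the nearest point of the net us; this leaves the fast integrals
   of finitely many frozen oscillations. *)
Lemma averaging_bound T (gamma : R) (us : seq V) N : 0 <= T -> 0 <= gamma ->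
  (forall x, `|x| <= K -> exists2 u, u \in us & `|x - u| < gamma) ->
  let delta := T / N.+1%:R in
  forall t, 0 <= t <= T -> `|X t - avg_sol K (noise_path eps eta) t| <=
   (((2 * L + 4 * M) * Num.min 1 (modulus T delta (noise_path eps eta)) +
    2 * L * M * delta + 2 * L * gamma) * T +
    2 * N.+1%:R * osc_sum K us c delta N.+1 eta + 2 * M * delta) * expR (L * T).
Proof.
move=> T0 g0 Hus delta; set A := (_ + 2 * L * gamma); set S := osc_sum _ _ _ _ _ _.
have d0 : 0 <= delta by rewrite divr_ge0.
have N0 : 0 < (N.+1%:R : R) by rewrite ltr0n.
have Td : T = N.+1%:R * delta by rewrite /delta mulrCA mulfV ?gt_eqF // mulr1.
have A0 : 0 <= A.
  rewrite !addr_ge0 ?mulr_ge0 ?addr_ge0 ?mulr_ge0 //.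
  by rewrite le_min ler01 modulus_ge0.
have S0 : 0 <= S by apply: sumr_ge0 => i _; apply: sumr_ge0.
apply: (ode_stability (tf_avg tf) Xc (@avg_sol_cont (noise_path eps eta))).
move=> t tT; have [t0 tT'] := andP tT.
(* Both equations are driven by the same noise, which cancels: the only source of error is the
   accumulated oscillation. *)
have -> : ode_defect (avg_field K) X t -
    ode_defect (avg_field K) (avg_sol K (noise_path eps eta)) t = Q t.
  rewrite /ode_defect {1}(trunc_solE xi cL fl f0lip flip eps t K0 Le).
  rewrite {1}(avg_solE (noise_path eps eta) t) (pt_noise eps Le t0).
  have zmod (x a i j k : V) : x + a + i - j - (x + a + k - k) = i - j.
    by apply/rowP => q; rewrite !mxE; ring.
  rewrite zmod -tiB //; [exact: (lip_field_cont (tf_slow tf c Le) Xc)|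
    exact: (lip_field_cont (tf_avg tf) Xc)].
have grid k : (k <= N.+1)%N -> `|Q (k%:R * delta)| <= k%:R * (A * delta + 2 * S).
  elim: k => [|k ih] kN; first by rewrite !mul0r tiN // normr0.
  have kT : k.+1%:R * delta <= T by rewrite Td ler_wpM2r // ler_nat.
  have W := window_bound d0 kN kT Hus.
  rewrite -(subrK (Q (k%:R * delta)) (Q (k.+1%:R * delta))) (le_trans (ler_normD _ _)) //.
  rewrite -[X in _ <= X * _]natr1 mulrDl mul1r addrC lerD //; first exact: ih (ltnW kN).
have [d00|dpos] : delta = 0 \/ 0 < delta.
  by move: d0; rewrite le_eqVlt => /predU1P[<-|]; [left|right].
  have T00 : T = 0 by rewrite Td d00 mulr0.
  have t00 : t <= 0 by rewrite (le_trans tT') // T00.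
  rewrite tiN // normr0 T00 mulr0 add0r d00 !mulr0 addr0.
  by rewrite !mulr_ge0 // ltW.
(* [k] complete windows precede [t]; the incomplete one is shorter than [delta] and costs at most 2
   M delta. *)
set k := Num.trunc (t / delta).
have td0 : 0 <= t / delta by rewrite divr_ge0.
have /andP[kt tk] := truncn_itv td0; rewrite -/k in kt tk.
have kt' : k%:R * delta <= t by rewrite -ler_pdivlMr.
have tk' : t - k%:R * delta <= delta.
  by rewrite lerBlDr -[X in X + _]mul1r -mulrDl nat1r -ler_pdivrMr // ltW.
have kN : (k <= N.+1)%N.
  by rewrite -(ler_nat R) -(ler_pM2r dpos) -Td (le_trans kt').
rewrite -(subrK (Q (k%:R * delta)) (Q t)) (le_trans (ler_normD _ _)) // addrC.
apply: lerD; last first.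
  apply: (@le_trans _ _ ((M + M) * (t - k%:R * delta))).
    apply: ti_lip; first by rewrite mulr_ge0.
      exact: osc_cont.
    move=> q _; have [_ + _] := tf_osc tf (X q); apply; exact: (flow_in fl).
  by rewrite (_ : M + M = 2 * M); [rewrite ler_wpM2l // mulr_ge0|ring].
rewrite (le_trans (grid k kN)) //.
apply: (@le_trans _ _ (N.+1%:R * (A * delta + 2 * S))).
  by rewrite ler_wpM2r ?ler_nat // addr_ge0 // mulr_ge0.
by rewrite Td mulrDr !mulrA [N.+1%:R * A]mulrC [N.+1%:R * 2]mulrC.
Qed.

End estimate.
End averaging.

(** * Weak convergence tested on Lipschitz functionals *)

Section weak_convergence.
Context (R : realType) (d : nat).
Local Notation V := 'rV[R]_d.
Local Notation path := (path_space R d).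

Lemma continuous_path_measurable (Psi : path -> R) : continuous Psi ->
  measurable_fun setT (Psi : borel path -> R).
Proof.
move=> Pc; apply: (measurability _ (@RGenOInfty.measurableE R)).
move=> _ [_ [x ->] <-]; rewrite setTI.
apply: (@sub_sigma_algebra _ setT (@open path)).
by move/continuousP : Pc; apply; exact: interval_open.
Qed.

Section random_path_functional.
Context (disp : measure_display) (T : measurableType disp) (D : set T).
Hypothesis mD : measurable D.

Lemma random_path_bmf (X : T -> R -> V) (Psi : path -> R) (M : R) :
  random_path D X -> continuous Psi -> (forall p, `|Psi p| <= M) ->
  bounded_mfun D (fun w => Psi (path_of (X w))).
Proof.
move=> [_ mX] Pc PM; split; last by exists M => w _; exact: PM.
exact: (measurable_comp measurableT (@subsetT _ _) (continuous_path_measurable Pc) mX).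
Qed.

Lemma random_path_within (X : T -> R -> V) w : random_path D X -> D w ->
  {within halfline R, continuous (X w)}.
Proof. by move=> [Xc _] /Xc /subspace_sigL_continuousP. Qed.

End random_path_functional.

(* Lower Lipschitz envelopes of Phi; they increase to Phi when it is continuous. *)
Definition inf_conv (Phi : path -> R) (k : nat) (p : path) : R :=
  inf [set Phi q + k%:R * sup_norm k%:R (fun t => pt p t - pt q t) | q in setT].

Section inf_conv.
Context (Phi : path -> R) (M : R).
Hypothesis (PM : forall p, `|Phi p| <= M).

Let sub_cont (p q : path) : continuous (fun t => pt p t - pt q t).
Proof. by move=> t; apply: cvgB; exact: pt_cont. Qed.

Let conv_ge k p q : - M <= Phi q + k%:R * sup_norm k%:R (fun t => pt p t - pt q t).
Proof.
have := PM q; rewrite ler_norml => /andP[h _].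
rewrite (le_trans h) // lerDl mulr_ge0 // sup_norm_ge0 //.
Qed.

Let conv_lb k p :
  has_lbound [set Phi q + k%:R * sup_norm k%:R (fun t => pt p t - pt q t) | q in setT].
Proof. by exists (- M) => _ [q _ <-]; exact: conv_ge. Qed.

Lemma inf_conv_le k p q :
  inf_conv Phi k p <= Phi q + k%:R * sup_norm k%:R (fun t => pt p t - pt q t).
Proof. by apply: ge_inf => //; exists q. Qed.

Lemma le_inf_conv k p (a : R) :
  (forall q, a <= Phi q + k%:R * sup_norm k%:R (fun t => pt p t - pt q t)) ->
  a <= inf_conv Phi k p.
Proof.
move=> H; apply: lb_le_inf; first by eexists; exists p.
by move=> _ [q _ <-]; exact: H.
Qed.

Lemma inf_conv_le_self k p : inf_conv Phi k p <= Phi p.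
Proof.
rewrite (le_trans (inf_conv_le k p p)) // gerDl.
have -> : sup_norm k%:R (fun t => pt p t - pt p t) = 0; last by rewrite mulr0.
apply/eqP; rewrite eq_le sup_norm_ge0 // andbT; apply: sup_norm_le => // t _.
by rewrite subrr normr0.
Qed.

Lemma inf_conv_bounded k p : `|inf_conv Phi k p| <= M.
Proof.
rewrite ler_norml le_inf_conv //=.
by rewrite (le_trans (inf_conv_le_self k p)) // (le_trans (ler_norm _)).
Qed.

Lemma inf_conv_lip k : path_lip k%:R k%:R (inf_conv Phi k).
Proof.
have half p q a : sup_close k%:R a p q -> inf_conv Phi k p <= inf_conv Phi k q + k%:R * a.
  move=> pq; rewrite -lerBlDr; apply: le_inf_conv => r.
  rewrite lerBlDr (le_trans (inf_conv_le k p r)) // -addrA lerD2l -mulrDr ler_wpM2l //.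
  apply: sup_norm_le => // t tk.
  rewrite -(subrKA (pt q t)) (le_trans (ler_normD _ _)) // addrC lerD ?pq //.
  exact: (sup_norm_ge (@sub_cont q r)).
move=> p q a pq; have qp : sup_close k%:R a q p by move=> t tT; rewrite distrC pq.
by rewrite ler_norml lerBlDl (half _ _ _ pq) andbT lerBrDl lerBlDl [k%:R * a + _]addrC (half _ _ _ qp).
Qed.

(** Paths [q] close to [p] have [Phi q] close to [Phi p]; for the others the penalty exceeds k a >=
    2 M, too much to lower the infimum. As [k] is both the slope and the time horizon, a single
    limit suffices. *)
Lemma inf_conv_cvg p : continuous Phi -> inf_conv Phi k p @[k --> \oo] --> Phi p.
Proof.
move=> Pc; apply/cvgrPdist_le => e e0.
have : nbhs p [set q | `|Phi p - Phi q| < e].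
  have /(cvgrPdist_lt (FF := nbhs_filter p)) := Pc p; exact.
move=> /nbhs_sup_close[T [a [T0 a0 Ta]]].
near=> k.
have kT : T <= k%:R by near: k; exact: nbhs_infty_ger.
have ka : (M + M) / a <= k%:R by near: k; exact: nbhs_infty_ger.
rewrite ger0_norm ?subr_ge0 ?inf_conv_le_self // lerBlDr -lerBlDl.
apply: le_inf_conv => q.
have [sa|sa] := leP (sup_norm k%:R (fun t => pt p t - pt q t)) a.
  have : `|Phi p - Phi q| < e.
    apply: Ta => t /andP[t0 tT]; rewrite (le_trans _ sa) //.
    by apply: (sup_norm_ge (@sub_cont p q)); rewrite t0 (le_trans tT).
  move=> /(le_lt_trans (ler_norm _)) h.
  have : 0 <= k%:R * sup_norm k%:R (fun t => pt p t - pt q t).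
    by rewrite mulr_ge0 // sup_norm_ge0.
  lra.
have h1 : M + M <= k%:R * sup_norm k%:R (fun t => pt p t - pt q t).
  rewrite ler_pdivrMr // in ka; rewrite (le_trans ka) // ler_wpM2l // ltW //.
have := PM p; have := PM q; rewrite !ler_norml => /andP[? ?] /andP[? ?]; lra.
Unshelve. all: by end_near. Qed.

End inf_conv.

(** Approximation from below by Lipschitz envelopes gives the lower bound on the limit of the
    expectations, for every bounded continuous functional. Applying this to [Phi] and to [- Phi]
    gives convergence. *)
Lemma weak_cvg_lip (I : Type) (F : set_system I) (FF : ProperFilter F)
    (d1 : measure_display) (T : measurableType d1) (mu : probability T R) (D : set T)
    (X : I -> T -> R -> V)
    (d2 : measure_display) (U : measurableType d2) (P : probability U R)
    (Y : U -> R -> V) :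
  measurable D -> (\forall i \near F, random_path D (X i)) -> random_path setT Y ->
  (forall (S k M : R) (Psi : path -> R), 0 <= S -> 0 <= k -> path_lip S k Psi ->
    (forall p, `|Psi p| <= M) ->
    \int[mu]_(w in D) Psi (path_of (X i w)) @[i --> F] --> \int[P]_w Psi (path_of (Y w))) ->
  weak_cvg F mu D X P Y.
Proof.
move=> mD rX rY H; split => // Phi Pc [M PM].
have half (Psi : path -> R) : continuous Psi -> (forall p, `|Psi p| <= M) ->
    forall e, 0 < e -> \forall i \near F,
    \int[P]_w Psi (path_of (Y w)) - e < \int[mu]_(w in D) Psi (path_of (X i w)).
  move=> Psic PsiM e e0; have e2 : 0 < e / 2 by rewrite divr_gt0.
  have Kc k : continuous (inf_conv Psi k).
    apply: (@path_lip_continuous R d k%:R k%:R); first exact: ler0n.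
    exact: (inf_conv_lip PsiM).
  have : \int[P]_w (inf_conv Psi k (path_of (Y w))) @[k --> \oo] -->
      \int[P]_w Psi (path_of (Y w)).
    apply: (@expect_dct _ _ _ P setT measurableT _ _ M).
    - by move=> k; have [] := random_path_bmf rY (Kc k) (inf_conv_bounded PsiM k).
    - by have [] := random_path_bmf rY Psic PsiM.
    - by move=> k w _; exact: inf_conv_bounded.
    - by apply: aeW => w _; exact: (inf_conv_cvg PsiM).
  move=> /cvgrPdist_lt /(_ _ e2)[k _ /(_ k (leqnn k)) /= hk].
  have /cvgrPdist_lt /(_ _ e2) := H _ _ _ _ (ler0n _ k) (ler0n _ k) (inf_conv_lip PsiM (k := k))
    (inf_conv_bounded PsiM k).
  move=> Hi; near=> i.
  have ri : random_path D (X i) by near: i.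
  have : \int[mu]_(w in D) inf_conv Psi k (path_of (X i w)) <=
         \int[mu]_(w in D) Psi (path_of (X i w)).
    apply: (@le_expect _ _ _ mu D mD (fun w => inf_conv Psi k (path_of (X i w)))
      (fun w => Psi (path_of (X i w)))).
    - exact: (random_path_bmf ri (Kc k) (inf_conv_bounded PsiM k)).
    - exact: (random_path_bmf ri Psic PsiM).
    - by move=> w _; exact: (inf_conv_le_self PsiM).
  have : `|\int[P]_w (inf_conv Psi k (path_of (Y w))) -
          \int[mu]_(w in D) inf_conv Psi k (path_of (X i w))| < e / 2 by near: i.
  move=> /(le_lt_trans (ler_norm _)); move: hk => /(le_lt_trans (ler_norm _)); lra.
apply/cvgrPdist_lt => e e0.
have NPc : continuous (fun p => - Phi p).
  by move=> p; apply: (@cvgN _ _ _ (nbhs p) (nbhs_filter p)); exact: Pc.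
have NPM p : `|- Phi p| <= M by rewrite normrN.
have h1 := half Phi Pc PM e e0; have h2 := half _ NPc NPM e e0.
near=> i.
have ri : random_path D (X i) by near: i.
have b1 : \int[P]_w Phi (path_of (Y w)) - e < \int[mu]_(w in D) Phi (path_of (X i w)).
  by near: i.
have b2 : \int[P]_w - Phi (path_of (Y w)) - e < \int[mu]_(w in D) - Phi (path_of (X i w)).
  by near: i.
have N1 : \int[P]_w - Phi (path_of (Y w)) = - \int[P]_w Phi (path_of (Y w)).
  have := @expectZ _ _ _ P setT measurableT (-1) _ (random_path_bmf rY Pc PM).
  by rewrite mulN1r => <-; apply: eq_Rintegral => w _; rewrite mulN1r.
have N2 : \int[mu]_(w in D) - Phi (path_of (X i w)) = - \int[mu]_(w in D) Phi (path_of (X i w)).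
  have := @expectZ _ _ _ mu D mD (-1) _ (random_path_bmf ri Pc PM).
  by rewrite mulN1r => <-; apply: eq_Rintegral => w _; rewrite mulN1r.
rewrite N1 N2 in b2; rewrite ltr_norml; apply/andP; split; lra.
Unshelve. all: by end_near. Qed.

End weak_convergence.

(** * The invariance principle in continuous time *)

(** Here r = sqrt n with n <= e^-2 <= n + 1. Then (e r)^2 >= 1 - e^2 and e r <= 1 give 1 - e r <=
    e^2, so the change of prefactor from 1 / r to e costs little even against an integral of size M
    r^2 t. *)
Lemma rescaling_error (R : realType) (e r M t A B : R) : 0 < e -> 0 < r -> 0 <= M -> 0 <= t ->
  r ^+ 2 <= (e ^+ 2)^-1 -> (e ^+ 2)^-1 <= r ^+ 2 + 1 ->
  A <= M * ((e ^+ 2)^-1 * t - r ^+ 2 * t) -> B <= M * (r ^+ 2 * t) ->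
  e * A + `|e - r^-1| * B <= 2 * M * t * e.
Proof.
move=> e0 r0 M0 t0 re er hA hB.
have e20 : 0 < e ^+ 2 by rewrite exprn_gt0.
have ne : e != 0 by rewrite gt_eqF.
have nr : r != 0 by rewrite gt_eqF.
have er1 : e * r <= 1.
  rewrite -(@ler_pXn2r _ 2) ?nnegrE ?mulr_ge0 ?(ltW e0) ?(ltW r0) // expr1n exprMn.
  by rewrite -(@mulfV _ (e ^+ 2)) ?gt_eqF // ler_wpM2l // ltW.
have h1 : e * A <= M * t * e.
  apply: (@le_trans _ _ (e * (M * t))); last by rewrite mulrC.
  rewrite ler_wpM2l ?(ltW e0) // (le_trans hA) // ler_wpM2l // -mulrBl ler_piMl //.
  by rewrite lerBlDr addrC.
have q1 : 1 - e * r <= e ^+ 2.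
  have h : 1 - (e * r) ^+ 2 <= e ^+ 2.
    have : (e ^+ 2)^-1 * e ^+ 2 <= (r ^+ 2 + 1) * e ^+ 2 by rewrite ler_wpM2r // ltW.
    rewrite mulVf ?gt_eqF // exprMn; lra.
  have : (e * r) ^+ 2 <= e * r by rewrite expr2 ler_piMl // mulr_ge0 ?ltW.
  lra.
have abs : `|e - r^-1| = (1 - e * r) / r.
  have -> : e - r^-1 = - ((1 - e * r) / r) by field.
  by rewrite normrN ger0_norm // divr_ge0 ?subr_ge0 // ltW.
have h2 : `|e - r^-1| * B <= M * t * e.
  rewrite abs; apply: (@le_trans _ _ ((1 - e * r) / r * (M * (r ^+ 2 * t)))).
    by rewrite ler_wpM2l // divr_ge0 ?subr_ge0 // ltW.
  have -> : (1 - e * r) / r * (M * (r ^+ 2 * t)) = (M * t) * ((1 - e * r) * r) by field.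
  rewrite ler_wpM2l ?mulr_ge0 //.
  apply: (@le_trans _ _ (e ^+ 2 * r)); first by rewrite ler_wpM2r // ltW.
  by rewrite expr2 -mulrA ler_piMr // ltW.
lra.
Qed.

Section wip.
Context (R : realType) (d l : nat).
Local Notation V := 'rV[R]_d.
Local Notation Y := 'rV[R]_l.
Context (g : Y -> Y) (Lambda : set Y) (phi : R -> Y -> Y) (mu : probability (borel Y) R).
Context (f0 : Y -> V).
Hypotheses (cL : compact Lambda) (glip : locally_lipschitz setT g)
  (fl : invariant_flow g Lambda phi)
  (f0lip : locally_lipschitz Lambda f0).
Local Notation D := (Lambda : set (borel Y)).
Context (S : 'M[R]_d) (disp : measure_display) (Omega : measurableType disp)
  (P : probability Omega R) (W : Omega -> R -> V).
Hypothesis wip : mildly_chaotic f0 Lambda phi mu S P W.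

Let mD : measurable D := compact_borel cL.

Lemma noise_rescale : exists2 M, 0 <= M & forall eps n eta t, 0 < eps -> (0 < n)%N ->
  n%:R <= (eps ^+ 2)^-1 -> (eps ^+ 2)^-1 <= n%:R + 1 -> Lambda eta -> 0 <= t ->
  `|noise phi f0 eps eta t - W_ f0 phi n eta t| <= 2 * M * t * eps.
Proof.
have [L [M [_ M0 HL HM]]] := f0_bounds cL f0lip.
exists M => // eps n eta t e0 n0 nc cn Le t0.
pose I (s : R) := time_integral s (fun s => f0 (phi s eta)).
have fc : continuous (fun s => f0 (phi s eta)).
  apply: (@lip_on_comp_cont _ _ _ _ _ _ (phi^~ eta) HL); last exact: (flow_cont fl).
  by move=> s; exact: (flow_in fl).
have Mf s : `|f0 (phi s eta)| <= M by apply: HM; exact: (flow_in fl).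
set r := Num.sqrt (n%:R : R).
have nR : 0 < (n%:R : R) by rewrite ltr0n.
have r0 : 0 < r by rewrite sqrtr_gt0.
have r2 : r ^+ 2 = n%:R by rewrite sqr_sqrtr // ltW.
have c0 : 0 < (eps ^+ 2)^-1 by rewrite invr_gt0 exprn_gt0.
have nE : noise phi f0 eps eta t = eps *: I ((eps ^+ 2)^-1 * t).
  have := @ti_affine _ _ 0 (eps ^+ 2)^-1 t _ fc (lexx 0) c0 t0.
  rewrite add0r (tiN _ (lexx 0)) add0r -/(I _) => ->.
  rewrite scalerA /noise /fast_integral expr2 invfM mulrA mulfV ?gt_eqF // mul1r.
  by congr (_ *: _); apply: eq_ti => s _; rewrite add0r.
rewrite nE /W_ -/r -/(I _) -r2.
(* The error separates into a change of the time horizon and a change of the prefactor. *)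
have zmod (a b : R) (u v : V) : a *: u - b *: v = a *: (u - v) + (a - b) *: v.
  by rewrite scalerBr scalerBl addrA subrK.
rewrite zmod (le_trans (ler_normD _ _)) // !normrZ (gtr0_norm e0).
have rc : r ^+ 2 * t <= (eps ^+ 2)^-1 * t by rewrite ler_wpM2r // r2.
have rt0 : 0 <= r ^+ 2 * t by rewrite mulr_ge0 // r2 ltW.
apply: rescaling_error => //; rewrite ?r2 //.
  rewrite -r2; apply: ti_lip => //; first by rewrite rt0.
rewrite -r2; apply: ti_norm_cst => //.
Qed.

(** For fixed [eps] the noise is Lipschitz in [eta], so a Lipschitz functional of it is Lipschitz on
    [Lambda], hence measurable. *)
Lemma noise_path_bmf eps k T (Psi : path_space R d -> R) (M : R) : 0 < eps -> 0 <= T ->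
  0 <= k -> path_lip T k Psi -> (forall p, `|Psi p| <= M) ->
  bounded_mfun D (fun eta => Psi (noise_path phi f0 eps eta)).
Proof.
move=> e0 T0 k0 PL PM; have [C [C0 HC]] := noise_lip_eta cL glip fl f0lip e0 T0.
apply: (@lip_on_bmf _ _ _ cL _ (k * C) M); last by move=> eta _; exact: PM.
move=> eta eta' Le Le'; rewrite -mulrA; apply: PL => t tT.
have [t0 _] := andP tT.
have := HC _ _ _ Le Le' tT.
have <- := pt_noise cL fl f0lip eps Le t0; have <- := pt_noise cL fl f0lip eps Le' t0.
exact.
Qed.

(** The invariance principle is assumed along integers. With n the integer part of eps^-2,
    [noise_rescale] bounds the distance between the noise and [W_ f0 phi n] on [0, T] by a multiple
    of [eps], which a Lipschitz functional cannot magnify by more than [k]. *)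
Lemma wip_eps T k M (Psi : path_space R d -> R) : 0 <= T -> 0 <= k ->
  path_lip T k Psi -> (forall p, `|Psi p| <= M) ->
  \int[mu]_(eta in D) Psi (noise_path phi f0 eps eta) @[eps --> 0^'+] -->
  \int[P]_w Psi (path_of (scaled_path S W w)).
Proof.
move=> T0 k0 PL PM; have Pc := path_lip_continuous T0 PL.
have [rW rS Hcvg] := wip.
have Hn := Hcvg Psi Pc (ex_intro _ M PM).
have [C C0 HC] := noise_rescale.
apply/cvgrPdist_lt => e e0.
have e2 : 0 < e / 2 by rewrite divr_gt0.
have /cvgrPdist_lt /(_ _ e2) Hn2 := Hn.
have [N _ HN] : \forall n \near \oo, random_path D (W_ f0 phi n) /\
   `|\int[P]_w Psi (path_of (scaled_path S W w)) -
     \int[mu]_(eta in D) Psi (path_of (W_ f0 phi n eta))| < e / 2.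
  by near=> n; split; near: n.
have B0 : 0 <= k * (2 * C * T) by rewrite !mulr_ge0.
have N10 : 0 < (N.+1%:R : R)^-1 by rewrite invr_gt0 ltr0n.
have Be : 0 < e / 2 / (k * (2 * C * T) + 1) by rewrite divr_gt0 // ltr_wpDl.
near=> eps.
have eps0 : 0 < eps by near: eps; exact: nbhs_right_gt.
have eps1 : eps <= 1 by near: eps; apply: nbhs_right_le; exact: ltr01.
have epsN : eps <= N.+1%:R^-1 by near: eps; exact: nbhs_right_le.
have epsB : eps < e / 2 / (k * (2 * C * T) + 1) by near: eps; exact: nbhs_right_lt.
have c0 : 0 < (eps ^+ 2)^-1 by rewrite invr_gt0 exprn_gt0.
set n := Num.trunc ((eps ^+ 2)^-1).
have /andP[nc cn] := truncn_itv (ltW c0); rewrite -/n in nc cn.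
have Nn : (N.+1 <= n)%N.
  rewrite truncn_ge_nat ?(ltW c0) // -[N.+1%:R]invrK lef_pV2 ?posrE ?exprn_gt0 //.
  by rewrite (le_trans _ epsN) // expr2 ler_piMl // ltW.
have [rn Hn'] := HN n (ltnW Nn).
have bW := random_path_bmf rn Pc PM.
have bN := noise_path_bmf eps0 T0 k0 PL PM.
have diff : `|\int[mu]_(eta in D) Psi (path_of (W_ f0 phi n eta)) -
    \int[mu]_(eta in D) Psi (noise_path phi f0 eps eta)| <= k * (2 * C * T) * eps.
  rewrite -(@expectB _ _ _ mu D mD _ _ bW bN); apply: (@norm_expect_cst _ _ _ mu D mD).
  - exact: (bounded_mfunB bW bN).
  - by rewrite mulr_ge0 // ltW.
  move=> eta Le; rewrite -mulrA; apply: PL => t /andP[t0 tT].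
  have n0 : (0 < n)%N by exact: leq_trans Nn.
  have cn' : (eps ^+ 2)^-1 <= n%:R + 1 by rewrite natr1 ltW.
  have := HC _ _ _ _ eps0 n0 nc cn' Le t0.
  have <- := pt_noise cL fl f0lip eps Le t0.
  have <- := pt_path_of (random_path_within rn Le) t0.
  move=> h; apply: (@le_trans _ _ (2 * C * t * eps)); first by rewrite distrC; exact: h.
  by rewrite ler_wpM2r ?(ltW eps0) // ler_wpM2l // mulr_ge0.
rewrite -(subrKA (\int[mu]_(eta in D) Psi (path_of (W_ f0 phi n eta)))).
apply: (le_lt_trans (ler_normD _ _)); rewrite (splitr e); apply: ltrD; first exact: Hn'.
apply: (le_lt_trans diff).
apply: (@le_lt_trans _ _ ((k * (2 * C * T) + 1) * eps)).
  by rewrite ler_wpM2r ?(ltW eps0) // lerDl.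
by rewrite mulrC -ltr_pdivlMr // ltr_wpDl.
Unshelve. all: by end_near. Qed.

End wip.

(** * Proof of the theorem *)

Section assembly.
Context (R : realType) (d l : nat).
Local Notation V := 'rV[R]_d.
Local Notation Y := 'rV[R]_l.
Context (g : Y -> Y) (Lambda : set Y) (phi : R -> Y -> Y) (mu : probability (borel Y) R).
Context (f0 : Y -> V) (f : V * Y -> V) (xi : V).
Hypotheses (cL : compact Lambda) (glip : locally_lipschitz setT g)
  (fl : invariant_flow g Lambda phi) (erg : ergodic_measure Lambda phi mu)
  (f0lip : locally_lipschitz Lambda f0)
  (flip : locally_lipschitz (setT `*` Lambda) f).
Local Notation D := (Lambda : set (borel Y)).
Local Notation F z := (row_integral mu D (fun eta => f (z, eta))).
Context (S : 'M[R]_d) (disp : measure_display) (Omega : measurableType disp)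
  (P : probability Omega R) (W X : Omega -> R -> V).
Hypothesis wip : mildly_chaotic f0 Lambda phi mu S P W.
Hypothesis sde : sde_solution xi S (fun z => F z) P W X.
Local Notation SW w := (path_of (scaled_path S W w)).
Local Notation G := (avg_sol Lambda mu f xi).
Local Notation Z := (trunc_sol phi f0 f xi).
Local Notation N_ := (noise_path phi f0).

Let mD : measurable D := compact_borel cL.

Lemma scaled_lt (c x y : R) : 0 <= c -> 0 < y -> x < y / (c + 1) -> c * x <= y.
Proof.
move=> c0 y0 xy; have c1 : 0 < c + 1 by rewrite ltr_wpDl.
apply: (@le_trans _ _ ((c + 1) * (y / (c + 1)))); last by rewrite mulrC divfK ?gt_eqF.
have := divr_gt0 y0 c1; move: (y / (c + 1)) xy => q xq q0.
by rewrite (le_trans (ler_wpM2l c0 (ltW xq))) // ler_wpM2r ?lerDl // ltW.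
Qed.

Lemma lt_double (i1 i2 q : R) : `|i1 - i2| < q -> i1 < q -> i2 < 2 * q.
Proof. by rewrite ltr_norml => /andP[? _] ?; lra. Qed.

Lemma error_budget (e i1 i2 i3 j1 j2 : R) : 0 < e -> i1 <= 2 * (e / 8) -> i2 <= e / 8 ->
  i3 <= j1 + j2 -> j1 <= e / 8 -> j2 <= e / 8 -> i1 + (i2 + i3) < e.
Proof. lra. Qed.

(* A Lipschitz substitute for the indicator of leaving the ball of radius K: it is 1 when
   sup |u| >= K - 1, the margin 1 absorbing the averaging error, and 0 when
   sup |u| <= K - 2. *)
Definition cutoff (T K : R) (u : R -> V) : R := clip 0 1 (sup_norm T u - (K - 2)).

Lemma cutoff01 T K u : 0 <= cutoff T K u <= 1.
Proof. exact: clip_itv. Qed.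

Lemma cutoff_lt1 T K u t : continuous u -> cutoff T K u < 1 -> 0 <= t <= T -> `|u t| < K - 1.
Proof.
move=> uc; rewrite /cutoff => h tT; apply: (le_lt_trans (sup_norm_ge uc tT)).
rewrite ltNge; apply/negP => h'; move: h; rewrite ltNge => /negP; apply.
by rewrite /clip le_max le_min lexx /= orbC lerBrDr; apply/orP; left; lra.
Qed.

Lemma cutoff_eq0 T K u : sup_norm T u <= K - 2 -> cutoff T K u = 0.
Proof.
move=> h; rewrite /cutoff /clip; apply/max_idPl; rewrite ge_min; apply/orP; right.
by rewrite subr_le0.
Qed.

Lemma cutoff_dist T K (u v : R -> V) a : 0 <= T -> continuous u -> continuous v ->
  (forall t, 0 <= t <= T -> `|u t - v t| <= a) -> `|cutoff T K u - cutoff T K v| <= a.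
Proof.
move=> T0 uc vc uv; apply: (le_trans (clip_lip _ _ _ _)).
have -> : sup_norm T u - (K - 2) - (sup_norm T v - (K - 2)) = sup_norm T u - sup_norm T v.
  by ring.
exact: sup_norm_dist.
Qed.

Section fixed_truncation.
Context (K L M : R) (K0 : 0 <= K) (tf : trunc_fields Lambda phi mu f K L M).

Let Gc p : continuous (G K p).
Proof. exact: (avg_sol_cont tf). Qed.

Lemma pt_avg_path p t : 0 <= t -> pt (path_of (G K p)) t = G K p t.
Proof. by move=> t0; apply: pt_path_of => //; apply: continuous_subspaceT; exact: Gc. Qed.

Lemma cutoff_avg_lip T : 0 <= T -> path_lip T (expR (L * T)) (fun p => cutoff T K (G K p)).
Proof.
move=> T0 p q a pq; apply: cutoff_dist => //; [exact: Gc..|].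
by move=> t tT; rewrite mulrC; exact: (avg_sol_lip xi tf pq).
Qed.

(** Continuous mapping in Lipschitz form: the solution map multiplies the Lipschitz constant by its
    Gronwall factor. *)
Lemma avg_path_lip T k Psi : path_lip T k Psi ->
  path_lip T (k * expR (L * T)) (fun p => Psi (path_of (G K p))).
Proof.
move=> PL p q a pq; rewrite -mulrA; apply: PL => t tT; have [t0 _] := andP tT.
rewrite [_ * a]mulrC; apply: le_trans (avg_sol_lip xi tf pq tT).
by rewrite le_eqVlt; apply/orP; left; apply/eqP; congr (`|_ - _|); exact: pt_avg_path.
Qed.

Lemma sde_avg_sol T w : 0 <= T ->
  (forall t, 0 <= t -> X w t = xi + scaled_path S W w t + time_integral t (fun s => F (X w s))) ->
  (forall t, 0 <= t <= T -> `|X w t| <= K) ->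
  forall t, 0 <= t <= T -> X w t = G K (SW w) t.
Proof.
move=> T0 HX XK; have [rX _] := sde; have [_ rS _] := wip.
have Xw := random_path_within rX (I : setT w).
have Sw := random_path_within rS (I : setT w).
pose U := X w \o clip 0 T.
have Uc : continuous U.
  apply: (within_clip T0 _ Xw) => t /=; rewrite in_itv /= => /andP[t0 _]; exact: t0.
have UX t : 0 <= t <= T -> X w t = U t by move=> tT; rewrite /U /= clip_id.
move=> t tT; rewrite UX //; apply/eqP.
rewrite -subr_eq0 -normr_eq0 eq_le normr_ge0 andbT.
have := ode_stability (tf_avg tf) Uc (@Gc (SW w)) (a := 0) (T := T).
rewrite mul0r; apply => // s sT; have [s0 sT'] := andP sT.
have -> : ode_defect (avg_field Lambda mu f K) U s = xi + scaled_path S W w s.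
  rewrite /ode_defect -(UX s sT) (HX s s0).
  have -> : time_integral s (fun q => F (X w q)) =
      time_integral s (fun q => avg_field Lambda mu f K q (U q)).
    apply: eq_ti => q /andP[q0 qs]; have qT : 0 <= q <= T by rewrite q0 (le_trans qs).
    by rewrite /avg_field -(UX q qT) (clipv_id (XK q qT)).
  by rewrite addrK.
have -> : ode_defect (avg_field Lambda mu f K) (G K (SW w)) s = xi + scaled_path S W w s.
  rewrite /ode_defect {1}(avg_solE xi tf (SW w) s) addrK.
  by congr (_ + _); exact: pt_path_of.
by rewrite subrr normr0.
Qed.

(* The modulus of continuity of the
   noise is controlled by the invariance principle, the frozen oscillations by
   the ergodic theorem. *)
Lemma averaging_error T e : 0 <= T -> 0 < e -> \forall eps \near 0^'+,
  exists b : Y -> R, [/\ bounded_mfun D b, \int[mu]_(eta in D) b eta < e,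
    forall eta, Lambda eta -> 0 <= b eta &
    forall eta t, Lambda eta -> 0 <= t <= T ->
      `|Z K eps eta t - G K (N_ eps eta) t| <= b eta].
Proof.
move=> T0 e0; have L0 : 0 <= L := le_trans ler01 (tf_L tf); have M0 := tf_M tf.
have [_ rS _] := wip.
set C := expR (L * T); have C0 : 0 <= C by exact: expR_ge0.
have e8 : 0 < e / 8 by rewrite divr_gt0.
(* These are the coefficients of [averaging_bound] once its factors [T] and [C] are distributed: for
   the modulus, the window length and the mesh of the net. The choices are made in the order
   [gamma], net, [N], [eps]. *)
pose c1 := (2 * L + 4 * M) * T * C; pose c3 := (2 * L * M * T + 2 * M) * C.
pose c4 := 2 * L * T * C.
have c10 : 0 <= c1 by rewrite !mulr_ge0 // addr_ge0 // mulr_ge0.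
have c30 : 0 <= c3 by rewrite mulr_ge0 // addr_ge0 // !mulr_ge0.
have c40 : 0 <= c4 by rewrite !mulr_ge0.
pose gamma := e / 8 / (c4 + 1).
have gamma0 : 0 < gamma by rewrite divr_gt0 // ltr_wpDl.
have hgamma : c4 * gamma <= e / 8.
  apply: (@le_trans _ _ ((c4 + 1) * gamma)); first by rewrite ler_wpM2r ?(ltW gamma0) // lerDl.
  by rewrite /gamma mulrC divfK // gt_eqF // ltr_wpDl.
have [us Hus] := norm_ball_net d K gamma0.
pose mm (m : nat) (p : path_space R d) := Num.min 1 (modulus T (T / m.+1%:R) p) : R.
have mmL m : path_lip T 2 (mm m).
  by apply: path_lip_min1; apply: modulus_lip => //; rewrite divr_ge0.
have mmB m p : `|mm m p| <= 1.
  have h : 0 <= modulus T (T / m.+1%:R) p by apply: modulus_ge0 => //; rewrite divr_ge0.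
  by rewrite ger0_norm ?le_min ?ler01 // ge_min lexx.
(* The limit paths are continuous, so their modulus tends to 0; the cut at 1 permits dominated
   convergence. *)
have mmc : \int[P]_w mm m (SW w) @[m --> \oo] --> (0 : R).
  have -> : (0 : R) = \int[P]_w (fun _ => 0) w by rewrite Rintegral_cst // mul0r.
  apply: (@expect_dct _ _ _ P setT measurableT _ _ 1).
  - by move=> m; have [] := random_path_bmf rS (path_lip_continuous T0 (mmL m)) (mmB m).
  - exact: measurable_cst.
  - by move=> m w _; exact: mmB.
  apply: aeW => w _; apply/cvgrPdist_le => r r0.
  have /cvgrPdist_le /(_ _ r0) := modulus_cvg0 (SW w) T0 T0.
  apply: filterS => m; rewrite !sub0r !normrN; apply: le_trans.
  have h : 0 <= modulus T (T / m.+1%:R) (SW w) by apply: modulus_ge0 => //; rewrite divr_ge0.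
  by rewrite !ger0_norm ?le_min ?ler01 // ge_min lexx orbT.
have c11 : 0 < c1 + 1 by rewrite ltr_wpDl.
have e81 : 0 < e / 8 / (c1 + 1) by rewrite divr_gt0.
have /cvgrPdist_lt /(_ _ e81) Hm1 := mmc.
have [N [hN1 hN2]] : exists N, \int[P]_w mm N (SW w) < e / 8 / (c1 + 1) /\
    c3 * (T / N.+1%:R) <= e / 8.
  near \oo => N; exists N; split.
    have : `|0 - \int[P]_w mm N (SW w)| < e / 8 / (c1 + 1) by near: N.
    by rewrite sub0r normrN; apply: le_lt_trans; exact: ler_norm.
  rewrite mulrA ler_pdivrMr ?ltr0n // [leRHS]mulrC -ler_pdivrMr //.
  by apply: (@le_trans _ _ N%:R); [near: N; exact: nbhs_infty_ger|rewrite ler_nat].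
pose c2 := 2 * N.+1%:R * C.
have c20 : 0 <= c2 by rewrite !mulr_ge0.
have c21 : 0 < c2 + 1 by rewrite ltr_wpDl.
have e82 : 0 < e / 8 / (c2 + 1) by rewrite divr_gt0.
have H1 := wip_eps cL glip fl f0lip wip T0 (ler0n R 2) (mmL N) (mmB N).
have /cvgrPdist_lt /(_ _ e81) H1' := H1.
set delta := T / N.+1%:R.
have d0 : 0 <= delta by rewrite divr_ge0.
have bfi (c : R) (j : 'I_N.+2) u : 0 <= c ->
    bounded_mfun D (fun eta => `|fast_integral phi (osc Lambda mu f K u) c (j%:R * delta) eta|).
  move=> c0; have [oL oM o0] := tf_osc tf u.
  by apply: (fast_integral_bmf cL glip fl oL L0 oM c0); rewrite mulr_ge0.
have H2 : \sum_(j < N.+2) \sum_(u <- us) \int[mu]_(eta in D)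
     `|fast_integral phi (osc Lambda mu f K u) (eps ^+ 2)^-1 (j%:R * delta) eta| @[eps --> 0^'+]
     --> (0 : R).
  apply: (@cvg_big_sum R _ _ _ _ _ (fun (j : 'I_N.+2) (eps : R) => \sum_(u <- us) \int[mu]_(eta in D)
     `|fast_integral phi (osc Lambda mu f K u) (eps ^+ 2)^-1 (j%:R * delta) eta|)) => j.
  apply: (@cvg_big_sum R _ _ _ _ _ (fun (u : V) (eps : R) => \int[mu]_(eta in D)
     `|fast_integral phi (osc Lambda mu f K u) (eps ^+ 2)^-1 (j%:R * delta) eta|)) => u.
  have [oL oM o0] := tf_osc tf u.
  by apply: (fast_average_cvg cL glip fl erg oL L0 (addr_ge0 M0 M0) oM o0); rewrite mulr_ge0.
have /cvgrPdist_lt /(_ _ e82) H2' := H2.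
near=> eps.
have eps0 : 0 < eps by near: eps; exact: nbhs_right_gt.
have c0 : 0 <= (eps ^+ 2)^-1 by rewrite invr_ge0 exprn_ge0 // ltW.
have h1 : `|\int[P]_w mm N (SW w) - \int[mu]_(eta in D) mm N (N_ eps eta)| < e / 8 / (c1 + 1).
  by near: eps.
have h2 : `|0 - \sum_(j < N.+2) \sum_(u <- us) \int[mu]_(eta in D)
     `|fast_integral phi (osc Lambda mu f K u) (eps ^+ 2)^-1 (j%:R * delta) eta| |
    < e / 8 / (c2 + 1) by near: eps.
pose OS eta := osc_sum Lambda phi mu f K us (eps ^+ 2)^-1 delta N.+1 eta.
have bm : bounded_mfun D (fun eta => mm N (N_ eps eta)).
  exact: (noise_path_bmf cL glip fl f0lip eps0 T0 (ler0n R 2) (mmL N) (mmB N)).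
have bS : bounded_mfun D OS.
  apply: bounded_mfun_sum => j; apply: bounded_mfun_sum => u; exact: bfi.
have ES : \int[mu]_(eta in D) OS eta < e / 8 / (c2 + 1).
  have -> : \int[mu]_(eta in D) OS eta = \sum_(j < N.+2) \sum_(u <- us) \int[mu]_(eta in D)
     `|fast_integral phi (osc Lambda mu f K u) (eps ^+ 2)^-1 (j%:R * delta) eta|.
    rewrite (@expect_sum _ _ _ mu D mD); last first.
      by move=> j; apply: bounded_mfun_sum => u; exact: bfi.
    apply: eq_bigr => j _; rewrite (@expect_sum _ _ _ mu D mD) // => u.
    exact: bfi.
  by move: h2; rewrite sub0r normrN; apply: le_lt_trans; exact: ler_norm.
(* The modulus is small in mean for the limit process; weak convergence at fixed [N] transfers this
   to the noise at the price of a factor 2. *)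
have Em : \int[mu]_(eta in D) mm N (N_ eps eta) < 2 * (e / 8 / (c1 + 1)).
  exact: lt_double h1 hN1.
exists (fun eta => c1 * mm N (N_ eps eta) + (c2 * OS eta + (c3 * delta + c4 * gamma))).
have bc := bounded_mfun_cst D (c3 * delta + c4 * gamma).
have b1 := bounded_mfunZ c1 bm; have b2 := bounded_mfunZ c2 bS.
have b3 := bounded_mfunD b2 bc.
split.
- exact: (bounded_mfunD b1 b3).
- rewrite (@expectD _ _ _ mu D mD _ _ b1 b3) (@expectD _ _ _ mu D mD _ _ b2 bc).
  rewrite (@expectZ _ _ _ mu D mD _ _ bm) (@expectZ _ _ _ mu D mD _ _ bS).
  have cc0 : 0 <= c3 * delta + c4 * gamma by rewrite addr_ge0 // mulr_ge0 // ltW.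
  have k3 := @expect_cst_le _ _ _ mu D mD _ cc0.
  have k1 : c1 * \int[mu]_(eta in D) mm N (N_ eps eta) <= 2 * (e / 8).
    have h := mulr_gt0 (ltr0Sn R 1) e8; apply: (scaled_lt c10 h).
    by rewrite -(mulrA 2).
  have k2 : c2 * \int[mu]_(eta in D) OS eta <= e / 8 by exact: scaled_lt.
  rewrite -/delta in hN2.
  exact: (error_budget e0 k1 k2 k3 hN2 hgamma).
- move=> eta Le; have OS0 : 0 <= OS eta.
    by apply: sumr_ge0 => j _; apply: sumr_ge0 => u _.
  have mm0 : 0 <= mm N (N_ eps eta) by rewrite le_min ler01 modulus_ge0.
  have p1 := mulr_ge0 c10 mm0; have p2 := mulr_ge0 c20 OS0.
  have p3 := addr_ge0 (mulr_ge0 c30 d0) (mulr_ge0 c40 (ltW gamma0)).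
  exact: (addr_ge0 p1 (addr_ge0 p2 p3)).
move=> eta t Le tT.
have := averaging_bound xi cL fl f0lip flip K0 tf eps Le N T0 (ltW gamma0) Hus tT.
rewrite -/delta -/C => /le_trans; apply; rewrite le_eqVlt; apply/orP; left; apply/eqP.
rewrite /c1 /c2 /c3 /c4 /mm -/delta -/(OS eta).
move: (Num.min _ _) (OS eta) => q1 q2; ring.
Unshelve. all: by end_near. Qed.

End fixed_truncation.

Lemma le_expect_ae (u v : Omega -> R) : bounded_mfun setT u -> bounded_mfun setT v ->
  {ae P, forall w, u w <= v w} -> \int[P]_w u w <= \int[P]_w v w.
Proof.
move=> bu bv uv; have bB := bounded_mfunB bv bu.
rewrite -subr_ge0 -(@expectB _ _ _ P setT measurableT _ _ bv bu).
rewrite (@eq_expect_ae _ _ _ P setT measurableT _ _ bB (bounded_mfun_norm bB)).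
  have := @le_expect _ _ _ P setT measurableT _ _ (bounded_mfun_cst setT 0) (bounded_mfun_norm bB).
  by rewrite Rintegral_cst // mul0r; apply => w _; exact: normr_ge0.
by apply: filterS uv => w uv _; rewrite ger0_norm // subr_ge0.
Qed.

(** Each path of [X] is bounded on [0, T], so the mean of its cutoff at level n tends to 0. Where
    that cutoff is below 1, [X] coincides with the truncated solution; elsewhere two values of [Psi]
    differ by at most 2 B. The radius is chosen before [L] and [M], which depend on it. *)
Lemma truncation_error T e : 0 <= T -> 0 < e -> exists K, 0 <= K /\
  forall L M, trunc_fields Lambda phi mu f K L M ->
  \int[P]_w cutoff T K (G K (SW w)) <= e /\
  forall k B Psi, 0 <= k -> path_lip T k Psi -> 0 <= B -> (forall p, `|Psi p| <= B) ->
   `|\int[P]_w Psi (path_of (X w)) - \int[P]_w Psi (path_of (G K (SW w)))| <= 2 * B * e.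
Proof.
move=> T0 e0; have [rX aX] := sde; have [_ rS _] := wip.
pose q (n : nat) (p : path_space R d) := cutoff T n%:R (pt p).
have qL n : path_lip T 1 (q n).
  move=> p p' a pp'; rewrite mul1r; apply: cutoff_dist => //; exact: pt_cont.
have qB n p : `|q n p| <= 1.
  by have /andP[q0 q1] := cutoff01 T n%:R (pt p); rewrite ger0_norm.
have bq n := random_path_bmf rX (path_lip_continuous T0 (@qL n)) (@qB n).
have qc : \int[P]_w q n (path_of (X w)) @[n --> \oo] --> (0 : R).
  have -> : (0 : R) = \int[P]_w (fun _ => 0) w by rewrite Rintegral_cst // mul0r.
  apply: (@expect_dct _ _ _ P setT measurableT _ _ 1).
  - by move=> n; have [] := bq n.
  - exact: measurable_cst.
  - by move=> n w _; exact: qB.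
  apply: aeW => w _; apply: cvg_near_cst.
  near=> n; apply: cutoff_eq0; rewrite lerBrDr.
  by near: n; exact: nbhs_infty_ger.
have /cvgrPdist_lt /(_ _ e0) Hq := qc.
have [n hn] : exists n, \int[P]_w q n (path_of (X w)) <= e.
  near \oo => n; exists n.
  have : `|0 - \int[P]_w q n (path_of (X w))| < e by near: n.
  by rewrite sub0r normrN => /ltW; apply: le_trans; exact: ler_norm.
(* One unit more than the level n of the cutoff of [X]: below 1 that cutoff gives |X| < n - 1 = K -
   2, exactly where the cutoff of radius [K] vanishes. *)
exists n.+1%:R; split => // L M tf.
have Gc p : continuous (G n.+1%:R p) by exact: (avg_sol_cont tf).
pose Q w := q n (path_of (X w)).
have Q01 w : 0 <= Q w <= 1 by exact: cutoff01.
have key : {ae P, forall w, Q w < 1 -> forall t, 0 <= t <= T ->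
    `|X w t| <= n.+1%:R - 2 /\ X w t = G n.+1%:R (SW w) t}.
  apply: filterS aX => w HX Qw t tT.
  have Xb s : 0 <= s <= T -> `|X w s| <= n.+1%:R - 2.
    move=> sT; have [s0 _] := andP sT.
    have := cutoff_lt1 (@pt_cont _ _ (path_of (X w))) Qw sT.
    by rewrite (pt_path_of (random_path_within rX (I : setT w)) s0) -natr1 => /ltW; lra.
  split; first exact: Xb.
  by apply: (sde_avg_sol tf T0 HX _ tT) => s /Xb; lra.
have GB p : `|cutoff T n.+1%:R (G n.+1%:R p)| <= 1.
  by have /andP[q0 q1] := cutoff01 T n.+1%:R (G n.+1%:R p); rewrite ger0_norm.
have bG := random_path_bmf rS (path_lip_continuous T0 (cutoff_avg_lip tf T0)) GB.
split.
  apply: le_trans hn; apply: le_expect_ae => //.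
  apply: filterS key => w kw; have /andP[q0 q1] := Q01 w.
  have [/kw H|Q1] := ltP (Q w) 1; last first.
    by apply: le_trans Q1; have /andP[] := cutoff01 T n.+1%:R (G n.+1%:R (SW w)).
  rewrite (_ : cutoff _ _ _ = 0) //; apply: cutoff_eq0; apply: sup_norm_le => // t tT.
  by have [h <-] := H t tT.
move=> k B Psi k0 PL B0 PB.
have bX := random_path_bmf rX (path_lip_continuous T0 PL) PB.
have bP : bounded_mfun setT (fun w => Psi (path_of (G n.+1%:R (SW w)))).
  apply: (random_path_bmf rS (path_lip_continuous T0 (avg_path_lip tf PL))) => p.
  exact: PB.
rewrite -(@expectB _ _ _ P setT measurableT _ _ bX bP).
apply: (le_trans (@norm_expect_le _ _ _ P setT measurableT _ (bounded_mfunB bX bP))).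
apply: (@le_trans _ _ (2 * B * \int[P]_w Q w)); last first.
  by apply: ler_wpM2l => //; rewrite mulr_ge0.
rewrite -(@expectZ _ _ _ P setT measurableT _ _ (bq n)).
apply: le_expect_ae; [exact: (bounded_mfun_norm (bounded_mfunB bX bP))|exact: bounded_mfunZ (bq n)|].
apply: filterS key => w kw; have /andP[q0 q1] := Q01 w.
have [/kw H|Q1] := ltP (Q w) 1.
  apply: (@le_trans _ _ (k * 0)); last by rewrite mulr0 mulr_ge0 // mulr_ge0.
  apply: PL => t tT; have [t0 _] := andP tT.
  rewrite (pt_path_of (random_path_within rX (I : setT w)) t0) (pt_avg_path tf _ t0).
  by have [_ <-] := H t tT; rewrite subrr normr0.
apply: (@le_trans _ _ (B + B)); first by rewrite (le_trans (ler_normB _ _)) // lerD.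
have -> : B + B = 2 * B * 1 by ring.
by apply: ler_wpM2l => //; rewrite mulr_ge0.
Unshelve. all: by end_near. Qed.

End assembly.

(** * From the approximation to convergence in law *)

Section conclusion.
Context (R : realType) (d l : nat).
Local Notation V := 'rV[R]_d.
Local Notation Y := 'rV[R]_l.
Context (g : Y -> Y) (Lambda : set Y) (phi : R -> Y -> Y) (mu : probability (borel Y) R).
Context (f0 : Y -> V) (f : V * Y -> V) (xi : V).
Hypotheses (cL : compact Lambda) (glip : locally_lipschitz setT g)
  (fl : invariant_flow g Lambda phi) (erg : ergodic_measure Lambda phi mu)
  (f0lip : locally_lipschitz Lambda f0)
  (flip : locally_lipschitz (setT `*` Lambda) f).
Local Notation D := (Lambda : set (borel Y)).
Local Notation F z := (row_integral mu D (fun eta => f (z, eta))).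
Context (S : 'M[R]_d) (disp : measure_display) (Omega : measurableType disp)
  (P : probability Omega R) (W X : Omega -> R -> V).
Hypothesis wip : mildly_chaotic f0 Lambda phi mu S P W.
Hypothesis sde : sde_solution xi S (fun z => F z) P W X.
Context (tau : R -> Y -> \bar R) (x : R -> Y -> R -> V) (y : R -> Y -> R -> Y).
Hypothesis sol : forall (eps : R) eta, 0 < eps -> Lambda eta ->
  maximal_solution f0 f g Lambda xi eps eta (tau eps eta) (x eps eta) (y eps eta).
Local Notation SW w := (path_of (scaled_path S W w)).
Local Notation G := (avg_sol Lambda mu f xi).
Local Notation Z := (trunc_sol phi f0 f xi).
Local Notation N_ := (noise_path phi f0).
Local Notation stopped eps eta := (stopped_path (tau eps eta) (x eps eta)).

Let mD : measurable D := compact_borel cL.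

Section pointwise.
Context (K L M : R) (K0 : 0 <= K) (tf : trunc_fields Lambda phi mu f K L M).
Context (T b eps : R) (eta : Y) (T0 : 0 <= T) (e0 : 0 < eps) (Le : Lambda eta).
Hypothesis b0 : 0 <= b.
Hypothesis Zb : forall t, 0 <= t <= 2 * T + 1 -> `|Z K eps eta t - G K (N_ eps eta) t| <= b.
Local Notation c := (cutoff (2 * T + 1) K (G K (N_ eps eta))).

(** Both [b] and the cutoff are nonnegative, so each is below 1: the averaged solution stays below K
    - 1 and the truncated one within distance 1 of it. *)
Let Z_lt (t : R) : b + c < 1 -> 0 <= t <= 2 * T + 1 -> `|Z K eps eta t| < K.
Proof.
move=> bc tT; have /andP[c0 c1] := cutoff01 (2 * T + 1) K (G K (N_ eps eta)).
have b1 : b < 1 by apply: le_lt_trans bc; rewrite lerDl.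
have c1' : c < 1 by apply: le_lt_trans bc; rewrite lerDr.
have h1 := Zb tT; have h2 := cutoff_lt1 (@avg_sol_cont _ _ _ _ _ _ _ _ _ _ _ tf _) c1' tT.
have h3 := ler_normD (Z K eps eta t - G K (N_ eps eta) t) (G K (N_ eps eta) t).
rewrite subrK in h3; apply: (le_lt_trans h3).
move: `|_ - _| `|G _ _ _| h1 h2 b1 => p q; lra.
Qed.

Let T'0 : 0 <= 2 * T + 1. Proof. by rewrite addr_ge0 // mulr_ge0. Qed.

Let tau_gt : b + c < 1 -> ((2 * T + 1)%:E < tau eps eta)%E.
Proof.
move=> bc; apply: (trunc_sol_tau cL fl f0lip flip Le (sol e0 Le) K0 T'0) => t.
exact: Z_lt.
Qed.

(** The horizon 2 T + 1 comes from stopping at half the blow-up time: control on [0, T] requires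
    existence beyond 2 T. *)
Lemma blow_up_cutoff : (tau eps eta <= (2 * T)%:E)%E -> 1 <= b + c.
Proof.
move=> h; rewrite leNgt; apply/negP => /tau_gt h'.
by have := lt_le_trans h' h; rewrite lte_fin ltNge lerDl ler01.
Qed.

(** If b + c < 1, neither truncation nor stopping acts on [0, T] and the paths differ by at most
    [b]. Otherwise b + c >= 1, and the trivial bound 2 B is at most 2 B (b + c). *)
Lemma stopped_dist k B Psi : 0 <= k -> path_lip T k Psi -> 0 <= B ->
  (forall p, `|Psi p| <= B) ->
  `|Psi (path_of (stopped eps eta)) - Psi (path_of (G K (N_ eps eta)))| <=
    k * b + 2 * B * (b + c).
Proof.
move=> k0 PL B0 PB; have /andP[c0 c1] := cutoff01 (2 * T + 1) K (G K (N_ eps eta)).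
have BB0 : 0 <= 2 * B by rewrite mulr_ge0.
have [bc|bc] := ltP (b + c) 1; last first.
  apply: (@le_trans _ _ (B + B)); first by rewrite (le_trans (ler_normB _ _)) // lerD.
  have -> : B + B = 2 * B * 1 by ring.
  by apply: (@le_trans _ _ (2 * B * (b + c))); rewrite ?ler_wpM2l // lerDr mulr_ge0.
apply: (@le_trans _ _ (k * b)); last by rewrite lerDl mulr_ge0 // addr_ge0.
apply: PL => t /andP[t0 tT].
have tT' : 0 <= t <= 2 * T + 1.
  by rewrite t0 (le_trans tT) //; move: T0; lra.
rewrite (pt_stopped cL glip fl f0lip flip e0 (fun eta => sol e0) Le t0).
rewrite (pt_avg_path xi tf _ t0).
have -> : stopped eps eta t = x eps eta t.
  have := tau_gt bc; rewrite /stopped_path.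
  case: (tau eps eta) => [r| |] //; rewrite lte_fin => hr.
  by congr (x eps eta _); apply/min_idPl; move: T0 hr tT; lra.
rewrite (trunc_sol_eq cL glip fl f0lip flip e0 Le (sol e0 Le) K0 T'0 _ tT') //.
  exact: Zb.
by move=> s; exact: Z_lt.
Qed.

End pointwise.

(** [b] bounds the averaging error and [q] dominates the indicator of an early blow-up. The mean of
    [q] is below 3 e: one e for [b], one for the cutoff of the limit process, and one for the weak
    convergence of the cutoffs. *)
Definition close_in_mean K T e eps : Prop :=
  exists b q : Y -> R, [/\ bounded_mfun D b, bounded_mfun D q,
    \int[mu]_(eta in D) b eta < e, \int[mu]_(eta in D) q eta < 3 * e &
    forall eta, Lambda eta -> [/\ 0 <= b eta, (tau eps eta <= (2 * T)%:E)%E -> 1 <= q eta,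
      0 <= q eta &
      forall k B Psi, 0 <= k -> path_lip T k Psi -> 0 <= B -> (forall p, `|Psi p| <= B) ->
      `|Psi (path_of (stopped eps eta)) - Psi (path_of (G K (N_ eps eta)))| <=
        k * b eta + 2 * B * q eta]].

Lemma approximation T e : 0 <= T -> 0 < e -> exists K L M, [/\ 0 <= K,
  trunc_fields Lambda phi mu f K L M,
  forall k B Psi, 0 <= k -> path_lip T k Psi -> 0 <= B -> (forall p, `|Psi p| <= B) ->
   `|\int[P]_w Psi (path_of (X w)) - \int[P]_w Psi (path_of (G K (SW w)))| <= 2 * B * e &
  \forall eps \near 0^'+, close_in_mean K T e eps].
Proof.
move=> T0 e0; have T'0 : 0 <= 2 * T + 1 by rewrite addr_ge0 // mulr_ge0.
have TT' : T <= 2 * T + 1 by move: T0; lra.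
have [K [K0 HK]] := truncation_error wip sde T'0 e0.
have [L [M tf]] := trunc_fields_exist cL fl erg flip K0.
have [Hc HX] := HK _ _ tf; exists K, L, M; split => //.
  move=> k B Psi k0 PL B0 PB; apply: (HX k) => // p q a pq; apply: PL => t /andP[t0 tT].
  by apply: pq; rewrite t0 (le_trans tT).
have CL := cutoff_avg_lip xi tf T'0.
have CB p : `|cutoff (2 * T + 1) K (G K p)| <= 1.
  by have /andP[q0 q1] := cutoff01 (2 * T + 1) K (G K p); rewrite ger0_norm.
have /cvgrPdist_lt /(_ _ e0) H1 := wip_eps cL glip fl f0lip wip T'0 (expR_ge0 _) CL CB.
have H2 := averaging_error xi cL glip fl erg f0lip flip wip K0 tf T'0 e0.
near=> eps.
have eps0 : 0 < eps by near: eps; exact: nbhs_right_gt.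
have h1 : `|\int[P]_w cutoff (2 * T + 1) K (G K (SW w)) -
    \int[mu]_(eta in D) cutoff (2 * T + 1) K (G K (N_ eps eta))| < e by near: eps.
have : exists b : Y -> R, [/\ bounded_mfun D b, \int[mu]_(eta in D) b eta < e,
    forall eta, Lambda eta -> 0 <= b eta &
    forall eta t, Lambda eta -> 0 <= t <= 2 * T + 1 ->
      `|Z K eps eta t - G K (N_ eps eta) t| <= b eta] by near: eps.
move=> [b [bb Eb b0 Zb]].
have bc := noise_path_bmf cL glip fl f0lip eps0 T'0 (expR_ge0 _) CL CB.
exists b, (fun eta => b eta + cutoff (2 * T + 1) K (G K (N_ eps eta))).
split => //; first exact: bounded_mfunD.
  rewrite (@expectD _ _ _ mu D mD _ _ bb bc).
  move: h1 Hc Eb; move: (\int[P]_w _) (\int[mu]_(eta in D) b eta) => I1 I2.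
  move: (\int[mu]_(eta in D) _) => I3; rewrite ltr_norml => /andP[h1 _] h2 h3.
  move: h1 h2 h3; lra.
move=> eta Le; split; first exact: b0.
- exact: (blow_up_cutoff K0 tf T0 eps0 Le (b0 _ Le) (fun t => Zb eta t Le)).
- by rewrite addr_ge0 ?b0 //; have /andP[] := cutoff01 (2 * T + 1) K (G K (N_ eps eta)).
- exact: (stopped_dist K0 tf T0 eps0 Le (b0 _ Le) (fun t => Zb eta t Le)).
Unshelve. all: by end_near. Qed.

Lemma blow_up_cvg (M : R) :
  mu (D `&` [set eta | (tau eps eta <= M%:E)%E]) @[eps --> 0^'+] --> 0%E.
Proof.
pose A eps : set (borel Y) := D `&` [set eta | (tau eps eta <= M%:E)%E].
have mA eps : 0 < eps -> measurable (A eps).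
  move=> e0; have := measurable_tau cL glip fl f0lip flip e0 (fun eta => sol e0).
  by move=> /(_ mD _ (emeasurable_itv `]-oo, M%:E]%O)); rewrite set_itvNyc.
have mAfin eps : 0 < eps -> mu (A eps) \is a fin_num.
  by move=> e0; apply: fin_num_measure; exact: mA.
apply: cvg_EFin; first by near=> eps; apply: mAfin; near: eps; exact: nbhs_right_gt.
apply/cvgrPdist_le => r r0; have r3 : 0 < r / 3 by rewrite divr_gt0.
(* A nonnegative horizon with M <= 2 T, so that blow-up before [M] forces 1 <= q; bounding the
   indicator by [q] is then Markov's inequality. *)
pose T := Num.max 0 M; have T0 : 0 <= T by rewrite le_max lexx.
have [K [L [N [K0 tf _ H]]]] := approximation T0 r3.
near=> eps.
have eps0 : 0 < eps by near: eps; exact: nbhs_right_gt.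
have : close_in_mean K T (r / 3) eps by near: eps.
move=> [b [q [_ bq _ Eq Hq]]].
rewrite sub0r normrN ger0_norm ?fine_ge0 //=.
have bA : bounded_mfun D (\1_(A eps) : Y -> R).
  split; first by apply: measurable_funTS; apply: measurable_indic; exact: mA.
  by exists 1 => eta _; rewrite indicE; case: (_ \in _); rewrite ?normr1 ?normr0.
have -> : fine (mu (D `&` [set eta | (tau eps eta <= M%:E)%E])) =
    \int[mu]_(eta in D) \1_(A eps) eta.
  rewrite /Rintegral integral_indic //; last exact: mA.
  by congr (fine (mu _)); rewrite /A setIAC setIid.
apply: (@le_trans _ _ (\int[mu]_(eta in D) q eta)); last first.
  by move: (ltW Eq); rewrite [3 * _]mulrC divfK.
apply: (@le_expect _ _ _ mu D mD) => // eta Le; have [_ h1 h2 _] := Hq _ Le.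
rewrite indicE; have [|//] := boolP (_ \in _); rewrite inE => -[_ tM].
apply: h1; apply: (le_trans tM); rewrite lee_fin.
have TM : M <= T by rewrite le_max lexx orbT.
by rewrite mulr_natl mulr2n (le_trans TM) // lerDl.
Unshelve. all: by end_near. Qed.

Lemma stopped_cvg T k B Psi : 0 <= T -> 0 <= k -> path_lip T k Psi ->
  (forall p, `|Psi p| <= B) ->
  \int[mu]_(eta in D) Psi (path_of (stopped eps eta)) @[eps --> 0^'+] -->
  \int[P]_w Psi (path_of (X w)).
Proof.
move=> T0 k0 PL PB; have B0 : 0 <= B := le_trans (normr_ge0 _) (PB (path_of (cst 0))).
apply/cvgrPdist_le => r r0.
have C0 : 0 < k + 8 * B + 1 by rewrite ltr_wpDl // addr_ge0 // mulr_ge0.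
(* The budget is 2 B e for truncating the limit, e for weak convergence, k e for the averaging error
   and 2 B (3 e) for the exceptional outcomes. *)
pose e := r / (k + 8 * B + 1); have e0 : 0 < e by rewrite divr_gt0.
have er : (k + 8 * B + 1) * e = r by rewrite /e mulrC divfK // gt_eqF.
have [K [L [N [K0 tf HX H]]]] := approximation T0 e0.
have GL := avg_path_lip xi tf PL.
have GB p : `|Psi (path_of (G K p))| <= B by exact: PB.
have ke0 : 0 <= k * expR (L * T) by rewrite mulr_ge0 // expR_ge0.
have /cvgrPdist_lt /(_ _ e0) H1 := wip_eps cL glip fl f0lip wip T0 ke0 GL GB.
near=> eps.
have eps0 : 0 < eps by near: eps; exact: nbhs_right_gt.
have : close_in_mean K T e eps by near: eps.
move=> [b [q [bb bq Eb Eq Hq]]].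
have h1 : `|\int[P]_w Psi (path_of (G K (SW w))) -
    \int[mu]_(eta in D) Psi (path_of (G K (N_ eps eta)))| < e by near: eps.
have h2 := HX k B Psi k0 PL B0 PB.
have bG := noise_path_bmf cL glip fl f0lip eps0 T0 ke0 GL GB.
have rS := random_stopped cL glip fl f0lip flip eps0 (fun eta => sol eps0).
have bS := random_path_bmf rS (path_lip_continuous T0 PL) PB.
have h3 : `|\int[mu]_(eta in D) Psi (path_of (stopped eps eta)) -
    \int[mu]_(eta in D) Psi (path_of (G K (N_ eps eta)))| <= k * e + 2 * B * (3 * e).
  rewrite -(@expectB _ _ _ mu D mD _ _ bS bG).
  apply: (le_trans (@norm_expect_le _ _ _ mu D mD _ (bounded_mfunB bS bG))).
  have bkb := bounded_mfunZ k bb; have bBq := bounded_mfunZ (2 * B) bq.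
  apply: (@le_trans _ _ (\int[mu]_(eta in D) (k * b eta + 2 * B * q eta))).
    apply: (@le_expect _ _ _ mu D mD _ _ (bounded_mfun_norm (bounded_mfunB bS bG))
      (bounded_mfunD bkb bBq)) => eta Le.
    by have [_ _ _ h] := Hq _ Le; exact: h.
  rewrite (@expectD _ _ _ mu D mD _ _ bkb bBq).
  rewrite (@expectZ _ _ _ mu D mD _ _ bb) (@expectZ _ _ _ mu D mD _ _ bq).
  by rewrite lerD // ler_wpM2l ?(ltW Eb) ?(ltW Eq) // mulr_ge0.
move: h1 h2 h3; move: (\int[P]_w Psi (path_of (X w))) (\int[P]_w _) => I1 I2.
move: (\int[mu]_(eta in D) Psi (path_of (stopped eps eta))) (\int[mu]_(eta in D) _) => I3 I4.
move=> h1 h2 h3.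
have -> : I1 - I3 = (I1 - I2) + (I2 - I4) - (I3 - I4) by ring.
apply: (le_trans (ler_normB _ _)); apply: (le_trans (lerD (ler_normD _ _) (lexx _))).
rewrite -er; move: (lerD (lerD h2 (ltW h1)) h3) => /le_trans; apply.
by rewrite le_eqVlt; apply/orP; left; apply/eqP; move: (k) (B) (e); move=> *; ring.
Unshelve. all: by end_near. Qed.

End conclusion.

Theorem theorem3p1 (R : realType) (d l : nat)
    (g : 'rV[R]_l -> 'rV[R]_l) (Lambda : set 'rV[R]_l)
    (phi : R -> 'rV[R]_l -> 'rV[R]_l) (mu : probability (borel 'rV[R]_l) R)
    (f0 : 'rV[R]_l -> 'rV[R]_d) (f : 'rV[R]_d * 'rV[R]_l -> 'rV[R]_d)
    (Sigma sqrtSigma : 'M[R]_d) (xi : 'rV[R]_d)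
    (disp : measure_display) (Omega : measurableType disp)
    (P : probability Omega R) (W X : Omega -> R -> 'rV[R]_d)
    (tau : R -> 'rV[R]_l -> \bar R)
    (x : R -> 'rV[R]_l -> R -> 'rV[R]_d)
    (y : R -> 'rV[R]_l -> R -> 'rV[R]_l) :
  locally_lipschitz setT g ->
  compact Lambda ->
  invariant_flow g Lambda phi ->
  ergodic_measure Lambda phi mu ->
  locally_lipschitz Lambda f0 ->
  locally_lipschitz (setT `*` Lambda) f ->
  row_integral mu Lambda f0 = 0 ->
  covariance_sqrt Sigma sqrtSigma ->
  brownian_motion P W ->
  mildly_chaotic f0 Lambda phi mu sqrtSigma P W ->
  let F := fun z => row_integral mu Lambda (fun eta => f (z, eta)) in
  (forall (eps : R) eta, 0 < eps -> Lambda eta ->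
    maximal_solution f0 f g Lambda xi eps eta
      (tau eps eta) (x eps eta) (y eps eta)) ->
  sde_solution xi sqrtSigma F P W X ->
  weak_cvg_blowup mu Lambda tau x P X.
Proof.
move=> glip cL fl erg f0lip flip _ _ _ wip F sol sde.
split.
- near=> eps; have eps0 : 0 < eps by near: eps; exact: nbhs_right_gt.
  exact: (measurable_tau cL glip fl f0lip flip eps0 (fun eta => sol eps eta eps0)).
- exact: (blow_up_cvg cL glip fl erg f0lip flip wip sde sol).
apply: weak_cvg_lip.
- exact: compact_borel.
- near=> eps; have eps0 : 0 < eps by near: eps; exact: nbhs_right_gt.
  exact: (random_stopped cL glip fl f0lip flip eps0 (fun eta => sol eps eta eps0)).
- by have [] := sde.
move=> T k B Psi T0 k0 PL PB.
exact: (stopped_cvg cL glip fl erg f0lip flip wip sde sol T0 k0 PL PB).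
Unshelve. all: by end_near. Qed.
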